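(* Let $T:[0,1]\to[0,1]$ be a Thaler map, and let $\mu$, $Y$, $A_0$, $A_1$, $\alpha$, $\ell$ and $a(\cdot)$ be as described in the context. Assume that $G\in\{u\in L^1(\mu):u\ge0\}$ admits a version which is Riemann integrable on $[0,1]$ with $\int_0^1G(x)\,dx>0$. Then there exists a constant $C_1\in(0,\infty)$ such that, for any positive-valued sequences $\{c(n)\}_{n\ge0}$ and $\{\tilde c(n)\}_{n\ge0}$ satisfying $c(n)\to0$, $c(n)n\to\infty$ and $\tilde c(n)\to0$, $\tilde c(n)a(n)\to\infty$ $(n\to\infty)$, we have $$C_1\le\liminf_{n\to\infty}\frac{\ell(c(n)n)}{c(n)^\alpha\ell(n)}\,\mu_G\Big(\frac{Z_n^Y}{n}\le c(n)\Big),\qquad C_1\le\liminf_{n\to\infty}\frac{1}{\tilde c(n)}\,\mu_G\Big(\frac{S_n^Y}{a(n)}\le\tilde c(n)\Big),$$ and $$C_1\le\liminf_{n\to\infty}\frac{\ell(c(n)n)}{c(n)^\alpha\ell(n)}\,\mu_G\Big(\frac{S_n^{A_i}}{n}\le c(n)\Big)\qquad(i=0,1).$$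
   Context: Thaler map. $T:[0,1]\to[0,1]$ satisfies: (i) for some $c\in(0,1)$ the restrictions $T:[0,c)\to[0,1)$ and $T:(c,1]\to(0,1]$ are strictly increasing, onto, and extend to $C^2$ maps $T_0:[0,c]\to[0,1]$ and $T_1:[c,1]\to[0,1]$ respectively; (ii) $T_0'>1$ and $T_0''>0$ on $(0,c]$, $T_1'>1$ and $T_1''<0$ on $[c,1)$, and $T'(0)=T'(1)=1$; (iii) there exist $p\in(1,\infty)$, $a\in(0,\infty)$ and a positive measurable $\ell^*:(0,\infty)\to(0,\infty)$ slowly varying at $0$ with $Tx-x\sim a^{-p}(1-x-T(1-x))\sim x^{p+1}\ell^*(x)$ $(x\to0+)$. Here $f\sim g$ means $f/g\to1$; a positive measurable function $\ell$ on $(0,\infty)$ is slowly varying at $\infty$ (resp. $0$) if $\ell(\lambda t)\sim\ell(t)$ as $t\to\infty$ (resp. $t\to0+$) for all $\lambda>0$. Invariant measure. Let $f_i$ be the inverse of $T_i$ $(i=0,1)$. It is known that $T$ admits an invariant density $h(x)=h_0(x)\frac{x(1-x)}{(x-f_0(x))(f_1(x)-x)}$, $x\in(0,1)$, with $h_0$ continuous and positive on $[0,1]$. Put $d\mu(x)=h(x)\,dx$; then $\mu$ is a $\sigma$-finite infinite measure on $([0,1],\mathcal B([0,1]))$ and $T$ is conservative, ergodic and $\mu$-preserving. Sets. Let $\gamma\in(0,c)$ be a $2$-periodic point of $T$ (so $T\gamma\in(c,1)$, $T^2\gamma=\gamma$). Fix arbitrary $c_0\in(0,\gamma]$, $c_1\in[T\gamma,1)$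 and set $A_0=[0,c_0)$, $Y=[c_0,c_1]$, $A_1=(c_1,1]$. Then $\mu(Y)\in(0,\infty)$ and $\mu(A_0)=\mu(A_1)=\infty$. Notation. For $0\le u\in L^1(\mu)$, $\mu_u(A)=\int_Au\,d\mu$; $\mu_u(\text{condition})$ is the $\mu_u$-measure of the set of points satisfying the condition. $\varphi(x)=\min\{k\ge1:T^kx\in Y\}$ ($\min\emptyset=\infty$), $Y_0=Y$, $Y_n=Y^c\cap\{\varphi=n\}$ for $n\ge1$, $w_n^Y=\sum_{k=0}^{n-1}\mu(Y_k)$, $w_n^{Y,A_i}=\sum_{k=0}^{n-1}\mu(Y_k\cap A_i)$, $Q^Y(s)=\sum_{n\ge0}e^{-ns}(w^Y_{n+1}-w^Y_n)$ for $s>0$. $Z_n^Y(x)=\max\{0\le k\le n:T^kx\in Y\}$ ($\max\emptyset=0$) and $S_n^A(x)=\sum_{k=1}^n1_A(T^kx)$. Parameters. $\alpha=1/p$, $\beta_0=\frac{T'(c-)}{T'(c-)+T'(c+)a^{-1}}$, $\beta_1=1-\beta_0$. It is known that there is a positive function $\ell:(0,\infty)\to(0,\infty)$ slowly varying at $\infty$ with $w_n^{Y,A_i}\sim\beta_in^{1-\alpha}\ell(n)$ $(n\to\infty,\ i=0,1)$; $\ell$ denotes such a function. Finally $a(t)=\frac{t}{\Gamma(1+\alpha)Q^Y(t^{-1})}$ for $t>0$ (the function $a(\cdot)$ is not to be confused with the constant $a$ in (iii)). *)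

(* Defs.v *)
From mathcomp Require Import all_boot all_order all_algebra.
From mathcomp Require Import all_classical all_reals all_analysis.

Set Implicit Arguments.
Unset Strict Implicit.
Unset Printing Implicit Defensive.

Import Order.TTheory GRing.Theory Num.Theory.
Import numFieldNormedType.Exports.

Local Open Scope classical_set_scope.
Local Open Scope ring_scope.

Section Analysis.
Variable R : realType.

Definition asymp_eq (F : set_system R) (f g : R -> R) : Prop :=
  f t / g t @[t --> F] --> (1 : R).

(* Used with F = +oo and F = 0^'+. *)
Definition slowly_varying (F : set_system R) (l : R -> R) : Prop :=
  [/\ measurable_fun (`]0, +oo[%classic : set R) l,
      forall t, 0 < t -> 0 < l t &
      forall lambda, 0 < lambda -> asymp_eq F (fun t => l (lambda * t)) l].

(* Difference quotients are taken inside D only, so that derivatives at the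
   end points of a closed interval are one-sided. *)
Definition diff_quot (f : R -> R) (x y : R) : R := (f y - f x) / (y - x).

Definition derivable_in (D : set R) (f : R -> R) (x : R) : Prop :=
  cvg (diff_quot f x y @[y --> within D x^']).

Definition derive_in (D : set R) (f : R -> R) (x : R) : R :=
  lim (diff_quot f x y @[y --> within D x^']).

Definition C2_on (D : set R) (f : R -> R) : Prop :=
  [/\ forall x, D x -> derivable_in D f x,
      forall x, D x -> derivable_in D (derive_in D f) x &
      {within D, continuous (derive_in D (derive_in D f))}].

(* The points of the partition are a = x_0 < x_1 < ... < x_m = b, where
   s = [:: x_1; ...; x_m], and xi i is the tag in [x_i, x_(i+1)]. *)
Definition is_riemann_integral (a b : R) (g : R -> R) (I : R) : Prop :=
  forall e, 0 < e -> exists2 d, 0 < d &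
    forall (s : seq R) (xi : nat -> R),
      itv_partition a b s ->
      (forall i, (i < size s)%N ->
         nth b (a :: s) i.+1 - nth b (a :: s) i < d /\
         nth b (a :: s) i <= xi i <= nth b (a :: s) i.+1) ->
      `|\sum_(0 <= i < size s)
           g (xi i) * (nth b (a :: s) i.+1 - nth b (a :: s) i) - I| < e.

(* Euler's Gamma function, for positive z. *)
Definition Gamma (z : R) : R :=
  \int[lebesgue_measure]_(t in `]0, +oo[) (t `^ (z - 1) * expR (- t)).

End Analysis.

Section ThalerMap.
Variable R : realType.
Implicit Types (T : R -> R) (c p a : R).

(* Self-maps of [0, 1] are functions R -> R whose values outside [0, 1] are
   irrelevant.  T0 and T1 are the C^2 extensions of the two branches. *)
Record thaler_map T (T0 T1 : R -> R) c p a : Prop := ThalerMap {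
  thaler_c : 0 < c < 1;
  thaler_self : forall x, 0 <= x <= 1 -> 0 <= T x <= 1;
  thaler_mono0 : {in `[0, c[ &, {homo T : x y / x < y}};
  thaler_mono1 : {in `]c, 1] &, {homo T : x y / x < y}};
  thaler_onto0 : T @` `[0, c[ = `[0, 1[%classic;
  thaler_onto1 : T @` `]c, 1] = `]0, 1]%classic;
  thaler_ext0 : {in `[0, c[, T0 =1 T};
  thaler_ext1 : {in `]c, 1], T1 =1 T};
  thaler_self0 : forall x, 0 <= x <= c -> 0 <= T0 x <= 1;
  thaler_self1 : forall x, c <= x <= 1 -> 0 <= T1 x <= 1;
  thaler_C2_0 : C2_on `[0, c] T0;
  thaler_C2_1 : C2_on `[c, 1] T1;
  thaler_d0 : forall x, 0 < x <= c -> 1 < derive_in `[0, c] T0 x;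
  thaler_dd0 : forall x, 0 < x <= c ->
    0 < derive_in `[0, c] (derive_in `[0, c] T0) x;
  thaler_d1 : forall x, c <= x < 1 -> 1 < derive_in `[c, 1] T1 x;
  thaler_dd1 : forall x, c <= x < 1 ->
    derive_in `[c, 1] (derive_in `[c, 1] T1) x < 0;
  thaler_indiff0 : derive_in `[0, c] T0 0 = 1;
  thaler_indiff1 : derive_in `[c, 1] T1 1 = 1;
  thaler_p : 1 < p;
  thaler_a : 0 < a;
  thaler_asymp : exists lstar : R -> R,
    [/\ slowly_varying 0^'+ lstar,
        asymp_eq 0^'+ (fun x => T x - x)
                      (fun x => a `^ (- p) * (1 - x - T (1 - x))) &
        asymp_eq 0^'+ (fun x => a `^ (- p) * (1 - x - T (1 - x)))
                      (fun x => x `^ (p + 1) * lstar x)]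
}.

Definition inverse_branch (D : set R) (S f : R -> R) : Prop :=
  (forall y, 0 <= y <= 1 -> D (f y) /\ S (f y) = y) /\
  (forall x, D x -> f (S x) = x).

Definition thaler_density (f0 f1 h0 : R -> R) (x : R) : R :=
  h0 x * (x * (1 - x) / ((x - f0 x) * (f1 x - x))).

(* mu is a measure on R which charges only ]0, 1[; the invariance clause is
   the one that characterizes h0, up to a multiplicative constant. *)
Record thaler_measure T (f0 f1 h0 : R -> R)
    (mu : {measure set (measurableTypeR R) -> \bar R}) : Prop := ThalerMeasure {
  thaler_h0_continuous : {within `[0, 1], continuous h0};
  thaler_h0_gt0 : forall x, 0 <= x <= 1 -> 0 < h0 x;
  thaler_muE : forall A : set (measurableTypeR R), measurable A ->
    mu A = (\int[lebesgue_measure]_(x in A `&` `]0%R, 1%R[)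
              (thaler_density f0 f1 h0 x)%:E)%E;
  thaler_invariant : forall A : set (measurableTypeR R), measurable A ->
    A `<=` `[0, 1] -> mu (`[0, 1] `&` T @^-1` A) = mu A
}.

Definition beta0 T c a : R :=
  let dl := lim (derive1 T x @[x --> c^'-]) in
  let dr := lim (derive1 T x @[x --> c^'+]) in
  dl / (dl + dr * a^-1).

Definition beta1 T c a : R := 1 - beta0 T c a.

End ThalerMap.

Section Statistics.
Variable R : realType.
Variable mu : {measure set (measurableTypeR R) -> \bar R}.
Variable T : R -> R.
Implicit Types (Y A : set R) (G : R -> R).

(* mu_G(E), for sets E of points of [0, 1] *)
Definition mu_density G (E : set R) : \bar R :=
  (\int[mu]_(x in `[0%R, 1%R] `&` E) (G x)%:E)%E.

(* min {k >= 1 : T^k x \in Y}, with value +oo on the empty set *)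
Definition hit_time Y (x : R) : \bar R :=
  ereal_inf [set (k%:R)%:E | k in [set k : nat | (1 <= k)%N /\ Y (iter k T x)]].

Definition Yset Y (n : nat) : set R :=
  if n is 0 then Y
  else (`[0, 1] `\` Y) `&` [set x | hit_time Y x = (n%:R)%:E].

Definition wander Y (n : nat) : \bar R :=
  (\sum_(0 <= k < n) mu (Yset Y k))%E.

Definition wander_in Y A (n : nat) : \bar R :=
  (\sum_(0 <= k < n) mu (Yset Y k `&` A))%E.

Definition Qfun Y (s : R) : \bar R :=
  (\sum_(0 <= n <oo) (expR (- (n%:R * s)))%:E * (wander Y n.+1 - wander Y n))%E.

Definition Zlast Y (n : nat) (x : R) : nat :=
  (\max_(k < n.+1 | `[< Y (iter k T x) >]) k)%N.

Definition occupation A (n : nat) (x : R) : R :=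
  \sum_(1 <= k < n.+1) \1_A (iter k T x).

(* The function a(t); all values of Qfun at positive arguments are finite. *)
Definition return_scale (alpha : R) Y (t : R) : R :=
  t / (Gamma (1 + alpha) * fine (Qfun Y t^-1)).

Definition L1_nonneg G : Prop :=
  mu.-integrable `[0, 1] (EFin \o G) /\
  {ae mu, forall x, 0 <= x <= 1 -> 0 <= G x}.

Definition riemann_version G : Prop :=
  exists (g : R -> R) (I : R),
    [/\ {ae mu, forall x, 0 <= x <= 1 -> g x = G x},
        is_riemann_integral 0 1 g I & 0 < I].

End Statistics.

(* Main.v *)
Require Import Defs.
From mathcomp Require Import all_boot all_order all_algebra.
From mathcomp Require Import all_classical all_reals all_analysis.
From mathcomp Require Import measurable_realfun.
From mathcomp Require Import ring lra zify.

(** The four probabilities are bounded below by the Lebesgue measure of explicit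
    unions of cylinders of the map induced on [gamma, T gamma].

    Write gam = gamma, del = T gamma, and let f0, f1 be the inverse branches.
    Periodicity says f0 del = gam and f1 gam = del.  Hence the images of
    [gam, del] under the iterates of f0, and under those of f1, tile ]0, del] and
    [gam, 1[, and the first-return map to [gam, del] has full branches only: its
    inverse branches are the maps f1 o f0^(i+1) and f0 o f1^(i+1), with return
    time i + 2.  Such a branch is called a letter, and a composition of letters a
    word.  The points of [gam, del] with return time larger than n + 1 form the
    core ]core_left n, core_right n[ around the discontinuity c.

    Distortion.  By the C^2 hypothesis log f0' and log f1' are Lipschitz.  Along
    an excursion the lengths of the images add up to at most one, and every letter
    contracts by a factor theta < 1, so all words, whatever their length and
    return times, have log-Lipschitz slopes with one constant K ([nice_word]).
    Conditionally on any word, the next letter is thus distributed as under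
    Lebesgue measure up to the factor exp K.

    Localisation.  A Riemann integrable G with positive integral exceeds some
    dl > 0 on an interval [u, v] ([riemann_lower_interval]), and [u, v] contains
    the image of [gam, del] under an inverse branch of an iterate T^N
    ([onto_branch_exists]).  Composing it with words yields disjoint cylinders
    inside [u, v]; the invariant density is bounded below, so the length of a
    union of cylinders bounds its mu_G-measure below.

    Renewal.  Let x_n = f0^n c0 and y_n = 1 - f1^n c1.  Every point of [gam, del]
    is, at time n, inside the excursion which follows some word of time at most n;
    summing this identity over n <= m and comparing the cores with their lengths,
    which are of order x_j + y_j, shows that the words of time at most m have
    total mass at least of order m / b_m, where b_m = m^(1-alpha) l(m)
    ([renewal_bound], [early_mass]).  Within each cylinder, a proportion of order
    x_n (or y_n) of the points starts, right after the word, an excursion to the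
    left (or right) of length at least n.  This realises the events on Z_n^Y
    and on the occupation times with probability of order
    (m / b_m) (b_n / n) = (m / n)^alpha l(n) / l(m), for m close to c(n) n.
    For S_n^Y one uses instead all words with at most s letters and return times
    at most n + 1: each letter loses mass of order x_n + y_n only, and visits Y a
    bounded number of times ([killed_mass], [letter_visits]), whence a
    probability of order s b_n / n, for s of order c~(n) a(n).

    Asymptotics.  The invariant density is comparable to x / (x - f0 x) near 0,
    so the n-th level set of the hitting time in A_0 has measure comparable to
    x_n, and likewise for A_1 and y_n.  The hypothesis on the wandering rates and
    monotonicity then force x_n and y_n to be comparable to b_n / n
    ([wandering_asymptotics]), and Q(1/n) to be at most of order b_n ([Qfun_le]).
    Comparing l(m) with l(c(n) n) when m and c(n) n differ by a bounded factor is
    the uniform convergence theorem, obtained here from Egorov's theorem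
    ([slowly_varying_comparable]). *)

Set Implicit Arguments.
Unset Strict Implicit.
Unset Printing Implicit Defensive.

Import Order.TTheory GRing.Theory Num.Theory.
Import numFieldNormedType.Exports.

Local Open Scope classical_set_scope.
Local Open Scope ring_scope.

(** * Distortion without derivatives *)

Section Distortion.
Variable R : realType.
Implicit Types (f g G : R -> R) (s t a b k : R).

Definition increasing_on s t f := forall a b, s <= a -> a < b -> b <= t -> f a < f b.

(** Any two difference quotients of f over subintervals of [s, t] differ by a
    factor at most exp k.  For differentiable f this says that log f' oscillates
    by at most k; increments are used so that one-sided derivatives and quotients
    by zero never appear. *)
Definition slopes_within s t k f := forall a b a' b',
  s <= a -> a <= b -> b <= t -> s <= a' -> a' <= b' -> b' <= t ->
  (f b - f a) * (b' - a') <= expR k * ((f b' - f a') * (b - a)).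

(** The form of bounded distortion that is stable under contraction: log f' is
    k-Lipschitz on [s, t]. *)
Definition log_lipschitz_slopes s t k f := forall s' t',
  s <= s' -> s' <= t' -> t' <= t -> slopes_within s' t' (k * (t' - s')) f.

Lemma increasing_onW s t f a b : increasing_on s t f ->
  s <= a -> a <= b -> b <= t -> f a <= f b.
Proof.
move=> If sa; rewrite le_eqVlt => /orP[/eqP-> //|ab] bt.
by apply/ltW/If.
Qed.

Lemma increasing_on_comp s t f g : increasing_on s t f ->
  increasing_on (f s) (f t) g -> increasing_on s t (g \o f).
Proof.
move=> If Ig a b sa ab bt /=; apply: Ig; last 2 first.
- exact: If.
- by apply: (increasing_onW If); lra.
by apply: (increasing_onW If); lra.
Qed.

Lemma slopes_within_le s t k k' f : increasing_on s t f -> k <= k' ->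
  slopes_within s t k f -> slopes_within s t k' f.
Proof.
move=> If kk' Sf a b a' b' sa ab bt sa' ab' bt'.
apply: (le_trans (Sf _ _ _ _ sa ab bt sa' ab' bt')).
apply: ler_wpM2r; last by rewrite ler_expR.
apply: mulr_ge0; rewrite subr_ge0 //.
exact: (increasing_onW If).
Qed.

Lemma slopes_within_comp s t k l f g : increasing_on s t f ->
  increasing_on (f s) (f t) g ->
  slopes_within s t k f -> slopes_within (f s) (f t) l g ->
  slopes_within s t (k + l) (g \o f).
Proof.
move=> If Ig Sf Sg a b a' b' sa ab bt sa' ab' bt' /=.
have fW u v : s <= u -> u <= v -> v <= t -> f u <= f v by exact: increasing_onW.
move: (ab'); rewrite le_eqVlt => /orP[/eqP<-|lt_ab'].
  by rewrite !subrr !(mulr0,mul0r).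
have f'0 : 0 < f b' - f a' by rewrite subr_gt0 If.
have h1 := Sf _ _ _ _ sa ab bt sa' ab' bt'.
have h2 : (g (f b) - g (f a)) * (f b' - f a') <=
    expR l * ((g (f b') - g (f a')) * (f b - f a)).
  by apply: Sg; apply: fW => //; lra.
have gA' : 0 <= g (f b') - g (f a').
  by rewrite subr_ge0; apply: (increasing_onW Ig); apply: fW => //; lra.
rewrite -(ler_pM2r f'0) expRD.
have -> : (g (f b) - g (f a)) * (b' - a') * (f b' - f a') =
  ((g (f b) - g (f a)) * (f b' - f a')) * (b' - a') by ring.
apply: (le_trans (ler_wpM2r _ h2)); first lra.
have -> : expR l * ((g (f b') - g (f a')) * (f b - f a)) * (b' - a') =
  (expR l * (g (f b') - g (f a'))) * ((f b - f a) * (b' - a')) by ring.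
apply: (le_trans (ler_wpM2l _ h1)); first by rewrite mulr_ge0 ?expR_ge0.
by rewrite le_eqVlt; apply/orP; left; apply/eqP; ring.
Qed.

(** By the chain rule the oscillation of the log-slope of an iterate is at most the
    sum of the oscillations over the successive images, that is k times the sum of
    their lengths. *)
Lemma slopes_within_iter k f n s t : 0 <= k ->
  (forall x, 0 <= x <= 1 -> 0 <= f x <= 1) ->
  increasing_on 0 1 f -> log_lipschitz_slopes 0 1 k f ->
  0 <= s -> s <= t -> t <= 1 ->
  [/\ increasing_on s t (iter n f),
      slopes_within s t (k * \sum_(0 <= j < n) (iter j f t - iter j f s)) (iter n f) &
      0 <= iter n f s /\ iter n f s <= iter n f t /\ iter n f t <= 1].
Proof.
move=> k0 fI If Lf s0 st t1; elim: n => [|n [In Sn [n0 [nn n1]]]].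
  split=> //.
    rewrite big_geq// mulr0 => a b a' b' *; rewrite expR0 mul1r /=.
    by rewrite mulrC.
split.
- apply: (increasing_on_comp (f := iter n f) (g := f)) => //.
  by move=> a b ha ab hb; apply: If => //; lra.
- rewrite big_nat_recr//= mulrDr.
  apply: (slopes_within_comp (f := iter n f) (g := f)) => //.
    by move=> a b ha ab hb; apply: If => //; lra.
  exact: Lf.
- have := fI (iter n f s); have := fI (iter n f t) => /=.
  have : f (iter n f s) <= f (iter n f t) by apply: (increasing_onW If); lra.
  by move=> h h1 h2; split; [|split=> //]; lra.
Qed.

(** A two-step argument.  As the images of [s, t] have total length at most one, the
    iterates have distortion at most exp k on [s, t]; therefore each image of a
    subinterval [a, b] takes up a proportion at most exp k (b - a) / (t - s) of the
    image of [s, t], and the lengths for [a, b] add up to that proportion. *)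
Lemma log_lipschitz_iter k f n s t : 0 <= k ->
  (forall x, 0 <= x <= 1 -> 0 <= f x <= 1) ->
  increasing_on 0 1 f -> log_lipschitz_slopes 0 1 k f ->
  0 <= s -> s < t -> t <= 1 ->
  (forall m, \sum_(0 <= j < m) (iter j f t - iter j f s) <= 1) ->
  log_lipschitz_slopes s t (k * expR k / (t - s)) (iter n f).
Proof.
move=> k0 fI If Lf s0 st t1 sum1 a b sa ab bt.
have [I' S' _] := @slopes_within_iter k f n a b k0 fI If Lf ltac:(lra) ab ltac:(lra).
apply: (slopes_within_le I' _ S').
rewrite -!mulrA; apply: ler_wpM2l => //.
have ts : 0 < t - s by lra.
have sub m : \sum_(0 <= j < m) (iter j f b - iter j f a) <=
    expR k * ((t - s)^-1 * (b - a)) * \sum_(0 <= j < m) (iter j f t - iter j f s).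
  rewrite big_distrr /=; apply: ler_sum => j _.
  have [Ij Sj _] := @slopes_within_iter k f j s t k0 fI If Lf ltac:(lra) ltac:(lra) ltac:(lra).
  have h : (iter j f b - iter j f a) * (t - s) <=
     expR k * ((iter j f t - iter j f s) * (b - a)).
    apply: (@slopes_within_le s t _ k _ Ij _ Sj); try lra.
    rewrite -[leRHS]mulr1; apply: ler_wpM2l => //.
  rewrite -(ler_pM2r ts); apply: (le_trans h).
  rewrite le_eqVlt; apply/orP; left; apply/eqP; field; lra.
apply: (le_trans (sub n)); rewrite -[leRHS]mulr1; apply: ler_wpM2l; last exact: sum1.
apply: mulr_ge0; first exact: expR_ge0.
by apply: mulr_ge0; [rewrite invr_ge0; lra|lra].
Qed.

Definition contracts s t theta f := forall a b,
  s <= a -> a <= b -> b <= t -> f b - f a <= theta * (b - a).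

(** Precomposing with a contraction of ratio theta improves the constant of the outer
    map by the factor theta: this is what keeps the constant bounded along words. *)
Lemma log_lipschitz_comp s t theta k l f g : 0 <= l ->
  increasing_on s t f -> increasing_on (f s) (f t) g ->
  contracts s t theta f -> log_lipschitz_slopes s t k f ->
  log_lipschitz_slopes (f s) (f t) l g ->
  log_lipschitz_slopes s t (theta * l + k) (g \o f).
Proof.
move=> l0 If Ig Cf Lf Lg a b sa ab bt.
have Ifab : increasing_on a b f by move=> u v *; apply: If; lra.
have fW u v : s <= u -> u <= v -> v <= t -> f u <= f v by exact: increasing_onW.
have Igab : increasing_on (f a) (f b) g.
  move=> u v ? ? ?; apply: Ig => //.
    by apply: (@le_trans _ _ (f a)) => //; apply: fW => //; lra.
  by apply: (@le_trans _ _ (f b)) => //; apply: fW => //; lra.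
have fab : f a <= f b by apply: fW.
apply: (@slopes_within_le _ _ (k * (b - a) + l * (f b - f a))).
- exact: increasing_on_comp.
- have := ler_wpM2l l0 (Cf _ _ sa ab bt); lra.
apply: slopes_within_comp => //; first exact: Lf.
by apply: Lg => //; apply: fW => //; lra.
Qed.

Lemma slopes_within_increment s t k f a b : slopes_within s t k f ->
  s <= a -> a <= b -> b <= t ->
  (f b - f a) * (t - s) <= expR k * ((f t - f s) * (b - a)) /\
  (f t - f s) * (b - a) <= expR k * ((f b - f a) * (t - s)).
Proof. by move=> Sf sa ab bt; split; apply: Sf; lra. Qed.

End Distortion.

(** * Unions of intervals and orbit statistics *)

Section OrbitStatistics.
Variable R : realType.
Variable T : R -> R.

Definition apart (a b a' b' : R) := b <= a' \/ b' <= a.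

Lemma measure_apart_itv (I : choiceType) (ws : seq I) (A B : I -> R) : uniq ws ->
  (forall w, w \in ws -> A w <= B w) ->
  (forall w w', w \in ws -> w' \in ws -> w <> w' -> apart (A w) (B w) (A w') (B w')) ->
  lebesgue_measure (\bigcup_(w in [set` ws]) `]A w, B w[%classic) =
    (\sum_(w <- ws) (B w - A w))%:E.
Proof.
move=> uws AB ap; rewrite measure_fin_bigcup//; last first.
- move=> w w' /= hw hw' [x [/=]]; rewrite !in_itv /= => /andP[h1 h2] /andP[h3 h4].
  by apply: contrapT => ww'; have [|] := ap _ _ hw hw' ww'; lra.
rewrite -fsbig_seq// -sumEFin; apply: eq_big_seq => w hw /=.
rewrite lebesgue_measure_itv /= lte_fin.
by case: ltP (AB _ hw) => // h1 h2; rewrite (_ : B w = A w) ?subrr//; apply/eqP; rewrite eq_le h1.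
Qed.

Lemma occupation_le (A : set R) n t x :
  (forall k, (t < k)%N -> (k <= n)%N -> ~ A (iter k T x)) -> occupation T A n x <= t%:R.
Proof.
move=> H; rewrite /occupation.
have : \sum_(1 <= k < n.+1) (\1_A (iter k T x) : R) <= \sum_(1 <= k < n.+1) (k <= t)%:R.
  rewrite big_nat [leRHS]big_nat; apply: ler_sum => k /andP[k1 kn].
  rewrite indicE ler_nat; case: (leqP k t) => [_|tk]; first by case: (_ \in _).
  by rewrite memNset//; exact: H.
move/le_trans; apply; rewrite -natr_sum ler_nat.
have : (\sum_(1 <= k < n.+1) (k <= t) = minn n t)%N.
  elim: n {H} => [|n IH]; first by rewrite big_geq// min0n.
  by rewrite big_nat_recr//= IH; case: leqP => h; lia.
by move=> ->; exact: geq_minr.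
Qed.

Lemma Zlast_le (Y : set R) n t x :
  (forall k, (t < k)%N -> (k <= n)%N -> ~ Y (iter k T x)) -> (Zlast T Y n x <= t)%N.
Proof.
move=> H; apply/bigmax_leqP => k /asboolP Yk; rewrite leqNgt; apply/negP => tk.
by apply: (H k tk) => //; rewrite -ltnS.
Qed.

End OrbitStatistics.

(** * Inverse branches of the first-return map *)

Section Words.
Variable R : realType.
Variables f0 f1 : R -> R.
Variables M theta cc gam del : R.

(** What is used of the two inverse branches.  The points gam and del form a cycle of
    period 2, cc is the common end point of the two ranges, M bounds the slopes of
    the log-derivatives, and theta is a contraction ratio away from the indifferent
    fixed points.  All conditions are on increments. *)
Record branch_pair : Prop := BranchPair {
  bp_gam : 0 < gam; bp_gamc : gam < cc; bp_cdel : cc < del; bp_del : del < 1;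
  bp_M : 0 <= M; bp_theta : 0 <= theta < 1;
  bp_f0I : forall x, 0 <= x <= 1 -> 0 <= f0 x <= 1;
  bp_f1I : forall x, 0 <= x <= 1 -> 0 <= f1 x <= 1;
  bp_f0inc : increasing_on 0 1 f0; bp_f1inc : increasing_on 0 1 f1;
  bp_f0con : contracts 0 1 1 f0; bp_f1con : contracts 0 1 1 f1;
  bp_f0log : log_lipschitz_slopes 0 1 M f0;
  bp_f1log : log_lipschitz_slopes 0 1 M f1;
  bp_f0con' : contracts del 1 theta f0; bp_f1con' : contracts 0 gam theta f1;
  bp_f00 : f0 0 = 0; bp_f11 : f1 1 = 1; bp_f01 : f0 1 = cc; bp_f10 : f1 0 = cc;
  bp_f0del : f0 del = gam; bp_f1gam : f1 gam = del;
  bp_f0lt : forall x, 0 < x <= 1 -> f0 x < x;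
  bp_f1gt : forall x, 0 <= x < 1 -> x < f1 x;
  bp_f0away : forall e, 0 < e -> exists2 th, th < 1 & contracts e 1 th f0;
  bp_f1away : forall e, 0 < e -> exists2 th, th < 1 & contracts 0 (1 - e) th f1;
  bp_f0surj : forall x, 0 <= x <= cc -> exists2 y, 0 <= y <= 1 & f0 y = x;
  bp_f1surj : forall x, cc <= x <= 1 -> exists2 y, 0 <= y <= 1 & f1 y = x
}.

Hypothesis bp : branch_pair.

Definition letter := (bool * nat)%type.
(** An excursion below gam is entered through f1 and spends i.+1 steps along f0
    ([true]); an excursion above del is the mirror image ([false]). *)
Definition letter_map (l : letter) : R -> R :=
  if l.1 then f1 \o iter l.2.+1 f0 else f0 \o iter l.2.+1 f1.
Definition letter_time (l : letter) : nat := l.2.+2.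

Definition core_left (n : nat) : R := f0 (iter n f1 del).
Definition core_right (n : nat) : R := f1 (iter n f0 gam).

Lemma iter_f0_anti n : 0 < iter n.+1 f0 gam /\ iter n.+1 f0 gam < iter n f0 gam <= gam.
Proof.
case: (bp) => *.
elim: n => [|n [h1 /andP[h2 h3]]] /=.
  have h : f0 0 < f0 gam by apply: bp_f0inc => //; lra.
  have h' : f0 gam < f0 del by apply: bp_f0inc => //; lra.
  by split; last (apply/andP; split); lra.
rewrite /= in h1 h2 h3.
have h : f0 0 < f0 (f0 (iter n f0 gam)) by apply: bp_f0inc => //; lra.
have h' : f0 (f0 (iter n f0 gam)) < f0 (iter n f0 gam) by apply: bp_f0inc => //; lra.
by split; last (apply/andP; split); lra.
Qed.

Lemma iter_f1_mono n : iter n.+1 f1 del < 1 /\ del <= iter n f1 del < iter n.+1 f1 del.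
Proof.
case: (bp) => *.
elim: n => [|n [h1 /andP[h2 h3]]] /=.
  have h : f1 del < f1 1 by apply: bp_f1inc => //; lra.
  have h' : f1 gam < f1 del by apply: bp_f1inc => //; lra.
  by split; last (apply/andP; split); lra.
rewrite /= in h1 h2 h3.
have h : f1 (f1 (iter n f1 del)) < f1 1 by apply: bp_f1inc => //; lra.
have h' : f1 (iter n f1 del) < f1 (f1 (iter n f1 del)) by apply: bp_f1inc => //; lra.
by split; last (apply/andP; split); lra.
Qed.

Lemma letter_map_ends l :
  (letter_map l gam = if l.1 then core_right l.2.+1 else core_left l.2) /\
  (letter_map l del = if l.1 then core_right l.2 else core_left l.2.+1).
Proof.
case: l => -[] i; rewrite /letter_map /core_left /core_right /=; split=> //.
- by rewrite -iterS iterSr (bp_f0del bp).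
- by rewrite -iterS iterSr (bp_f1gam bp).
Qed.

Lemma core_mono n : [/\ gam <= core_left n, core_left n < core_left n.+1,
  core_left n < cc, cc < core_right n & core_right n.+1 < core_right n <= del].
Proof.
have [a1 /andP[a2 a3]] := iter_f0_anti n.
have [b1 /andP[b2 b3]] := iter_f1_mono n.
move: (bp_gam bp) (bp_gamc bp) (bp_cdel bp) (bp_del bp) => g0 gc cd d1.
rewrite /core_left /core_right; split.
- by rewrite -(bp_f0del bp); apply: (increasing_onW (bp_f0inc bp)); lra.
- by apply: (bp_f0inc bp); lra.
- by rewrite -(bp_f01 bp); apply: (bp_f0inc bp); lra.
- by rewrite -(bp_f10 bp); apply: (bp_f1inc bp); lra.
- apply/andP; split; first by apply: (bp_f1inc bp); lra.
  by rewrite -(bp_f1gam bp); apply: (increasing_onW (bp_f1inc bp)); lra.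
Qed.

Lemma core_nested m n : (m <= n)%N ->
  core_left m <= core_left n /\ core_right n <= core_right m.
Proof.
elim: n => [|n IH]; first by rewrite leqn0 => /eqP->.
rewrite leq_eqVlt => /orP[/eqP->//|/IH[h1 h2]].
have [_ h3 _ _ /andP[h4 _]] := core_mono n.
by split; lra.
Qed.

Lemma core_leftW n : gam <= core_left n < cc.
Proof. by have [h1 _ h2 _ _] := core_mono n; apply/andP; split. Qed.

Lemma core_rightW n : cc < core_right n <= del.
Proof. by have [_ _ _ h1 /andP[_ h2]] := core_mono n; apply/andP; split. Qed.

Let D := M * expR M / (del - gam) + M.

Lemma core_base : core_left 0 = gam /\ core_right 0 = del.
Proof. by rewrite /core_left /core_right /= (bp_f0del bp) (bp_f1gam bp). Qed.

(** As f0 del = gam, the images of [gam, del] under the iterates of f0 are adjacent: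
    the sum telescopes. *)
Lemma sum_iter_f0 m : \sum_(0 <= j < m) (iter j f0 del - iter j f0 gam) <= 1.
Proof.
move: (bp_gam bp) (bp_gamc bp) (bp_cdel bp) (bp_del bp) => g0 gc cd d1.
have -> : \sum_(0 <= j < m) (iter j f0 del - iter j f0 gam) = del - iter m f0 del.
  elim: m => [|m IH]; first by rewrite big_geq// subrr.
  by rewrite big_nat_recr//= IH -(bp_f0del bp) -iterSr/=; ring.
suff : 0 <= iter m f0 del by lra.
case: m => [|m]; first by rewrite /=; lra.
by rewrite iterSr (bp_f0del bp); have [h1 /andP[h2 _]] := iter_f0_anti m; lra.
Qed.

Lemma sum_iter_f1 m : \sum_(0 <= j < m) (iter j f1 del - iter j f1 gam) <= 1.
Proof.
move: (bp_gam bp) (bp_gamc bp) (bp_cdel bp) (bp_del bp) => g0 gc cd d1.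
have -> : \sum_(0 <= j < m) (iter j f1 del - iter j f1 gam) = iter m f1 gam - gam.
  elim: m => [|m IH]; first by rewrite big_geq// subrr.
  by rewrite big_nat_recr//= IH -(bp_f1gam bp) -iterSr/=; ring.
suff : iter m f1 gam <= 1 by lra.
case: m => [|m]; first by rewrite /=; lra.
rewrite iterSr (bp_f1gam bp); have [_ /andP[_ h]] := iter_f1_mono m.
have [h' _] := iter_f1_mono m; lra.
Qed.

Lemma contracts_iter (f : R -> R) n s t : (forall x, 0 <= x <= 1 -> 0 <= f x <= 1) ->
  increasing_on 0 1 f -> contracts 0 1 1 f -> 0 <= s -> s <= t -> t <= 1 ->
  [/\ 0 <= iter n f s, iter n f s <= iter n f t, iter n f t <= 1 &
    iter n f t - iter n f s <= t - s].
Proof.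
move=> fI If Cf s0 st t1; elim: n => [|n [h1 h2 h3 h4]] /=; first by split.
have a1 := fI (iter n f s); have a2 := fI (iter n f t).
have a3 : f (iter n f s) <= f (iter n f t) by apply: (increasing_onW If).
have := Cf _ _ h1 h2 h3; rewrite mul1r => a4.
by split; lra.
Qed.

(** The long inner iterate has distortion controlled by [log_lipschitz_iter]; the single
    outer step takes place away from the indifferent fixed point and provides the
    contraction. *)
Lemma letter_map_nice l : [/\ increasing_on gam del (letter_map l),
  contracts gam del theta (letter_map l),
  log_lipschitz_slopes gam del D (letter_map l) &
  gam <= letter_map l gam /\ letter_map l del <= del].
Proof.
move: (bp_gam bp) (bp_gamc bp) (bp_cdel bp) (bp_del bp) => g0 gc cd d1.
have := bp_theta bp => /andP[th0 th1].
have M0 := bp_M bp.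
have gen (f h : R -> R) : (forall x, 0 <= x <= 1 -> 0 <= f x <= 1) ->
  increasing_on 0 1 f -> contracts 0 1 1 f -> log_lipschitz_slopes 0 1 M f ->
  increasing_on 0 1 h -> contracts 0 1 1 h -> log_lipschitz_slopes 0 1 M h ->
  (forall m, \sum_(0 <= j < m) (iter j f del - iter j f gam) <= 1) ->
  forall n, contracts (iter n f gam) (iter n f del) theta h ->
  [/\ increasing_on gam del (h \o iter n f),
  contracts gam del theta (h \o iter n f) &
  log_lipschitz_slopes gam del D (h \o iter n f)].
  move=> fI If Cf Lf Ih Ch Lh sf n Ch'.
  have g1 : gam <= del by lra.
  have gd : gam < del by lra.
  have d1' : del <= 1 by lra.
  have g0' : 0 <= gam by lra.
  have [If' _ _] := @slopes_within_iter _ M f n gam del M0 fI If Lf g0' g1 d1'.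
  have [c1 c2 c3 c4] := contracts_iter n fI If Cf g0' g1 d1'.
  have Lf' := @log_lipschitz_iter _ M f n gam del M0 fI If Lf g0' gd d1' sf.
  have Ih' : increasing_on (iter n f gam) (iter n f del) h.
    by move=> u v *; apply: Ih; lra.
  split.
  - exact: increasing_on_comp.
  - move=> u v gu uv vd /=.
    have [e1 e2 e3 e4] := @contracts_iter f n u v fI If Cf ltac:(lra) uv ltac:(lra).
    apply: (le_trans (Ch' _ _ _ e2 _)).
    + by apply: (increasing_onW If'); lra.
    + by apply: (increasing_onW If'); lra.
    by apply: ler_wpM2l.
  - have -> : D = 1 * M + M * expR M / (del - gam) by rewrite /D; ring.
    apply: log_lipschitz_comp => //.
    + move=> u v gu uv vd; rewrite mul1r.
      by have [] := @contracts_iter f n u v fI If Cf ltac:(lra) uv ltac:(lra).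
    + by move=> u v *; apply: Lh; lra.
have [e1 e2] := letter_map_ends l.
case: l e1 e2 => -[] i /= e1 e2.
- have [|k1 k2 k3] := gen f0 f1 (bp_f0I bp) (bp_f0inc bp) (bp_f0con bp) (bp_f0log bp)
    (bp_f1inc bp) (bp_f1con bp) (bp_f1log bp) sum_iter_f0 i.+1.
  - have [h1 /andP[h2 h3]] := iter_f0_anti i.
    have h4 : iter i.+1 f0 del = iter i f0 gam by rewrite iterSr (bp_f0del bp).
    by rewrite h4 => u v *; apply: (bp_f1con' bp); lra.
  split=> //; rewrite e1 e2.
  have /andP[] := core_rightW i.+1; have /andP[] := core_rightW i; split; lra.
- have [|k1 k2 k3] := gen f1 f0 (bp_f1I bp) (bp_f1inc bp) (bp_f1con bp) (bp_f1log bp)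
    (bp_f0inc bp) (bp_f0con bp) (bp_f0log bp) sum_iter_f1 i.+1.
  - have [h1 /andP[h2 h3]] := iter_f1_mono i.
    have h4 : iter i.+1 f1 gam = iter i f1 del by rewrite iterSr (bp_f1gam bp).
    by rewrite h4 => u v *; apply: (bp_f0con' bp); lra.
  split=> //; rewrite e1 e2.
  have /andP[] := core_leftW i; have /andP[] := core_leftW i.+1; split; lra.
Qed.

(** The class of maps in which distortion estimates are made: with K large enough, it
    is stable under composition with letters. *)
Definition nice (K : R) (G : R -> R) :=
  increasing_on gam del G /\ log_lipschitz_slopes gam del K G.

(** K is chosen so that theta * K + D <= K: the contraction of the letter absorbs its own
    distortion D. *)
Lemma nice_letter K G l : D <= (1 - theta) * K -> 0 <= K ->
  nice K G -> nice K (G \o letter_map l).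
Proof.
move=> DK K0 [IG LG]; have [Il Cl Ll [l1 l2]] := letter_map_nice l.
have IG' : increasing_on (letter_map l gam) (letter_map l del) G.
  by move=> u v *; apply: IG; lra.
split; first exact: increasing_on_comp.
move=> s t gs st td; apply: (@slopes_within_le _ _ _ ((theta * K + D) * (t - s))).
- apply: increasing_on_comp; first by move=> u v *; apply: Il; lra.
  move=> u v h1 h2 h3; apply: IG' => //.
    by apply: le_trans h1; apply: (increasing_onW Il); lra.
  by apply: (le_trans h3); apply: (increasing_onW Il); lra.
- by apply: ler_wpM2r; lra.
apply: (log_lipschitz_comp (s := gam) (t := del)) => //.
by move=> u v *; apply: LG; lra.
Qed.

Lemma iter_f1_above n x : 0 <= x <= 1 -> x <= iter n f1 x <= 1.
Proof.
move=> /andP[x0 x1]; elim: n => [|n /andP[IH0 IH1]] /=; first by rewrite lexx.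
have /andP[_ ->] := bp_f1I bp (x := iter n f1 x) ltac:(lra); rewrite andbT.
move: IH1; rewrite le_eqVlt => /orP[/eqP->|lt1]; first by rewrite (bp_f11 bp).
by apply/(le_trans IH0)/ltW/(bp_f1gt bp); rewrite (le_trans x0 IH0).
Qed.

(** The first letter is applied last, so that it is the first one met by the orbit
    under T. *)
Definition word_map (G : R -> R) (w : seq letter) : R -> R :=
  foldl (fun F l => F \o letter_map l) G w.
Definition word_time (w : seq letter) : nat := (\sum_(l <- w) letter_time l)%N.

Lemma word_map_rcons G w l : word_map G (rcons w l) = word_map G w \o letter_map l.
Proof. by rewrite /word_map foldl_rcons. Qed.

Lemma word_time_rcons w l : word_time (rcons w l) = (word_time w + letter_time l)%N.
Proof. by rewrite /word_time -cats1 big_cat big_seq1. Qed.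

Lemma word_time_ge w : ((size w).*2 <= word_time w)%N.
Proof.
elim: w => [|l w IH]; first by rewrite /word_time big_nil.
rewrite /word_time big_cons /= doubleS -addn2 addnC.
by apply: leq_add => //; rewrite /letter_time.
Qed.

Lemma nice_word K G w : D <= (1 - theta) * K -> 0 <= K ->
  nice K G -> nice K (word_map G w).
Proof.
by move=> DK K0; elim: w G => [|l w IH] G nG //=; apply: IH; apply: nice_letter.
Qed.

Lemma nice_increment K G a b : 0 <= K -> nice K G ->
  gam <= a -> a <= b -> b <= del ->
  (G b - G a) * (del - gam) <= expR K * ((G del - G gam) * (b - a)) /\
  (G del - G gam) * (b - a) <= expR K * ((G b - G a) * (del - gam)).
Proof.
move: (bp_gam bp) (bp_gamc bp) (bp_cdel bp) (bp_del bp) => g0 gc cd d1.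
move=> K0 [IG LG] ga ab bd.
have h : slopes_within gam del K G.
  apply: (@slopes_within_le _ _ _ (K * (del - gam))) => //.
    by rewrite -[leRHS]mulr1; apply: ler_wpM2l => //; lra.
  by apply: LG; lra.
by apply: slopes_within_increment.
Qed.

(** * Renewal identity for words *)

Definition alphabet (n : nat) : seq letter :=
  [seq (s, i) | i <- iota 0 n, s <- [:: true; false]].

Fixpoint words (n r : nat) : seq (seq letter) :=
  if r is r'.+1 then [seq rcons w l | w <- words n r', l <- alphabet n]
  else [:: [::]].

Lemma mem_alphabet n l : (l \in alphabet n) = (l.2 < n)%N.
Proof.
apply/allpairsP/idP => [[[i s] /= [hi hs ->]]|].
  by move: hi; rewrite mem_iota.
case: l => s i /= hi; exists (i, s); split => //=; first by rewrite mem_iota.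
by case: s; rewrite !inE.
Qed.

Lemma alphabet_uniq n : uniq (alphabet n).
Proof. by apply: allpairs_uniq; rewrite ?iota_uniq// => -[? ?] [? ?] _ _ [-> ->]. Qed.

Lemma words_uniq n r : uniq (words n r).
Proof.
elim: r => [|r IH] //=; apply: allpairs_uniq => //; first exact: alphabet_uniq.
by move=> [w l] [w' l'] _ _ /= /rcons_inj[-> ->].
Qed.

Lemma mem_words n r w : w \in words n r ->
  size w = r /\ all (fun l : letter => l.2 < n)%N w.
Proof.
elim: r w => [|r IH] w /=; first by rewrite inE => /eqP->.
move=> /allpairsP[[w' l] /= [/IH[h1 h2]]]; rewrite mem_alphabet => hl ->.
by rewrite size_rcons h1 all_rcons hl h2.
Qed.

Definition gap (G : R -> R) (a b : R) : R := G b - G a.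

(** The letters with return time at most n.+1 tile the complement of the n-th core in
    [gam, del]. *)
Lemma sum_alphabet G n :
  \sum_(l <- alphabet n) gap (G \o letter_map l) gam del =
  gap G gam del - gap G (core_left n) (core_right n).
Proof.
elim: n => [|n IH].
  by rewrite /alphabet /= big_nil /gap; have [-> ->] := core_base; rewrite subrr.
have -> : alphabet n.+1 = alphabet n ++ [:: (true, n); (false, n)].
  by rewrite /alphabet -addn1 iotaD allpairs_cat.
rewrite big_cat /= IH !big_cons big_nil addr0 /gap /=.
have [/= -> ->] := letter_map_ends (true, n).
have [/= -> ->] := letter_map_ends (false, n).
ring.
Qed.

Lemma sum_words G n r (P : pred nat) (H : (R -> R) -> R) :
  \sum_(w <- words n r.+1 | P (word_time w)) H (word_map G w) =
  \sum_(w <- words n r) \sum_(l <- alphabet n | P (word_time w + letter_time l)%N)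
     H (word_map G w \o letter_map l).
Proof.
rewrite /= big_mkcond big_allpairs_dep; apply: eq_bigr => w _.
rewrite [RHS]big_mkcond; apply: eq_bigr => l _.
by rewrite word_time_rcons word_map_rcons.
Qed.

Lemma alphabet_filter m n : (m <= n)%N ->
  [seq l <- alphabet n | (l.2 < m)%N] = alphabet m.
Proof.
move=> mn; rewrite -(subnKC mn) /alphabet iotaD allpairs_cat filter_cat add0n.
rewrite [X in X ++ _](_ : _ = alphabet m); last first.
  by apply/all_filterP/allP => l; rewrite mem_alphabet.
rewrite [X in _ ++ X](_ : _ = [::]) ?cats0//.
apply/eqP; rewrite -size_eq0 size_filter -leqn0 leqNgt -has_count; apply/hasPn => l.
move=> /allpairsP[[i s] /= [hi _ ->]] /=.
by move: hi; rewrite mem_iota => /andP[hi _]; rewrite -leqNgt.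
Qed.

(** After a word of time at most n, either the next return also happens by time n, or
    the point lies in a core.  The predecessor accounts for the return time of the
    letter of index i being i.+2; when the word takes exactly n steps, truncation gives
    the 0-th core, which is all of [gam, del]. *)
Lemma renewal_step G N n r : (n <= N)%N ->
  \sum_(w <- words N r | (word_time w <= n)%N) gap (word_map G w) gam del =
  \sum_(w <- words N r | (word_time w <= n)%N)
     gap (word_map G w) (core_left (n - word_time w).-1) (core_right (n - word_time w).-1)
  + \sum_(w <- words N r.+1 | (word_time w <= n)%N) gap (word_map G w) gam del.
Proof.
move=> nN.
rewrite (sum_words _ _ _ (fun t => t <= n)%N (fun F => gap F gam del)).
rewrite [X in _ + X](bigID (fun w => word_time w <= n)%N) /=.
rewrite [X in _ + (_ + X)]big1 ?addr0; last first.
  move=> w; rewrite -ltnNge => nw; rewrite big_pred0// => l.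
  by apply/negbTE; rewrite -ltnNge (leq_trans nw)// leq_addr.
rewrite -big_split /=; apply: eq_bigr => w wn.
rewrite -big_filter.
rewrite (@eq_filter _ _ (fun l : letter => l.2 < (n - word_time w).-1)%N); last first.
  by move=> l; rewrite /letter_time; apply/idP/idP; move: wn; lia.
rewrite alphabet_filter ?sum_alphabet; first ring.
by rewrite (leq_trans (leq_pred _))// (leq_trans (leq_subr _ _)).
Qed.

(** Iterating [renewal_step] terminates because each letter takes at least two steps:
    every point of [gam, del] is in some excursion at time n. *)
Lemma renewal_identity G N n : (n <= N)%N ->
  gap G gam del = \sum_(0 <= r < n.+1) \sum_(w <- words N r | (word_time w <= n)%N)
     gap (word_map G w) (core_left (n - word_time w).-1) (core_right (n - word_time w).-1).
Proof.
move=> nN.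
have H m : gap G gam del = \sum_(0 <= r < m) \sum_(w <- words N r | (word_time w <= n)%N)
     gap (word_map G w) (core_left (n - word_time w).-1) (core_right (n - word_time w).-1)
    + \sum_(w <- words N m | (word_time w <= n)%N) gap (word_map G w) gam del.
  elim: m => [|m IH].
    by rewrite big_geq//= big_mkcond big_seq1 /word_time big_nil leq0n add0r.
  by rewrite big_nat_recr//= {}IH renewal_step// addrA.
rewrite {1}(H n.+1) [X in _ + X]big_seq_cond big_pred0 ?addr0// => w.
apply/negP => /andP[/mem_words[sw _]]; rewrite leqNgt.
by rewrite (leq_trans _ (word_time_ge w))// sw -addnn ltn_addl.
Qed.

Lemma sum_shift_le (c : nat -> R) N t : (forall j, 0 <= c j) ->
  \sum_(0 <= n < N | (t <= n)%N) c (n - t)%N <= \sum_(0 <= j < N) c j.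
Proof.
move=> c0.
have [tN|Nt] := leqP t N; last first.
  rewrite big_nat_cond big_pred0 ?sumr_ge0// => n.
  by apply/negP => /andP[/andP[_ h] h']; move: Nt h h'; lia.
have -> : \sum_(0 <= n < N | (t <= n)%N) c (n - t)%N = \sum_(t <= n < N) c (n - t)%N.
  by rewrite [RHS](@big_nat_widenl _ _ _ t 0 N xpredT).
rewrite -{1}(add0n t) big_addn (eq_bigr c); last by move=> i _; rewrite addnK.
rewrite [leRHS](@big_cat_nat _ _ _ (N - t))//= ?leq_subr//.
by rewrite lerDl sumr_ge0.
Qed.

Lemma gap_ge0 K G a b : nice K G -> gam <= a -> a <= b -> b <= del -> 0 <= gap G a b.
Proof. by move=> [IG _] *; rewrite subr_ge0; apply: (increasing_onW IG). Qed.

(** Sum [renewal_identity] over n <= N.  By bounded distortion the mass of the core after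
    a word is at most exp K times the mass of the word times the relative length of
    the core, and for each word the sum over n is a sum of distinct core lengths. *)
Lemma renewal_bound K G N : D <= (1 - theta) * K -> 0 <= K -> nice K G ->
  N.+1%:R * (del - gam) * gap G gam del <=
  expR K * (\sum_(0 <= r < N.+1) \sum_(w <- words N r | (word_time w <= N)%N)
     gap (word_map G w) gam del) *
  \sum_(0 <= j < N.+1) (core_right j.-1 - core_left j.-1).
Proof.
move: (bp_gam bp) (bp_gamc bp) (bp_cdel bp) (bp_del bp) => g0 gc cd d1.
move=> DK K0 nG.
pose c j := core_right j.-1 - core_left j.-1.
have c0 j : 0 <= c j.
  by rewrite /c; have := core_rightW j.-1; have := core_leftW j.-1; lra.
pose q w := gap (word_map G w) gam del.
have q0 w : 0 <= q w.
  by apply: (@gap_ge0 K) => //; [exact: nice_word|lra].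
have step n : (n <= N)%N -> (del - gam) * gap G gam del <=
   \sum_(0 <= r < N.+1) \sum_(w <- words N r | (word_time w <= n)%N)
      expR K * (q w * c (n - word_time w)%N).
  move=> nN; rewrite [in leLHS](renewal_identity G nN) big_distrr /=.
  rewrite [leRHS](@big_cat_nat _ _ _ n.+1)//=.
  apply: ler_wpDr.
    rewrite sumr_ge0// => r _; rewrite sumr_ge0// => w _.
    by rewrite mulr_ge0 ?expR_ge0// mulr_ge0.
  apply: ler_sum => r _; rewrite big_distrr /=; apply: ler_sum => w _.
  rewrite mulrC.
  have := core_rightW (n - word_time w).-1; have := core_leftW (n - word_time w).-1.
  move=> h1 h2.
  have [|||+ _] := nice_increment (a := core_left (n - word_time w).-1)
    (b := core_right (n - word_time w).-1) K0 (nice_word w DK K0 nG); try lra.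
  by [].
rewrite -mulrA.
have -> : N.+1%:R * ((del - gam) * gap G gam del) =
   \sum_(0 <= n < N.+1) (del - gam) * gap G gam del.
  by rewrite big_const_nat subn0 iter_addr addr0 mulr_natl.
apply: (@le_trans _ _ (\sum_(0 <= n < N.+1) \sum_(0 <= r < N.+1)
   \sum_(w <- words N r | (word_time w <= n)%N)
      expR K * (q w * c (n - word_time w)%N))).
  by rewrite big_nat [leRHS]big_nat; apply: ler_sum => n /andP[_ nN]; exact: step.
rewrite exchange_big /= [X in _ <= X * _]big_distrr /= [leRHS]big_distrl /=.
apply: ler_sum => r _.
under eq_bigr do rewrite big_mkcond.
rewrite exchange_big /= [X in _ <= _ * X * _]big_mkcond [X in _ <= X * _]big_distrr /= [leRHS]big_distrl /=.
apply: ler_sum => w _.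
rewrite -big_mkcond /=.
case: leqP => [wN|Nw]; last first.
  rewrite mulr0 mul0r big_nat_cond big_pred0// => n.
  by apply/negP => /andP[/andP[_ h] h']; move: Nw h h'; lia.
rewrite -!big_distrr /= -mulrA; apply: ler_wpM2l; first exact: expR_ge0.
by apply: ler_wpM2l => //; apply: sum_shift_le.
Qed.

(** Each further letter removes from a word only its core, that is a proportion at most
    exp K times the relative core length. *)
Lemma killed_mass K G n r : D <= (1 - theta) * K -> 0 <= K -> nice K G ->
  gap G gam del * (1 - r%:R * (expR K * (core_right n - core_left n) / (del - gam)))
  <= \sum_(w <- words n r) gap (word_map G w) gam del <= gap G gam del.
Proof.
move: (bp_gam bp) (bp_gamc bp) (bp_cdel bp) (bp_del bp) => g0 gc cd d1.
move=> DK K0 nG; set x := expR K * _ / _.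
have h1 := core_rightW n; have h2 := core_leftW n.
have x0 : 0 <= x by rewrite /x divr_ge0 ?mulr_ge0 ?expR_ge0//; lra.
have G0 : 0 <= gap G gam del by apply: (@gap_ge0 K) => //; lra.
elim: r => [|r /andP[IH1 IH2]]; first by rewrite /= big_seq1 mul0r subr0 mulr1 lexx.
have := sum_words G n r xpredT (fun F => gap F gam del); rewrite /= => ->.
under eq_bigr do rewrite sum_alphabet.
rewrite big_split /= sumrN.
set S := \sum_(w <- _) gap (word_map G w) gam del in IH1 IH2 *.
set E := \sum_(w <- _) gap _ _ _.
have E0 : 0 <= E.
  by apply: sumr_ge0 => w _; apply: (@gap_ge0 K); [exact: nice_word|lra|lra|lra].
have ES : E <= x * S.
  rewrite /E /S mulr_sumr; apply: ler_sum => w _.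
  have [|||+ _] := nice_increment (a := core_left n)
    (b := core_right n) K0 (nice_word w DK K0 nG); try lra.
  move=> h; rewrite -(@ler_pM2r _ (del - gam)); last lra.
  apply: (le_trans h); rewrite le_eqVlt; apply/orP; left; apply/eqP.
  have dg : del - gam != 0 by apply: lt0r_neq0; lra.
  by rewrite /x /gap; field.
have xS : x * S <= x * gap G gam del by apply: ler_wpM2l.
rewrite -natr1; apply/andP; split; nra.
Qed.

(** * Cylinders and their orbits *)

Lemma word_map_range K G w a b : D <= (1 - theta) * K -> 0 <= K -> nice K G ->
  gam <= a -> a <= b -> b <= del ->
  G gam <= word_map G w a /\ word_map G w b <= G del.
Proof.
move=> DK K0; elim: w G => [|l w IH] G nG ga ab bd /=.
  by case: nG => IG _; split; apply: (increasing_onW IG); lra.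
have [h1 h2] := IH _ (nice_letter l DK K0 nG) ga ab bd.
have [_ _ _ [h3 h4]] := letter_map_nice l.
case: (letter_map_nice l) => Il _ _ _.
have h5 : letter_map l gam <= letter_map l del by apply: (increasing_onW Il); lra.
case: nG => IG _; split.
- by apply: le_trans h1 => /=; apply: (increasing_onW IG); lra.
- by apply: (le_trans h2) => /=; apply: (increasing_onW IG); lra.
Qed.

Lemma letter_core l n : (l.2 < n)%N ->
  letter_map l del <= core_left n \/ core_right n <= letter_map l gam.
Proof.
have [-> ->] := letter_map_ends l.
by case: l => -[] i /= /core_nested[h1 h2]; [right|left].
Qed.

Lemma letters_apart l l' : l <> l' ->
  letter_map l del <= letter_map l' gam \/ letter_map l' del <= letter_map l gam.
Proof.
have [-> ->] := letter_map_ends l; have [-> ->] := letter_map_ends l'.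
case: l l' => [s i] [s' i'] /= ll.
have := core_leftW i; have := core_leftW i'; have := core_leftW i.+1; have := core_leftW i'.+1.
have := core_rightW i; have := core_rightW i'; have := core_rightW i.+1; have := core_rightW i'.+1.
have [ii|ii|ii] := ltngtP i i'.
- have [h1 h2] := core_nested ii.
  by move: s s' {ll} => [] [] *; [right|right|left|left]; lra.
- have [h1 h2] := core_nested ii.
  by move: s s' {ll} => [] [] *; [left|right|left|right]; lra.
subst i'.
by move: s s' ll => [] [] ll *; [exfalso; apply: ll|right|left|exfalso; apply: ll]; rewrite //; lra.
Qed.

(** The first letters that differ already separate the two images.  If one word is a
    prefix of the other, the restriction to the core does it: the core of the shorter
    word avoids all its continuations. *)
Lemma words_apart K G n w w' a b : D <= (1 - theta) * K -> 0 <= K -> nice K G ->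
  all (fun l : letter => l.2 < n)%N w -> all (fun l : letter => l.2 < n)%N w' ->
  core_left n <= a -> a <= b -> b <= core_right n -> w <> w' ->
  apart (word_map G w a) (word_map G w b) (word_map G w' a) (word_map G w' b).
Proof.
move=> DK K0 nG aw aw' na ab bn.
have cl := core_leftW n; have cr := core_rightW n.
have nil_cons F l v : nice K F -> (l.2 < n)%N ->
    apart (F a) (F b) (word_map F (l :: v) a) (word_map F (l :: v) b).
  move=> nF ln; have nFl := nice_letter l DK K0 nF.
  have [|||h1 h2] := word_map_range v (a := a) (b := b) DK K0 nFl; try lra.
  have [Il _ _ [l1 l2]] := letter_map_nice l.
  have l3 : letter_map l gam <= letter_map l del by apply: (increasing_onW Il); lra.
  case: nF => IF _; rewrite /apart /=.
  have [h|h] := letter_core ln; [right|left].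
  - by apply: (le_trans h2) => /=; apply: (increasing_onW IF); lra.
  - by apply: le_trans h1 => /=; apply: (increasing_onW IF); lra.
elim: w G nG aw w' aw' => [|l w IH] G nG aw [|l' w'] aw' //= ww'.
- by move: aw' => /andP[? _]; apply: nil_cons.
- move: aw => /andP[? _]; case: (@nil_cons G l w nG) => //; [by right|by left].
move: aw aw' => /= /andP[ln aw] /andP[ln' aw'].
have [ll|/eqP ll] := eqVneq l l'.
  by subst l'; apply: IH => //; [exact: nice_letter|move=> ?; apply: ww'; congr cons].
have [|||h1 h2] := word_map_range w (a := a) (b := b) DK K0 (nice_letter l DK K0 nG); try lra.
have [|||h1' h2'] := word_map_range w' (a := a) (b := b) DK K0 (nice_letter l' DK K0 nG); try lra.
have [Il _ _ [l1 l2]] := letter_map_nice l.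
have [Il' _ _ [l1' l2']] := letter_map_nice l'.
have l3 : letter_map l gam <= letter_map l del by apply: (increasing_onW Il); lra.
have l3' : letter_map l' gam <= letter_map l' del by apply: (increasing_onW Il'); lra.
case: nG => IG _; rewrite /apart.
have [h|h] := letters_apart ll; [left|right].
- apply: (le_trans h2); apply: le_trans h1' => /=; apply: (increasing_onW IG); lra.
- apply: (le_trans h2'); apply: le_trans h1 => /=; apply: (increasing_onW IG); lra.
Qed.

(** If the iterates stayed above e, then, x - f0 x being nondecreasing, each step would
    decrease them by at least e - f0 e > 0. *)
Lemma iter_f0_small e : 0 < e -> exists j, iter j f0 gam <= e.
Proof.
move=> e0; have [e1|e1] := leP 1 e.
  by exists 0%N => /=; have := bp_gamc bp; have := bp_cdel bp; have := bp_del bp; lra.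
have fe := bp_f0lt bp (x := e) ltac:(lra).
apply: contrapT => /forallNP H.
have lt_e j : e < iter j f0 gam by rewrite ltNge; apply/negP/H.
have drop j : iter j f0 gam <= 1 - j%:R * (e - f0 e).
  elim: j => [|j IH] /=.
    by have := bp_gamc bp; have := bp_cdel bp; have := bp_del bp; lra.
  have h1 : iter j f0 gam <= 1.
    have := iter_f0_anti j; have := bp_gamc bp; have := bp_cdel bp; have := bp_del bp; lra.
  have := bp_f0con bp (ltW e0) (ltW (lt_e j)) h1.
  by rewrite -natr1; lra.
have h : 0 < e - f0 e by lra.
pose N := Num.truncn (1 / (e - f0 e)).
have := truncnS_gt (1 / (e - f0 e)).
rewrite ltr_pdivrMr// => hN.
by have := drop N.+1; have := lt_e N.+1; rewrite /N; lra.
Qed.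

Lemma iter_f1_close e : e < 1 -> exists j, e <= iter j f1 del.
Proof.
move=> e1; have [e0|e0] := leP e 0.
  by exists 0%N => /=; have := bp_gam bp; have := bp_gamc bp; have := bp_cdel bp; lra.
have fe := bp_f1gt bp (x := e) ltac:(lra).
apply: contrapT => /forallNP H.
have lt_e j : iter j f1 del < e by rewrite ltNge; apply/negP/H.
have drop j : j%:R * (f1 e - e) <= iter j f1 del.
  elim: j => [|j IH] /=.
    by have := bp_gamc bp; have := bp_cdel bp; have := bp_gam bp; lra.
  have h1 : 0 <= iter j f1 del.
    have := iter_f1_mono j; have := bp_gamc bp; have := bp_cdel bp; have := bp_gam bp; lra.
  have := bp_f1con bp h1 (ltW (lt_e j)) (ltW e1).
  by rewrite -natr1; lra.
have h : 0 < f1 e - e by lra.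
pose N := Num.truncn (1 / (f1 e - e)).
have := truncnS_gt (1 / (f1 e - e)).
rewrite ltr_pdivrMr// => hN.
by have := drop N.+1; have := lt_e N.+1; rewrite /N; lra.
Qed.

Variable T : R -> R.
Variables c0 c1 : R.

(** T undoes f on open intervals.  The end points are avoided because the
    value of T at its discontinuity is arbitrary. *)
Definition inverts (f : R -> R) := forall s t x,
  0 <= s -> s <= t -> t <= 1 -> f s < x -> x < f t -> s < T x /\ T x < t.

Hypothesis T_f0 : inverts f0.
Hypothesis T_f1 : inverts f1.
Hypothesis c0_gam : 0 < c0 <= gam.
Hypothesis c1_del : del <= c1 < 1.

Let Y : set R := `[c0, c1]%classic.

Definition visits (t : nat) (x : R) : nat := (\sum_(0 <= k < t) `[< Y (iter k T x) >])%N.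

Lemma visitsD t s x : visits (t + s) x = (visits t x + visits s (iter t T x))%N.
Proof.
rewrite /visits (@big_cat_nat _ _ _ t)//= ?leq_addr//; congr addn.
rewrite -{1}(add0n t) big_addn addKn.
by apply: eq_bigr => k _; rewrite iterD.
Qed.

Lemma visits_le t x : (visits t x <= t)%N.
Proof.
have : (visits t x <= \sum_(0 <= k < t) 1)%N.
  by apply: leq_sum => k _; case: asbool.
by rewrite sum_nat_const_nat subn0 muln1.
Qed.

Lemma inverts_iter f n k s t x : (forall x, 0 <= x <= 1 -> 0 <= f x <= 1) ->
  increasing_on 0 1 f -> contracts 0 1 1 f -> inverts f ->
  0 <= s -> s <= t -> t <= 1 -> (k <= n)%N ->
  iter n f s < x -> x < iter n f t ->
  iter (n - k) f s < iter k T x /\ iter k T x < iter (n - k) f t.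
Proof.
move=> fI If Cf Hf s0 st t1; elim: k => [|k IH] kn h1 h2; first by rewrite subn0.
have [h3 h4] := IH (ltnW kn) h1 h2.
have [e1 e2 e3 e4] := @contracts_iter f (n - k.+1) s t fI If Cf s0 st t1.
rewrite iterS; apply: Hf => //; rewrite -iterS -subSn// ?subSS//.
Qed.

Lemma letter_orbit_right i a b x k : gam <= a -> a <= b -> b <= del -> (k <= i.+1)%N ->
  letter_map (true, i) a < x -> x < letter_map (true, i) b ->
  iter (i.+1 - k) f0 a < iter k.+1 T x /\ iter k.+1 T x < iter (i.+1 - k) f0 b.
Proof.
move: (bp_gam bp) (bp_gamc bp) (bp_cdel bp) (bp_del bp) => g0 gc cd d1.
move=> ga ab bd ki h1 h2.
have a0 : 0 <= a by lra.
have b1 : b <= 1 by lra.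
have [e1 e2 e3 e4] := @contracts_iter f0 i.+1 a b (bp_f0I bp) (bp_f0inc bp) (bp_f0con bp) a0 ab b1.
have [h3 h4] := T_f1 e1 e2 e3 h1 h2.
rewrite iterSr; apply: inverts_iter => //; [exact: bp_f0I|exact: bp_f0inc|exact: bp_f0con].
Qed.

Lemma letter_orbit_left i a b x k : gam <= a -> a <= b -> b <= del -> (k <= i.+1)%N ->
  letter_map (false, i) a < x -> x < letter_map (false, i) b ->
  iter (i.+1 - k) f1 a < iter k.+1 T x /\ iter k.+1 T x < iter (i.+1 - k) f1 b.
Proof.
move: (bp_gam bp) (bp_gamc bp) (bp_cdel bp) (bp_del bp) => g0 gc cd d1.
move=> ga ab bd ki h1 h2.
have a0 : 0 <= a by lra.
have b1 : b <= 1 by lra.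
have [e1 e2 e3 e4] := @contracts_iter f1 i.+1 a b (bp_f1I bp) (bp_f1inc bp) (bp_f1con bp) a0 ab b1.
have [h3 h4] := T_f0 e1 e2 e3 h1 h2.
rewrite iterSr; apply: inverts_iter => //; [exact: bp_f1I|exact: bp_f1inc|exact: bp_f1con].
Qed.

Lemma sum_recent i j : (\sum_(0 <= k < i.+1) (i < k + j) <= j)%N.
Proof.
rewrite big_nat_rev /= big_nat (eq_bigr (fun k => (k < j)%N : nat)); last first.
  move=> k /andP[_ ki]; congr nat_of_bool; rewrite add0n subSS.
  by apply/idP/idP; move: ki; lia.
rewrite -big_nat.
have : (\sum_(0 <= k < i.+1) (k < j) = minn i.+1 j)%N.
  elim: i => [|i IH]; first by rewrite big_nat1; case: j => [|j]; rewrite ?minn0// minnSS min0n.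
  rewrite big_nat_recr//= IH; case: ltnP => h; lia.
by move=> ->; exact: geq_minr.
Qed.

Lemma iter_f0_le m n : (m <= n)%N -> iter n f0 gam <= iter m f0 gam.
Proof.
elim: n => [|n IH]; first by rewrite leqn0 => /eqP->.
rewrite leq_eqVlt => /orP[/eqP->//|/IH h].
by have [_ /andP[h1 _]] := iter_f0_anti n; lra.
Qed.

Lemma iter_f1_le m n : (m <= n)%N -> iter m f1 del <= iter n f1 del.
Proof.
elim: n => [|n IH]; first by rewrite leqn0 => /eqP->.
rewrite leq_eqVlt => /orP[/eqP->//|/IH h].
by have [_ /andP[_ h1]] := iter_f1_mono n; lra.
Qed.

(** During an excursion the orbit runs through iterates of the fundamental domain
    [gam, del]; only the j of them that are closest to it can meet Y, and there is one
    more visit at time 0. *)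
Lemma letter_visits j l a b x : iter j f0 gam <= c0 -> c1 <= iter j f1 del ->
  gam <= a -> a <= b -> b <= del -> letter_map l a < x -> x < letter_map l b ->
  [/\ a < iter (letter_time l) T x, iter (letter_time l) T x < b &
     (visits (letter_time l) x <= j.+1)%N].
Proof.
move: (bp_gam bp) (bp_gamc bp) (bp_cdel bp) (bp_del bp) => g0 gc cd d1.
move=> j0 j1 ga ab bd; case: l => s i h1 h2.
have end' : a < iter (letter_time (s, i)) T x /\ iter (letter_time (s, i)) T x < b.
  move: h1 h2; rewrite /letter_time; case: s => /= h1 h2.
    by have := @letter_orbit_right i a b x i.+1 ga ab bd (leqnn _) h1 h2; rewrite subnn.
  by have := @letter_orbit_left i a b x i.+1 ga ab bd (leqnn _) h1 h2; rewrite subnn.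
case: end' => k1 k2; split=> //.
rewrite /visits /letter_time big_nat_recl//= -(add1n j); apply: leq_add.
  by case: asbool.
apply: (leq_trans _ (sum_recent i j)); rewrite big_nat [leqRHS]big_nat.
apply: leq_sum => k /andP[_ ki].
case: (ltnP i (k + j)) => [_|jk]; first by case: asbool.
rewrite leqn0 eqb0; apply/asboolPn; rewrite /Y /= in_itv /= => /andP[y0 y1].
have kik : (k <= i)%N by [].
have ji : (j <= i - k)%N by rewrite leq_subRL.
move: h1 h2; case: s {k1 k2} => h1 h2.
- have [_ h3] := @letter_orbit_right i a b x k ga ab bd (leqW kik) h1 h2.
  have := iter_f0_le ji; have : iter (i.+1 - k) f0 b <= iter (i.+1 - k) f0 del.
    have [] := @contracts_iter f0 (i.+1 - k) b del (bp_f0I bp) (bp_f0inc bp) (bp_f0con bp) ltac:(lra) bd ltac:(lra).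
    by [].
  rewrite subSn// (iterSr _ _ del) (bp_f0del bp) => h4 h5.
  by move: h3; rewrite subSn//=; move: h4 => /=; move: y0 => /=; lra.
- have [h3 _] := @letter_orbit_left i a b x k ga ab bd (leqW kik) h1 h2.
  have := iter_f1_le ji; have : iter (i.+1 - k) f1 gam <= iter (i.+1 - k) f1 a.
    have [] := @contracts_iter f1 (i.+1 - k) gam a (bp_f1I bp) (bp_f1inc bp) (bp_f1con bp) ltac:(lra) ga ltac:(lra).
    by [].
  rewrite subSn// (iterSr _ _ gam) (bp_f1gam bp) => h4 h5.
  by move: h3; rewrite subSn//=; move: h4 => /=; move: y1 => /=; lra.
Qed.

(** G is an inverse branch of the t-th iterate of T along which Y is visited at most
    v times. *)
Definition realizes (G : R -> R) (t v : nat) := forall a b x,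
  gam <= a -> a <= b -> b <= del -> G a < x -> x < G b ->
  [/\ a < iter t T x, iter t T x < b & (visits t x <= v)%N].

Lemma realizes_word j G t v w : iter j f0 gam <= c0 -> c1 <= iter j f1 del ->
  realizes G t v -> realizes (word_map G w) (t + word_time w) (v + size w * j.+1).
Proof.
move=> j0 j1; elim: w G t v => [|l w IH] G t v rG.
  by rewrite /word_time big_nil addn0 mul0n addn0.
have -> : (t + word_time (l :: w) = t + letter_time l + word_time w)%N.
  by rewrite /word_time big_cons addnA.
have -> : (v + size (l :: w) * j.+1 = v + j.+1 + size w * j.+1)%N by rewrite /= mulSn addnA.
apply: IH => a b x ga ab bd h1 h2.
have [Il _ _ [l1 l2]] := letter_map_nice l.
have [|||h3 h4 h5] := rG (letter_map l a) (letter_map l b) x _ _ _ h1 h2.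
- by apply: (le_trans l1); apply: (increasing_onW Il); lra.
- by apply: (increasing_onW Il).
- by apply: (le_trans _ l2); apply: (increasing_onW Il); lra.
have [h6 h7 h8] := letter_visits j0 j1 ga ab bd h3 h4.
by rewrite addnC iterD addnC visitsD; split=> //; apply: leq_add.
Qed.

Definition word_union (G : R -> R) (ws : seq (seq letter)) (a b : R) : set R :=
  \bigcup_(w in [set` ws]) `]word_map G w a, word_map G w b[%classic.

Lemma measure_words K G n ws a b : D <= (1 - theta) * K -> 0 <= K -> nice K G ->
  uniq ws -> (forall w, w \in ws -> all (fun l : letter => l.2 < n)%N w) ->
  core_left n <= a -> a <= b -> b <= core_right n ->
  lebesgue_measure (word_union G ws a b) = (\sum_(w <- ws) gap (word_map G w) a b)%:E.
Proof.
move=> DK K0 nG uws aws na ab bn; apply: measure_apart_itv => //.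
  move=> w hw; have := core_leftW n; have := core_rightW n => h1 h2.
  have [IG _] := nice_word w DK K0 nG.
  by apply: (increasing_onW IG); lra.
by move=> w w' hw hw' ww'; apply: (words_apart (n := n) DK K0 nG) => //; exact: aws.
Qed.

(** By bounded distortion the interval [a, b] keeps, in each cylinder, its relative
    length up to the factor exp K. *)
Lemma measure_words_ge K G n ws a b : D <= (1 - theta) * K -> 0 <= K -> nice K G ->
  uniq ws -> (forall w, w \in ws -> all (fun l : letter => l.2 < n)%N w) ->
  core_left n <= a -> a <= b -> b <= core_right n ->
  (((\sum_(w <- ws) gap (word_map G w) gam del) * ((b - a) / (expR K * (del - gam))))%:E
   <= lebesgue_measure (word_union G ws a b))%E.
Proof.
move: (bp_gam bp) (bp_gamc bp) (bp_cdel bp) (bp_del bp) => g0 gc cd d1.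
move=> DK K0 nG uws aws na ab bn; rewrite (measure_words DK K0 nG uws aws)//.
rewrite lee_fin mulr_suml; apply: ler_sum => w _.
have h1 := core_leftW n; have h2 := core_rightW n.
have [|||_ h] := nice_increment (a := a) (b := b) K0 (nice_word w DK K0 nG); try lra.
have e0 : 0 < expR K * (del - gam) by rewrite mulr_gt0 ?expR_gt0//; lra.
by rewrite mulrA ler_pdivrMr// /gap; apply: (le_trans h); rewrite mulrCA.
Qed.

(** Some inverse branch of an iterate of T maps [gam, del] into [u, v]; visits are bounded
    by the number of steps. *)
Definition onto_branch_in (u v : R) := exists G N K,
  [/\ 0 <= K, nice K G & contracts gam del 1 G] /\
  [/\ u <= G gam, G del <= v & realizes G N N].

Lemma onto_branch_in_base u v : u < cc -> cc < v -> onto_branch_in u v.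
Proof.
move: (bp_gam bp) (bp_gamc bp) (bp_cdel bp) (bp_del bp) => g0 gc cd d1.
move=> uc cv; have [i hi] := iter_f0_small (e := v - cc) ltac:(lra).
pose l : letter := (true, i); have [Il Cl Ll [l1 l2]] := letter_map_nice l.
have th := bp_theta bp.
have M0 := bp_M bp.
exists (letter_map l), (letter_time l), D; split; split=> //.
- by rewrite /D addr_ge0// divr_ge0 ?mulr_ge0 ?expR_ge0//; lra.
- by move=> a b ga ab bd; apply: (le_trans (Cl _ _ ga ab bd)); apply: ler_wpM2r; lra.
- have [-> _] := letter_map_ends l; rewrite /l/=.
  by have := core_rightW i.+1; lra.
- have [_ ->] := letter_map_ends l; rewrite /l/= /core_right.
  have [h1 /andP[h2 h3]] := iter_f0_anti i.
  have := bp_f1con bp (lexx 0) (b := iter i f0 gam) ltac:(lra) ltac:(lra).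
  by rewrite (bp_f10 bp); lra.
- move=> a b x ga ab bd h1 h2.
  have := @letter_orbit_right i a b x i.+1 ga ab bd (leqnn _) h1 h2; rewrite subnn => -[h3 h4].
  by split=> //; exact: visits_le.
Qed.

Lemma onto_branch_in_step f u v : (forall x, 0 <= x <= 1 -> 0 <= f x <= 1) ->
  increasing_on 0 1 f -> contracts 0 1 1 f -> log_lipschitz_slopes 0 1 M f -> inverts f ->
  0 <= u -> v <= 1 -> onto_branch_in u v -> onto_branch_in (f u) (f v).
Proof.
move: (bp_gam bp) (bp_gamc bp) (bp_cdel bp) (bp_del bp) => g0 gc cd d1.
have M0 := bp_M bp.
move=> fI If Cf Lf Hf u0 v1 [G [N [K [[K0 [IG LG] CG] [uG Gv rG]]]]].
have GW a b : gam <= a -> a <= b -> b <= del -> G a <= G b by exact: increasing_onW.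
have Gm : G gam <= G del by apply: GW; lra.
exists (f \o G), N.+1, (1 * M + K); split; split.
- lra.
- split; first by apply: increasing_on_comp => // a b *; apply: If; lra.
  apply: log_lipschitz_comp => //; first by move=> a b *; apply: If; lra.
  by move=> a b *; apply: Lf; lra.
- move=> a b ga ab bd /=; have h1 := CG _ _ ga ab bd.
  have h2 : G gam <= G a by apply: GW; lra.
  have h3 : G b <= G del by apply: GW; lra.
  have h4 := GW _ _ ga ab bd.
  by have := Cf (G a) (G b); lra.
- by apply: (increasing_onW If); lra.
- by apply: (increasing_onW If); lra.
- move=> a b x ga ab bd /= h1 h2.
  have h3 : G gam <= G a by apply: GW; lra.
  have h4 : G b <= G del by apply: GW; lra.
  have h5 := GW _ _ ga ab bd.
  have [h6 h7] : G a < T x /\ T x < G b by apply: Hf => //; lra.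
  have [h8 h9 _] := rG a b (T x) ga ab bd h6 h7.
  by split; [rewrite -iterS iterSr..|exact: visits_le].
Qed.

(** An interval whose image under f0 has length at least d reaches at least d to the
    right of 0, and f0 contracts there by a factor less than one. *)
Lemma f0_shortens d : 0 < d -> exists2 e, 0 < e & forall u v, 0 <= u -> u <= v -> v <= 1 ->
  d <= f0 v - f0 u -> f0 v - f0 u + e <= v - u.
Proof.
move=> d0; have [th th1 Cth] := bp_f0away bp (e := d / 2) ltac:(lra).
exists ((1 - th) * (d / 2)); first by rewrite mulr_gt0//; lra.
move=> u v u0 uv v1 dd.
have := bp_f0con bp u0 uv v1; rewrite mul1r => h1.
have := bp_f0con bp (a := u) (b := u + d / 2) u0 ltac:(lra) ltac:(lra).
have := Cth (u + d / 2) v ltac:(lra) ltac:(lra) v1.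
have : (1 - th) * (d / 2) <= (1 - th) * (v - u - d / 2) by apply: ler_wpM2l; lra.
by lra.
Qed.

Lemma f1_shortens d : 0 < d -> exists2 e, 0 < e & forall u v, 0 <= u -> u <= v -> v <= 1 ->
  d <= f1 v - f1 u -> f1 v - f1 u + e <= v - u.
Proof.
move=> d0; have [th th1 Cth] := bp_f1away bp (e := d / 2) ltac:(lra).
exists ((1 - th) * (d / 2)); first by rewrite mulr_gt0//; lra.
move=> u v u0 uv v1 dd.
have := bp_f1con bp u0 uv v1; rewrite mul1r => h1.
have := bp_f1con bp (a := v - d / 2) (b := v) ltac:(lra) ltac:(lra) v1.
have := Cth u (v - d / 2) u0 ltac:(lra) ltac:(lra).
have : (1 - th) * (d / 2) <= (1 - th) * (v - u - d / 2) by apply: ler_wpM2l; lra.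
by lra.
Qed.

(** Pull [u, v] back by T.  As long as it avoids cc in its interior it lies in the range
    of one branch, and its preimage is longer by a fixed amount e; hence after finitely
    many steps it contains cc, near which all letters of large index have their range. *)
Lemma onto_branch_exists u v : 0 <= u -> u < v -> v <= 1 -> onto_branch_in u v.
Proof.
move: (bp_gam bp) (bp_gamc bp) (bp_cdel bp) (bp_del bp) => g0 gc cd d1.
move=> u0 uv v1.
have [e0 e0_gt0 H0] := f0_shortens (d := v - u) ltac:(lra).
have [e1 e1_gt0 H1] := f1_shortens (d := v - u) ltac:(lra).
pose e := Num.min e0 e1.
have e_gt0 : 0 < e by rewrite /e lt_min e0_gt0.
have [ee0 ee1] : e <= e0 /\ e <= e1 by rewrite /e !ge_min !lexx orbT.
suff H n u' v' : 0 <= u' -> v' <= 1 -> v - u <= v' - u' -> 1 <= v' - u' + n%:R * e ->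
    onto_branch_in u' v'.
  pose n := Num.truncn (1 / e).
  apply: (H n.+1) => //.
  have := truncnS_gt (1 / e); rewrite ltr_pdivrMr// -/n; lra.
elim: n u' v' => [|n IH] u' v' u'0 v'1 d le1.
  by apply: onto_branch_in_base; rewrite mul0r in le1; lra.
have [v'c|cv'] := leP v' cc.
  have [y y01 fy] := bp_f0surj bp (x := v') ltac:(lra).
  have [x x01 fx] := bp_f0surj bp (x := u') ltac:(lra).
  have xy : x <= y.
    rewrite leNgt; apply/negP => yx.
    by have := bp_f0inc bp (a := y) (b := x) ltac:(lra) yx ltac:(lra); lra.
  have := H0 x y ltac:(lra) xy ltac:(lra); rewrite fx fy => /(_ d) h.
  rewrite -fx -fy; apply: (onto_branch_in_step (bp_f0I bp) (bp_f0inc bp) (bp_f0con bp) (bp_f0log bp) T_f0); first by case/andP: x01.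
    by case/andP: y01.
  have le1' : 1 <= y - x + n%:R * e by move: le1; rewrite -natr1 mulrDl mul1r; lra.
  by apply: IH => //; [case/andP: x01|case/andP: y01|lra].
have [cu'|u'c] := leP cc u'.
  have [y y01 fy] := bp_f1surj bp (x := v') ltac:(lra).
  have [x x01 fx] := bp_f1surj bp (x := u') ltac:(lra).
  have xy : x <= y.
    rewrite leNgt; apply/negP => yx.
    by have := bp_f1inc bp (a := y) (b := x) ltac:(lra) yx ltac:(lra); lra.
  have := H1 x y ltac:(lra) xy ltac:(lra); rewrite fx fy => /(_ d) h.
  rewrite -fx -fy; apply: (onto_branch_in_step (bp_f1I bp) (bp_f1inc bp) (bp_f1con bp) (bp_f1log bp) T_f1); first by case/andP: x01.
    by case/andP: y01.
  have le1' : 1 <= y - x + n%:R * e by move: le1; rewrite -natr1 mulrDl mul1r; lra.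
  by apply: IH => //; [case/andP: x01|case/andP: y01|lra].
exact: onto_branch_in_base.
Qed.

(** The interval between cc and f1 (f0^n c0) consists of the points which step into
    ]0, f0^n c0[, hence stay below c0 for n more steps. *)
Lemma cylinder_orbit_right j G N n w x : iter j f0 gam <= c0 -> c1 <= iter j f1 del ->
  realizes G N N ->
  word_map G w cc < x -> x < word_map G w (f1 (iter n f0 c0)) ->
  (forall k, (N + word_time w < k)%N -> (k <= N + word_time w + n.+1)%N ->
     0 < iter k T x < c0) /\
  (visits (N + word_time w) x <= N + size w * j.+1)%N.
Proof.
move: (bp_gam bp) (bp_gamc bp) (bp_cdel bp) (bp_del bp) => g0 gc cd d1.
move: c0_gam c1_del => /andP[c0_0 c0_g] /andP[c1_d c1_1].
move=> j0 j1 rG h1 h2; set t := (N + word_time w)%N.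
have [e1 e2 e3 e4] := @contracts_iter f0 n 0 c0 (bp_f0I bp) (bp_f0inc bp) (bp_f0con bp) (lexx 0) ltac:(lra) ltac:(lra).
have [e5 e6 e7 e8] := @contracts_iter f0 n c0 gam (bp_f0I bp) (bp_f0inc bp) (bp_f0con bp) ltac:(lra) ltac:(lra) ltac:(lra).
have i0 m : iter m f0 0 = 0 by elim: m => //= m ->; exact: bp_f00.
rewrite i0 in e1 e2 e3 e4.
have b1 : cc <= f1 (iter n f0 c0).
  by rewrite -(bp_f10 bp); apply: (increasing_onW (bp_f1inc bp)) => //; lra.
have b2 : f1 (iter n f0 c0) <= del.
  rewrite -(bp_f1gam bp); apply: (increasing_onW (bp_f1inc bp)); try lra.
have [|//|//|h3 h4 h5] := @realizes_word j G N N w j0 j1 rG _ _ x _ _ _ h1 h2; first lra.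
split=> // k tk kn.
have -> : k = ((k - t.+1) + t.+1)%N by rewrite subnK.
rewrite iterD iterS.
have [h6 h7] : 0 < T (iter t T x) /\ T (iter t T x) < iter n f0 c0.
  by apply: T_f1 => //; rewrite (bp_f10 bp).
have kn' : (k - t.+1 <= n)%N by rewrite leq_subLR addSn -addnS.
have := @inverts_iter f0 n (k - t.+1) 0 c0 (T (iter t T x)) (bp_f0I bp) (bp_f0inc bp) (bp_f0con bp) T_f0 (lexx 0) ltac:(lra) ltac:(lra) kn'.
rewrite i0 => /(_ h6 h7) [h8 h9].
have [e9 e10 e11 e12] := @contracts_iter f0 (n - (k - t.+1)) 0 c0 (bp_f0I bp) (bp_f0inc bp) (bp_f0con bp) (lexx 0) ltac:(lra) ltac:(lra).
by rewrite i0 in h8 e9 e10 e12 *; lra.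
Qed.

Lemma cylinder_orbit_left j G N n w x : iter j f0 gam <= c0 -> c1 <= iter j f1 del ->
  realizes G N N ->
  word_map G w (f0 (iter n f1 c1)) < x -> x < word_map G w cc ->
  (forall k, (N + word_time w < k)%N -> (k <= N + word_time w + n.+1)%N ->
     c1 < iter k T x < 1) /\
  (visits (N + word_time w) x <= N + size w * j.+1)%N.
Proof.
move: (bp_gam bp) (bp_gamc bp) (bp_cdel bp) (bp_del bp) => g0 gc cd d1.
move: c0_gam c1_del => /andP[c0_0 c0_g] /andP[c1_d c1_1].
move=> j0 j1 rG h1 h2; set t := (N + word_time w)%N.
have [e1 e2 e3 e4] := @contracts_iter f1 n c1 1 (bp_f1I bp) (bp_f1inc bp) (bp_f1con bp) ltac:(lra) ltac:(lra) (lexx 1).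
have [e5 e6 e7 e8] := @contracts_iter f1 n del c1 (bp_f1I bp) (bp_f1inc bp) (bp_f1con bp) ltac:(lra) ltac:(lra) ltac:(lra).
have i1 m : iter m f1 1 = 1 by elim: m => //= m ->; exact: bp_f11.
rewrite i1 in e2 e3 e4.
have b1 : f0 (iter n f1 c1) <= cc.
  by rewrite -(bp_f01 bp); apply: (increasing_onW (bp_f0inc bp)) => //; lra.
have b2 : gam <= f0 (iter n f1 c1).
  rewrite -(bp_f0del bp); apply: (increasing_onW (bp_f0inc bp)); try lra.
have [//|//||h3 h4 h5] := @realizes_word j G N N w j0 j1 rG _ _ x _ _ _ h1 h2; first lra.
split=> // k tk kn.
have -> : k = ((k - t.+1) + t.+1)%N by rewrite subnK.
rewrite iterD iterS.
have [h6 h7] : iter n f1 c1 < T (iter t T x) /\ T (iter t T x) < 1.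
  by apply: T_f0 => //; rewrite (bp_f01 bp).
have kn' : (k - t.+1 <= n)%N by rewrite leq_subLR addSn -addnS.
have := @inverts_iter f1 n (k - t.+1) c1 1 (T (iter t T x)) (bp_f1I bp) (bp_f1inc bp) (bp_f1con bp) T_f1 ltac:(lra) ltac:(lra) (lexx 1) kn'.
rewrite i1 => /(_ h6 h7) [h8 h9].
have /andP[c1up _] := iter_f1_above (n - (k - t.+1)) (x := c1) ltac:(lra).
by rewrite i1 in h9; rewrite (le_lt_trans c1up h8) h9.
Qed.

Lemma occupation_visits n t x :
  (forall k, (t < k)%N -> (k <= n)%N -> ~ Y (iter k T x)) ->
  occupation T Y n x <= (visits t x).+1%:R.
Proof.
move=> H; rewrite /occupation /visits.
pose f k : nat := `[< Y (iter k T x) >].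
have -> : \sum_(1 <= k < n.+1) (\1_Y (iter k T x) : R) = (\sum_(1 <= k < n.+1) f k)%:R.
  rewrite natr_sum; apply: eq_bigr => k _; rewrite indicE /f.
  by case: asboolP => h; [rewrite mem_set|rewrite memNset].
rewrite ler_nat; have f1' k : (f k <= 1)%N by rewrite /f; case: asbool.
have [nt|tn] := ltnP n t.
  apply/leqW; rewrite [leqRHS](@big_cat_nat _ _ _ n.+1)//=.
  rewrite (@big_ltn _ _ _ 0 n.+1)//= -addnA addnCA; exact: leq_addr.
have : (\sum_(1 <= k < n.+1) f k <= \sum_(0 <= k < n.+1) f k)%N.
  by rewrite (@big_ltn _ _ _ 0 n.+1)//= leq_addl.
move/leq_trans; apply.
rewrite (@big_cat_nat _ _ _ t.+1)//= [X in (_ + X)%N]big_nat [X in (_ + X)%N]big1 ?addn0; last first.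
  move=> k /andP[tk kn]; apply/eqP; rewrite eqb0; apply/asboolPn; exact: H.
by rewrite big_nat_recr//= -addn1 leq_add2l.
Qed.

End Words.

(** * One-sided derivatives *)

Section OneSided.
Variable R : realType.
Implicit Types (f : R -> R) (a b x : R).

Lemma derivable_in_quot a b f x : derivable_in `[a, b] f x -> forall e, 0 < e ->
  exists2 d, 0 < d & forall y, a <= y <= b -> y != x -> `|y - x| < d ->
    `|diff_quot f x y - derive_in `[a, b] f x| < e.
Proof.
move=> df e e0; have /cvgrPdist_lt/(_ e e0) := df.
rewrite near_withinE /dnbhs near_withinE => /nbhs_ballP[d /= d0 H].
exists d => // y aby yx dyx; rewrite distrC; apply: H => //=.
by rewrite /ball /= distrC.
Qed.

Lemma derivable_in_continuous a b f :
  (forall x, a <= x <= b -> derivable_in `[a, b] f x) ->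
  {within `[a, b], continuous f}.
Proof.
move=> df; apply/subspace_continuousP => x /= xab; rewrite in_itv /= in xab.
have [d d0 H] := @derivable_in_quot a b f x (df x xab) 1 ltr01.
apply/cvgrPdist_lt => e e0; rewrite near_withinE.
pose L := `|derive_in `[a, b] f x| + 1.
have L0 : 0 < L by rewrite /L ltr_wpDl.
apply/nbhs_ballP; exists (Num.min d (e / L)) => /=.
  by rewrite lt_min d0 divr_gt0.
move=> y; rewrite /ball /= lt_min => /andP[xyd xye]; rewrite in_itv /= => yab.
have [->|yx] := eqVneq y x; first by rewrite subrr normr0.
rewrite distrC in xyd; have := H y yab yx xyd; rewrite /diff_quot => h.
have yx0 : y - x != 0 by rewrite subr_eq0.
rewrite distrC -[f y - f x](divfK yx0) normrM distrC -(divfK (lt0r_neq0 L0) e) mulrC distrC.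
have h' : `|(f y - f x) / (y - x)| < L.
  rewrite /L -ltrBlDl; apply: le_lt_trans h; exact: lerB_dist.
rewrite [`|y - x|]distrC; apply: ltr_pM => //.
Qed.

Lemma derivable_in_is_derive a b f x : a < x < b -> derivable_in `[a, b] f x ->
  is_derive x 1 f (derive_in `[a, b] f x).
Proof.
move=> /andP[ax xb] df; set L := derive_in _ _ _.
have H : h^-1 *: ((f \o shift x) (h *: 1) - f x) @[h --> 0^'] --> L.
  apply/cvgrPdist_lt => e e0.
  have [d d0 H] := derivable_in_quot df e0.
  rewrite /dnbhs near_withinE; apply/nbhs_ballP.
  exists (Num.min d (Num.min (x - a) (b - x))) => /=.
    by rewrite !lt_min d0 /= !subr_gt0 ax.
  move=> h; rewrite /ball /= sub0r normrN !lt_min => /andP[hd /andP[hxa hbx]] h0.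
  have [h1 h2] : - (x - a) < h /\ h < b - x.
    move: hxa hbx; rewrite !ltr_norml => /andP[? _] /andP[_ ?]; split=> //.
  have := H (h + x).
  rewrite /diff_quot addrK -subr_eq0 addrK distrC => /(_ _ h0 hd).
  rewrite /GRing.scale /= mulr1 mulrC; apply; apply/andP; split; lra.
apply: DeriveDef; first by apply/cvg_ex; exists L.
by rewrite /derive; apply: cvg_lim.
Qed.

(** Inside ]x, y[ the one-sided quotients are ordinary ones, so this is the usual mean
    value theorem. *)
Lemma derivable_in_MVT a b f x y :
  (forall z, a <= z <= b -> derivable_in `[a, b] f z) ->
  a <= x -> x < y -> y <= b ->
  exists2 z, x < z < y & f y - f x = derive_in `[a, b] f z * (y - x).
Proof.
move=> df ax xy yb.
have cf : {within `[x, y], continuous f}.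
  apply: continuous_subspaceW (derivable_in_continuous df).
  by move=> z /=; rewrite !in_itv /= => /andP[xz zy]; apply/andP; split; lra.
have [|z zxy fxy] := @MVT R f (derive_in `[a, b] f) x y xy _ cf.
  move=> z; rewrite in_itv /= => /andP[xz zy]; apply: derivable_in_is_derive.
    by apply/andP; split; lra.
  by apply: df; apply/andP; split; lra.
by exists z => //; move: zxy; rewrite in_itv.
Qed.

Lemma C2_on_bounded a b f : a <= b -> C2_on `[a, b] f ->
  exists2 M, 0 <= M & forall x, a <= x <= b ->
    `|derive_in `[a, b] (derive_in `[a, b] f) x| <= M.
Proof.
move=> ab [_ _ cf].
have [u _ Hu] := EVT_max ab cf.
have [v _ Hv] := EVT_min ab cf.
set g := derive_in _ _ in Hu Hv *.
exists (`|g u| + `|g v|); first exact: addr_ge0.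
move=> x xab; rewrite ler_norml; apply/andP; split.
  have := Hv x; rewrite in_itv /= => /(_ xab) h; apply: le_trans h.
  have := ler_norm (- g v); rewrite normrN; have := normr_ge0 (g u); lra.
have := Hu x; rewrite in_itv /= => /(_ xab) h; apply: (le_trans h).
have := ler_norm (g u); have := normr_ge0 (g v); lra.
Qed.

End OneSided.

(** * Inverses of expanding branches *)

Section InverseBranch.
Variable R : realType.
Variables (tau d f : R -> R) (p q M : R).

(** tau is a branch on [p, q] and f its inverse.  The derivative d enters through the mean
    value theorem, so that one-sided derivatives at p and q are covered. *)
Record smooth_branch : Prop := SmoothBranch {
  sb_pq : p < q;
  sb_M : 0 <= M;
  sb_mvt : forall x y, p <= x -> x < y -> y <= q ->
    exists2 z, x < z < y & tau y - tau x = d z * (y - x);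
  sb_ge1 : forall x, p <= x <= q -> 1 <= d x;
  sb_lip : forall x y, p <= x <= q -> p <= y <= q -> d x - d y <= M * `|x - y|;
  sb_self : forall x, p <= x <= q -> 0 <= tau x <= 1;
  sb_f : forall y, 0 <= y <= 1 -> p <= f y <= q /\ tau (f y) = y;
  sb_tau : forall x, p <= x <= q -> f (tau x) = x
}.

Hypothesis sb : smooth_branch.

Lemma tau_expands x y : p <= x -> x <= y -> y <= q -> y - x <= tau y - tau x.
Proof.
move=> px; rewrite le_eqVlt => /orP[/eqP->|xy] yq; first by rewrite !subrr.
have [z /andP[xz zy] ->] := sb_mvt sb px xy yq.
by rewrite ler_peMl ?subr_ge0 ?(ltW xy)// (sb_ge1 sb)//; apply/andP; split; lra.
Qed.

Lemma inv_increasing : increasing_on 0 1 f.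
Proof.
move=> a b a0 ab b1.
have [/andP[f1 f2] f3] := sb_f sb (y := a) ltac:(lra).
have [/andP[f4 f5] f6] := sb_f sb (y := b) ltac:(lra).
rewrite ltNge; apply/negP => ba.
by have := tau_expands f4 ba f2; lra.
Qed.

Lemma inv_contracts : contracts 0 1 1 f.
Proof.
move=> a b a0 ab b1; rewrite mul1r.
have [/andP[f1 f2] f3] := sb_f sb (y := a) ltac:(lra).
have [/andP[f4 f5] f6] := sb_f sb (y := b) ltac:(lra).
by have := tau_expands f1 (increasing_onW inv_increasing a0 ab b1) f5; rewrite f3 f6.
Qed.

Lemma inv_mvt a b : 0 <= a -> a < b -> b <= 1 ->
  exists2 z, f a < z < f b & b - a = d z * (f b - f a).
Proof.
move=> a0 ab b1.
have [/andP[f1 f2] f3] := sb_f sb (y := a) ltac:(lra).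
have [/andP[f4 f5] f6] := sb_f sb (y := b) ltac:(lra).
have := sb_mvt sb f1 (inv_increasing a0 ab b1) f5.
by rewrite f3 f6.
Qed.

Lemma inv_contracts_in s t rho : 0 <= s -> t <= 1 -> 0 < rho ->
  (forall z, f s <= z <= f t -> rho <= d z) -> contracts s t rho^-1 f.
Proof.
move=> s0 t1 r0 H a b sa; rewrite le_eqVlt => /orP[/eqP->|ab] bt; first by rewrite !subrr mulr0.
have [z /andP[az zb] ->] := inv_mvt (a := a) (b := b) ltac:(lra) ab ltac:(lra).
have h1 : f s <= f a by apply: (increasing_onW inv_increasing); lra.
have h2 : f b <= f t by apply: (increasing_onW inv_increasing); lra.
have hz := H z ltac:(lra).
have h3 : 0 <= f b - f a by lra.
rewrite mulrA ler_peMl// mulrC ler_pdivlMr// mul1r.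
exact: hz.
Qed.

(** The quotients of f are values of 1 / d.  As d >= 1, an M-Lipschitz d has an M-Lipschitz
    logarithm, and f does not expand distances. *)
Lemma inv_log_lipschitz : log_lipschitz_slopes 0 1 M f.
Proof.
move=> s t s0 st t1 a b a' b' sa ab bt sa' ab' bt'.
move: ab ab'; rewrite (le_eqVlt a) (le_eqVlt a') => /orP[/eqP->|ab].
  by move=> _; rewrite !subrr !(mulr0, mul0r).
move=> /orP[/eqP->|ab']; first by rewrite !subrr !(mulr0, mul0r).
have [z /andP[az zb] ez] := inv_mvt (a := a) (b := b) ltac:(lra) ab ltac:(lra).
have [z' /andP[az' zb'] ez'] := inv_mvt (a := a') (b := b') ltac:(lra) ab' ltac:(lra).
have fW u v : 0 <= u -> u <= v -> v <= 1 -> f u <= f v by exact: (increasing_onW inv_increasing).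
have m1 : f s <= f a by apply: fW; lra.
have m2 : f b <= f t by apply: fW; lra.
have m3 : f s <= f a' by apply: fW; lra.
have m4 : f b' <= f t by apply: fW; lra.
have [/andP[f1 f2] _] := sb_f sb (y := s) ltac:(lra).
have [/andP[f3 f4] _] := sb_f sb (y := t) ltac:(lra).
have k1 := sb_ge1 sb (x := z) ltac:(lra).
have k2 := sb_ge1 sb (x := z') ltac:(lra).
have lip := sb_lip sb (x := z') (y := z) ltac:(lra) ltac:(lra).
have M0 := sb_M sb.
have dist : `|z' - z| <= t - s.
  have := inv_contracts s0 st t1; rewrite mul1r => h.
  by rewrite ler_norml; apply/andP; split; lra.
have ft0 : 0 <= M * (t - s) by apply: mulr_ge0 => //; lra.
have ez'' : d z' <= expR (M * (t - s)) * d z.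
  have h1 : M * `|z' - z| <= M * (t - s) by apply: ler_wpM2l.
  have h2 := expR_ge1Dx (M * (t - s)).
  have h3 : (1 + M * (t - s)) * d z <= expR (M * (t - s)) * d z by apply: ler_wpM2r => //; lra.
  have h4 : M * (t - s) <= M * (t - s) * d z by apply: ler_peMr.
  by lra.
rewrite ez ez'.
have p1 : 0 <= f b - f a by rewrite subr_ge0; apply: fW; lra.
have p2 : 0 <= f b' - f a' by rewrite subr_ge0; apply: fW; lra.
have -> : (f b - f a) * (d z' * (f b' - f a')) = d z' * ((f b - f a) * (f b' - f a')) by ring.
have -> : expR (M * (t - s)) * ((f b' - f a') * (d z * (f b - f a))) =
  expR (M * (t - s)) * d z * ((f b - f a) * (f b' - f a')) by ring.
by apply: ler_wpM2r => //; exact: mulr_ge0.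
Qed.

Lemma inv_0 : f 0 = p.
Proof.
have [/andP[f1 f2] f3] := sb_f sb (y := 0) ltac:(lra).
have := sb_pq sb => pq.
have h := tau_expands (lexx p) f1 f2.
have := sb_self sb (x := p) ltac:(lra); lra.
Qed.

Lemma inv_1 : f 1 = q.
Proof.
have [/andP[f1 f2] f3] := sb_f sb (y := 1) ltac:(lra).
have := sb_pq sb => pq.
have h := tau_expands f1 f2 (lexx q).
have := sb_self sb (x := q) ltac:(lra); lra.
Qed.

Lemma inv_surj x : p <= x <= q -> exists2 y, 0 <= y <= 1 & f y = x.
Proof. by move=> xpq; exists (tau x); [exact: (sb_self sb)|exact: (sb_tau sb)]. Qed.

Lemma inv_inverts T : (forall x, p < x -> x < q -> T x = tau x) -> inverts T f.
Proof.
move=> Ttau s t x s0 st t1 sx xt.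
have [/andP[f1 f2] f3] := sb_f sb (y := s) ltac:(lra).
have [/andP[f4 f5] f6] := sb_f sb (y := t) ltac:(lra).
rewrite Ttau; try lra.
have h1 := tau_expands f1 (ltW sx) ltac:(lra).
have h2 := tau_expands (x := x) (y := f t) ltac:(lra) (ltW xt) f5.
by lra.
Qed.

Lemma inv_range : 0 <= p -> q <= 1 -> forall x, 0 <= x <= 1 -> 0 <= f x <= 1.
Proof. by move=> p0 q1 x x01; have [/andP[h1 h2] _] := sb_f sb x01; lra. Qed.

Lemma inv_lower_slope L : 0 < L -> (forall z, p <= z <= q -> d z <= L) ->
  forall a b, 0 <= a -> a <= b -> b <= 1 -> b - a <= L * (f b - f a).
Proof.
move=> L0 H a b a0; rewrite le_eqVlt => /orP[/eqP->|ab] b1; first by rewrite !subrr mulr0.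
have [z /andP[az zb] ->] := inv_mvt a0 ab b1.
have [/andP[f1 f2] _] := sb_f sb (y := a) ltac:(lra).
have [/andP[f4 f5] _] := sb_f sb (y := b) ltac:(lra).
by apply: ler_wpM2r; [lra|apply: H; lra].
Qed.

End InverseBranch.

Lemma contracts_le (R : realType) (f : R -> R) s t u v :
  u <= v -> contracts s t u f -> contracts s t v f.
Proof.
move=> uv C x y sx xy yt; apply: (le_trans (C _ _ sx xy yt)).
by apply: ler_wpM2r; rewrite ?subr_ge0.
Qed.

Lemma contracts_lt_id (R : realType) (f : R -> R) : f 0 = 0 -> contracts 0 1 1 f ->
  (forall e, 0 < e -> exists2 th, th < 1 & contracts e 1 th f) ->
  forall x, 0 < x <= 1 -> f x < x.
Proof.
move=> f0 Cf away x /andP[x0 x1]; have x20 : 0 < x / 2 by rewrite divr_gt0.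
have [th th1 C] := away _ x20.
have h1 := C (x / 2) x (lexx _) ltac:(lra) x1.
have := Cf 0 (x / 2) (lexx _) ltac:(lra) ltac:(lra); rewrite f0 => h2.
have : th * (x - x / 2) < 1 * (x - x / 2) by rewrite ltr_pM2r //; lra.
by lra.
Qed.

Lemma contracts_gt_id (R : realType) (f : R -> R) : f 1 = 1 -> contracts 0 1 1 f ->
  (forall e, 0 < e -> exists2 th, th < 1 & contracts 0 (1 - e) th f) ->
  forall x, 0 <= x < 1 -> x < f x.
Proof.
move=> f1 Cf away x /andP[x0 x1]; have x20 : 0 < (1 - x) / 2 by rewrite divr_gt0//; lra.
have [th th1 C] := away _ x20.
have h1 := C x (1 - (1 - x) / 2) x0 ltac:(lra) (lexx _).
have := Cf (1 - (1 - x) / 2) 1 ltac:(lra) ltac:(lra) (lexx _); rewrite f1 => h2.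
have : th * (1 - (1 - x) / 2 - x) < 1 * (1 - (1 - x) / 2 - x) by rewrite ltr_pM2r //; lra.
by lra.
Qed.

(** * The branches of a Thaler map *)

Section ThalerBranches.
Variable R : realType.
Variables (T T0 T1 : R -> R) (c p a : R) (f0 f1 : R -> R).
Hypothesis hT : thaler_map T T0 T1 c p a.
Hypothesis hf0 : inverse_branch `[0, c] T0 f0.
Hypothesis hf1 : inverse_branch `[c, 1] T1 f1.

Let d0 := derive_in `[0, c] T0.
Let d1 := derive_in `[c, 1] T1.

Lemma thaler_d0_increasing x y : 0 <= x -> x < y -> y <= c -> d0 x < d0 y.
Proof.
move=> x0 xy yc; have [_ H _] := thaler_C2_0 hT.
have [z /andP[xz zy] e] : exists2 z, x < z < y & d0 y - d0 x = derive_in `[0, c] d0 z * (y - x).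
  by apply: (derivable_in_MVT (a := 0) (b := c)) => // z hz; apply: H; rewrite /= in_itv.
have : 0 < derive_in `[0, c] d0 z by apply: (thaler_dd0 hT); lra.
move=> dz; have h : 0 < derive_in `[0, c] d0 z * (y - x) by apply: mulr_gt0; lra.
by lra.
Qed.

Lemma thaler_d1_decreasing x y : c <= x -> x < y -> y <= 1 -> d1 y < d1 x.
Proof.
move=> x0 xy yc; have [_ H _] := thaler_C2_1 hT.
have [z /andP[xz zy] e] : exists2 z, x < z < y & d1 y - d1 x = derive_in `[c, 1] d1 z * (y - x).
  by apply: (derivable_in_MVT (a := c) (b := 1)) => // z hz; apply: H; rewrite /= in_itv.
have : derive_in `[c, 1] d1 z < 0 by apply: (thaler_dd1 hT); lra.
move=> dz; have h : 0 < - derive_in `[c, 1] d1 z * (y - x) by apply: mulr_gt0; lra.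
by lra.
Qed.

Lemma C2_on_slope_lipschitz u v (tau : R -> R) : u <= v -> C2_on `[u, v] tau ->
  exists2 M, 0 <= M & forall x y, u <= x <= v -> u <= y <= v ->
    derive_in `[u, v] tau x - derive_in `[u, v] tau y <= M * `|x - y|.
Proof.
move=> uv C2; have [M M0 HM] := C2_on_bounded uv C2; exists M => //.
have [_ H _] := C2; set d := derive_in _ _ in H HM *.
have mvt x y : u <= x -> x < y -> y <= v -> `|d y - d x| <= M * (y - x).
  move=> ux xy yv.
  have [z /andP[xz zy] ->] : exists2 z, x < z < y & d y - d x = derive_in `[u, v] d z * (y - x).
    by apply: (derivable_in_MVT (a := u) (b := v)) => // z hz; apply: H; rewrite /= in_itv.
  have yx : 0 <= y - x by lra.
  by rewrite normrM (ger0_norm yx); apply: ler_wpM2r => //; apply: HM; lra.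
move=> x y /andP[ux xv] /andP[uy yv]; have [xy|yx|->] := ltgtP x y.
- rewrite (le_trans (ler_norm _))// distrC (le_trans (mvt _ _ ux xy yv))//.
  by rewrite distrC ger0_norm//; lra.
- rewrite (le_trans (ler_norm _))// (le_trans (mvt _ _ uy yx xv))//.
  by rewrite ger0_norm//; lra.
- by rewrite !subrr normr0 mulr0.
Qed.

Lemma thaler_smooth_branches : exists M,
  smooth_branch T0 d0 f0 0 c M /\ smooth_branch T1 d1 f1 c 1 M.
Proof.
have /andP[c_0 c_1] := thaler_c hT.
have [M0 M00 L0] := C2_on_slope_lipschitz (ltW c_0) (thaler_C2_0 hT).
have [M1 M10 L1] := C2_on_slope_lipschitz (ltW c_1) (thaler_C2_1 hT).
exists (M0 + M1).
have [D0 _ _] := thaler_C2_0 hT; have [D1 _ _] := thaler_C2_1 hT.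
have [g0 g0'] := hf0; have [g1 g1'] := hf1.
split; split=> //; try lra.
- move=> x y x0 xy yc; apply: (@derivable_in_MVT R 0 c T0 x y _ x0 xy yc) => z hz.
  by apply: D0; rewrite /= in_itv.
- move=> x /andP[]; rewrite le_eqVlt => /orP[/eqP<-|x0] xc.
    by rewrite /d0 (thaler_indiff0 hT).
  by apply/ltW/(thaler_d0 hT); apply/andP.
- move=> x y hx hy; apply: (le_trans (L0 x y hx hy)); apply: ler_wpM2r => //; lra.
- exact: (thaler_self0 hT).
- move=> x y x0 xy yc; apply: (@derivable_in_MVT R c 1 T1 x y _ x0 xy yc) => z hz.
  by apply: D1; rewrite /= in_itv.
- move=> x /andP[xc]; rewrite le_eqVlt => /orP[/eqP->|x1].
    by rewrite /d1 (thaler_indiff1 hT).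
  by apply/ltW/(thaler_d1 hT); apply/andP.
- move=> x y hx hy; apply: (le_trans (L1 x y hx hy)); apply: ler_wpM2r => //; lra.
- exact: (thaler_self1 hT).
Qed.

(** By convexity the slopes of the branches are largest at c, so those of the inverse
    branches are bounded below. *)
Lemma thaler_lower_slopes M : smooth_branch T0 d0 f0 0 c M -> smooth_branch T1 d1 f1 c 1 M ->
  exists L, 1 <= L /\ forall u v, 0 <= u -> u <= v -> v <= 1 ->
    v - u <= L * (f0 v - f0 u) /\ v - u <= L * (f1 v - f1 u).
Proof.
move=> sb0 sb1; have /andP[c_0 c_1] := thaler_c hT.
have D0c : 1 <= d0 c by apply: (sb_ge1 sb0); rewrite lexx ltW.
have D1c : 1 <= d1 c by apply: (sb_ge1 sb1); rewrite lexx ltW.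
have L0 : 0 < d0 c + d1 c by lra.
exists (d0 c + d1 c); split=> [|u v u0 uv v1]; first lra.
split.
- apply: (inv_lower_slope sb0) => // z /andP[z0].
  rewrite le_eqVlt => /orP[/eqP->|zc]; first by rewrite lerDl; lra.
  by have := thaler_d0_increasing z0 zc (lexx c); lra.
- apply: (inv_lower_slope sb1) => // z /andP[].
  rewrite le_eqVlt => /orP[/eqP<- _|cz z1]; first by rewrite lerDr; lra.
  by have := thaler_d1_decreasing (lexx c) cz z1; lra.
Qed.

Lemma thaler_T0E x : 0 < x -> x < c -> T x = T0 x.
Proof. by move=> x0 xc; rewrite (thaler_ext0 hT)// in_itv /=; apply/andP; split; lra. Qed.

Lemma thaler_T1E x : c < x -> x < 1 -> T x = T1 x.
Proof. by move=> x0 xc; rewrite (thaler_ext1 hT)// in_itv /=; apply/andP; split; lra. Qed.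

(** By convexity the slope of T0 is increasing, so f0 contracts on [u, 1] by the inverse of
    the slope at f0 u, which is larger than 1 for u > 0; symmetrically for f1. *)
Lemma thaler_branch_pair gamma : 0 < gamma < c -> c < T gamma < 1 -> T (T gamma) = gamma ->
  exists M theta L,
  [/\ branch_pair f0 f1 M theta c gamma (T gamma), inverts T f0, inverts T f1 & 1 <= L] /\
  (forall u v, 0 <= u -> u <= v -> v <= 1 ->
    v - u <= L * (f0 v - f0 u) /\ v - u <= L * (f1 v - f1 u)).
Proof.
move=> /andP[g_0 g_c] /andP[c_d d_1] per.
have /andP[c_0 c_1] := thaler_c hT.
have [M [sb0 sb1]] := thaler_smooth_branches.
have f00 := inv_0 sb0; have f01 := inv_1 sb0; have f10 := inv_0 sb1; have f11 := inv_1 sb1.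
have f0d : f0 (T gamma) = gamma by rewrite thaler_T0E// (sb_tau sb0)//; lra.
have f1g : f1 gamma = T gamma by rewrite -{1}per thaler_T1E// (sb_tau sb1)//; lra.
have I0 := inv_increasing sb0; have I1 := inv_increasing sb1.
have away0 u : 0 < u -> u <= 1 -> contracts u 1 (d0 (f0 u))^-1 f0 /\ 1 < d0 (f0 u).
  move=> u0 u1; have fu0 : 0 < f0 u by rewrite -f00; apply: I0; lra.
  have [/andP[_ fuc] _] := sb_f sb0 (y := u) ltac:(lra).
  have d1u : 1 < d0 (f0 u) by apply: (thaler_d0 hT); apply/andP.
  split=> //; apply: (inv_contracts_in sb0); try lra.
  move=> z /andP[]; rewrite le_eqVlt => /orP[/eqP<-//|uz]; rewrite f01 => zc.
  by apply/ltW/thaler_d0_increasing; lra.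
have away1 u : 0 <= u -> u < 1 -> contracts 0 u (d1 (f1 u))^-1 f1 /\ 1 < d1 (f1 u).
  move=> u0 u1; have fu0 : f1 u < 1 by rewrite -f11; apply: I1; lra.
  have [/andP[fuc _] _] := sb_f sb1 (y := u) ltac:(lra).
  have d1u : 1 < d1 (f1 u) by apply: (thaler_d1 hT); apply/andP.
  split=> //; apply: (inv_contracts_in sb1); try lra.
  move=> z /andP[+ +]; rewrite f10 [z <= _]le_eqVlt => cz /orP[/eqP->//|uz].
  by apply/ltW/thaler_d1_decreasing; lra.
have inv_lt1 (r : R) : 1 < r -> 0 <= r^-1 < 1.
  by move=> r1; rewrite invr_ge0 invf_lt1; lra.
have [Cd Dd] := away0 (T gamma) ltac:(lra) ltac:(lra).
have [Cg Dg] := away1 gamma ltac:(lra) ltac:(lra).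
have /andP[i1 i2] := inv_lt1 _ Dd; have /andP[i3 i4] := inv_lt1 _ Dg.
pose theta := Num.max (d0 (f0 (T gamma)))^-1 (d1 (f1 gamma))^-1.
have A0 e : 0 < e -> exists2 th, th < 1 & contracts e 1 th f0.
  move=> e0; have [e1|e1] := leP e 1.
    have [C D] := away0 e e0 e1; have /andP[_ j] := inv_lt1 _ D.
    by exists (d0 (f0 e))^-1.
  by exists 0 => // x y ex xy y1; move: (le_trans (le_trans ex xy) y1); rewrite leNgt e1.
have A1 e : 0 < e -> exists2 th, th < 1 & contracts 0 (1 - e) th f1.
  move=> e0; have [e1|e1] := leP e 1.
    have e2 : 0 <= 1 - e by rewrite subr_ge0.
    have e3 : 1 - e < 1 by rewrite ltrBlDr ltrDl.
    have [C D] := away1 (1 - e) e2 e3; have /andP[_ j] := inv_lt1 _ D.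
    by exists (d1 (f1 (1 - e)))^-1.
  by exists 0 => // x y ex xy y1; move: (le_trans (le_trans ex xy) y1); rewrite subr_ge0 leNgt e1.
have [L [L1 low]] := thaler_lower_slopes sb0 sb1.
exists M, theta, L; split=> //.
split=> //.
- split=> //.
  + exact: (sb_M sb0).
  + by rewrite le_max i1 gt_max i2 i4.
  + exact: (inv_range sb0 (lexx 0) (ltW c_1)).
  + exact: (inv_range sb1 (ltW c_0) (lexx 1)).
  + exact: (inv_contracts sb0).
  + exact: (inv_contracts sb1).
  + exact: (inv_log_lipschitz sb0).
  + exact: (inv_log_lipschitz sb1).
  + by apply: contracts_le Cd; rewrite /theta le_max lexx.
  + by apply: contracts_le Cg; rewrite /theta le_max lexx orbT.
  + exact: (contracts_lt_id f00 (inv_contracts sb0) A0).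
  + exact: (contracts_gt_id f11 (inv_contracts sb1) A1).
  + exact: (inv_surj sb0).
  + exact: (inv_surj sb1).
- exact: (inv_inverts sb0 thaler_T0E).
- exact: (inv_inverts sb1 thaler_T1E).
Qed.

End ThalerBranches.

(** * Measure of the hitting-time levels *)

Section DensityBounds.
Variable R : realType.
Variable mu : {measure set (measurableTypeR R) -> \bar R}.
Variable h : R -> R.
Let leb := @lebesgue_measure R.
Hypothesis muE : forall A : set (measurableTypeR R), measurable A ->
  mu A = (\int[leb]_(x in A `&` `]0%R, 1%R[) (h x)%:E)%E.
Hypothesis mh : measurable_fun (`]0, 1[%classic : set R) h.
Hypothesis h0 : forall x, 0 < x < 1 -> 0 <= h x.

Lemma density_le (E : set R) B : measurable E -> E `<=` `]0, 1[ -> 0 <= B ->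
  (forall x, E x -> h x <= B) -> (mu E <= B%:E * leb E)%E.
Proof.
move=> mE E01 B0 HB; rewrite muE// (_ : E `&` _ = E); last by apply/setIidl.
have -> : (B%:E * leb E = \int[leb]_(x in E) (cst B%:E) x)%E by rewrite integral_cst.
have mhE : measurable_fun E h by apply: measurable_funS mh.
apply: ge0_le_integral => //.
- by move=> x /E01 /=; rewrite in_itv /= => x01; rewrite lee_fin h0.
- exact/measurable_EFinP.
Qed.

Lemma density_ge (E : set R) A : measurable E -> E `<=` `]0, 1[ -> 0 <= A ->
  (forall x, E x -> A <= h x) -> (A%:E * leb E <= mu E)%E.
Proof.
move=> mE E01 A0 HA; rewrite muE// (_ : E `&` _ = E); last by apply/setIidl.
have -> : (A%:E * leb E = \int[leb]_(x in E) (cst A%:E) x)%E by rewrite integral_cst.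
have mhE : measurable_fun E h by apply: measurable_funS mh.
apply: ge0_le_integral => //; exact/measurable_EFinP.
Qed.

End DensityBounds.

Section HitTime.
Variable R : realType.
Variables (T : R -> R) (Y : set R).

Lemma hit_time_first x m : (1 <= m)%N -> Y (iter m T x) ->
  (forall k, (1 <= k)%N -> (k < m)%N -> ~ Y (iter k T x)) ->
  hit_time T Y x = (m%:R)%:E.
Proof.
move=> m1 Ym H; apply/eqP; rewrite eq_le; apply/andP; split.
  by apply: ereal_inf_lbound; exists m.
apply: le_ereal_inf_tmp => _ [k [k1 Yk] <-]; rewrite lee_fin ler_nat leqNgt.
by apply/negP => km; exact: (H k).
Qed.

Lemma hit_time_inv x n : hit_time T Y x = (n%:R)%:E ->
  exists m, [/\ (1 <= m)%N, Y (iter m T x) & forall k, (1 <= k)%N -> (k < m)%N -> ~ Y (iter k T x)].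
Proof.
move=> hn.
have [k [k1 Yk]] : exists k, (1 <= k)%N /\ Y (iter k T x).
  apply: contrapT => /forallNP H; move: hn; rewrite /hit_time.
  rewrite (_ : [set k | _] = set0) ?image_set0 ?ereal_inf0//.
  by apply/seteqP; split=> // k; exact: H.
pose P k := (1 <= k)%N && `[< Y (iter k T x) >].
have exP : exists k, P k by exists k; rewrite /P k1; apply/asboolP.
exists (ex_minn exP); case: ex_minnP => m /andP[m1 /asboolP Ym] Hm; split=> // i i1 im Yi.
by have := Hm i; rewrite /P i1 /= => /(_ (introT (asboolP _) Yi)); rewrite leqNgt im.
Qed.

End HitTime.

(** The terms with k < n are bounded by y k.  The remaining ones are at most y n times a
    geometric series of sum at most n.+1, and (n - 1) * y n is at most the partial sum;
    4 = 1 + 3 since n.+1 <= 3 (n - 1). *)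
Lemma laplace_sum (R : realType) (y : nat -> R) (n K : nat) : (forall k, 0 <= y k) ->
  (forall k, y k.+1 <= y k) -> (2 <= n)%N ->
  \sum_(1 <= k < K) expR (- (k%:R * n%:R^-1)) * y k <= 4 * \sum_(1 <= k < n) y k.
Proof.
move=> y0 yd n2.
have yW i j : (i <= j)%N -> y j <= y i.
  move=> /subnKC <-; elim: (j - i)%N => [|d IH]; first by rewrite addn0.
  by rewrite addnS (le_trans (yd _)).
have n0 : 0 < n%:R :> R by rewrite ltr0n; lia.
pose q := expR (- (n%:R^-1)) : R.
have qk k : expR (- (k%:R * n%:R^-1)) = q ^+ k.
  by rewrite /q -mulrN expRM_natl.
have q0 : 0 <= q by exact: expR_ge0.
have q_le1 : q <= 1 by rewrite -[leRHS]expR0 ler_expR oppr_le0 invr_ge0 ltW.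
have q1 : (1 - q) * n.+1%:R >= 1.
  have h1 := expR_ge1Dx (n%:R^-1 : R).
  have h2 : q * expR (n%:R^-1) = 1 by rewrite /q -expRD addNr expR0.
  have h3 : q * (1 + n%:R^-1) <= 1 by apply: (le_trans (ler_wpM2l q0 h1)); rewrite h2.
  have h4 : q * (1 + n%:R^-1) * n%:R <= 1 * n%:R by apply: ler_wpM2r => //; exact: ltW.
  have h5 : q * (1 + n%:R^-1) * n%:R = q * n.+1%:R by rewrite -natr1; field; exact: lt0r_neq0.
  by rewrite -natr1 in h5 *; lra.
have geo m : (1 - q) * \sum_(0 <= k < m) q ^+ k <= 1.
  have -> : (1 - q) * \sum_(0 <= k < m) q ^+ k = 1 - q ^+ m.
    elim: m => [|m IH]; first by rewrite big_geq// mulr0 expr0 subrr.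
    by rewrite big_nat_recr//= mulrDr IH exprS; ring.
  by rewrite gerBl exprn_ge0.
have geo' m : \sum_(0 <= k < m) q ^+ k <= n.+1%:R.
  have S0 : 0 <= \sum_(0 <= k < m) q ^+ k by apply: sumr_ge0 => k _; exact: exprn_ge0.
  have q1' : 0 < 1 - q by have n10 : 0 < n.+1%:R :> R by []; rewrite -(pmulr_lgt0 _ n10); lra.
  by rewrite -(ler_pM2l q1') (le_trans (geo m)).
apply: (@le_trans _ _ (\sum_(1 <= k < K) ((k < n)%N%:R * y k + y n * q ^+ k))).
  apply: ler_sum => k _; rewrite qk; have [kn|nk] := ltnP k n.
    rewrite mul1r ler_wpDr//; first by rewrite mulr_ge0// exprn_ge0.
    by rewrite ler_piMl// exprn_ile1.
  by rewrite mul0r add0r mulrC ler_wpM2r ?exprn_ge0// yW.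
rewrite big_split /= -mulr_sumr.
have h1 : \sum_(1 <= k < K) (k < n)%N%:R * y k <= \sum_(1 <= k < n) y k.
  apply: (@le_trans _ _ (\sum_(1 <= k < maxn K n) (k < n)%N%:R * y k)).
    case: (leqP 1 K) => [K1|]; last by rewrite ltnS leqn0 => /eqP->; rewrite big_geq// sumr_ge0// => k _; rewrite mulr_ge0.
    rewrite [leRHS](@big_cat_nat _ _ _ K)//= ?leq_maxl// lerDl sumr_ge0// => k _; exact: mulr_ge0.
  rewrite (@big_cat_nat _ _ _ n)//= ?leq_maxr//; last exact: ltnW.
  rewrite [X in _ + X]big_nat [X in _ + X]big1 ?addr0; last first.
    by move=> k /andP[nk _]; rewrite ltnNge nk mul0r.
  by rewrite big_nat [leRHS]big_nat; apply: ler_sum => k /andP[_ ->]; rewrite mul1r.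
have h2 : \sum_(1 <= k < K) q ^+ k <= n.+1%:R.
  case: K {h1} => [|K]; first by rewrite big_geq.
  apply: le_trans (geo' K.+1); rewrite [leRHS]big_nat_recl// expr0.
  by rewrite big_add1 /= ler_wpDl.
have h3 : (n.-1)%:R * y n <= \sum_(1 <= k < n) y k.
  have -> : (n.-1)%:R * y n = \sum_(1 <= k < n) y n.
    by rewrite big_const_nat iter_addr addr0 subn1 mulr_natl.
  by rewrite big_nat [leRHS]big_nat; apply: ler_sum => k /andP[_ kn]; exact/yW/ltnW.
have h4 : n.+1%:R <= 3 * (n.-1)%:R :> R.
  by rewrite -natrM ler_nat; case: n n2 {n0 h3 h1 h2 q q0 q_le1 qk q1 geo geo'} => [|[|n]]// _; lia.
have h5 : y n * \sum_(1 <= k < K) q ^+ k <= y n * n.+1%:R by apply: ler_wpM2l.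
have h6 : y n * n.+1%:R <= y n * (3 * (n.-1)%:R) by apply: ler_wpM2l.
by lra.
Qed.

Section Wandering.
Variable R : realType.
Variables f0 f1 : R -> R.
Variables M theta cc gam del : R.
Hypothesis bp : branch_pair f0 f1 M theta cc gam del.
Variables (T : R -> R) (c0 c1 L : R).
Hypothesis T_f0 : inverts T f0.
Hypothesis T_f1 : inverts T f1.
Hypothesis c0_gam : 0 < c0 <= gam.
Hypothesis c1_del : del <= c1 < 1.
Hypothesis T00 : T 0 = 0.
Hypothesis T11 : T 1 = 1.
Hypothesis L1 : 1 <= L.
Hypothesis low0 : forall u v, 0 <= u -> u <= v -> v <= 1 -> v - u <= L * (f0 v - f0 u).
Hypothesis low1 : forall u v, 0 <= u -> u <= v -> v <= 1 -> v - u <= L * (f1 v - f1 u).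

Let Y : set R := `[c0, c1]%classic.

Lemma inverts_eq (f : R -> R) y : increasing_on 0 1 f -> inverts T f -> 0 < y < 1 -> T (f y) = y.
Proof.
move=> If Hf /andP[y0 y1]; apply/eqP; rewrite eq_le; apply/andP; split; rewrite leNgt; apply/negP => h.
- pose t := (y + Num.min 1 (T (f y))) / 2.
  have ht : y < Num.min 1 (T (f y)) by rewrite lt_min y1.
  have t1 : Num.min 1 (T (f y)) <= 1 by rewrite ge_min lexx.
  have t2 : Num.min 1 (T (f y)) <= T (f y) by rewrite ge_min lexx orbT.
  have [h1 h2] : 0 < T (f y) /\ T (f y) < t.
    by apply: (Hf); rewrite ?/t //; try lra; apply: If; rewrite ?/t; lra.
  by move: h2; rewrite /t; lra.
- pose t := (y + Num.max 0 (T (f y))) / 2.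
  have ht : Num.max 0 (T (f y)) < y by rewrite gt_max y0.
  have t1 : 0 <= Num.max 0 (T (f y)) by rewrite le_max lexx.
  have t2 : T (f y) <= Num.max 0 (T (f y)) by rewrite le_max lexx orbT.
  have [h1 h2] : t < T (f y) /\ T (f y) < 1.
    by apply: (Hf); rewrite ?/t //; try lra; apply: If; rewrite ?/t; lra.
  by move: h1; rewrite /t; lra.
Qed.

Lemma iter_c0 n : [/\ 0 < iter n f0 c0, iter n.+1 f0 c0 < iter n f0 c0 & iter n f0 c0 <= c0].
Proof.
move: c0_gam c1_del => /andP[c00 c0g] /andP[c1d c11].
move: (bp_gamc bp) (bp_cdel bp) (bp_del bp) => gc cd d1.
elim: n => [|n [h1 h2 h3]] /=.
  by split; [lra|apply: (bp_f0lt bp); lra|lra].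
split.
- by rewrite -(bp_f00 bp); apply: (bp_f0inc bp); lra.
- by apply: (bp_f0inc bp) => //; [rewrite -(bp_f00 bp); apply: (increasing_onW (bp_f0inc bp)); lra|lra].
- by rewrite /= in h2; lra.
Qed.

Lemma iter_c1 n : [/\ iter n f1 c1 < 1, iter n f1 c1 < iter n.+1 f1 c1 & c1 <= iter n f1 c1].
Proof.
move: c0_gam c1_del => /andP[c00 c0g] /andP[c1d c11].
move: (bp_gam bp) (bp_gamc bp) (bp_cdel bp) => g0 gc cd.
elim: n => [|n [h1 h2 h3]] /=.
  by split; [lra|apply: (bp_f1gt bp); lra|lra].
split.
- by rewrite -(bp_f11 bp); apply: (bp_f1inc bp); lra.
- by apply: (bp_f1inc bp) => //; [lra|rewrite -(bp_f11 bp); apply: (increasing_onW (bp_f1inc bp)); lra].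
- by rewrite /= in h2; lra.
Qed.

Lemma step_c0 n x : iter n.+2 f0 c0 <= x < iter n.+1 f0 c0 ->
  iter n.+1 f0 c0 <= T x < iter n f0 c0.
Proof.
move: c0_gam c1_del => /andP[c00 c0g] /andP[c1d c11].
move: (bp_gamc bp) (bp_cdel bp) (bp_del bp) => gc cd d1.
have [h1 h2 h3] := iter_c0 n; have [h4 h5 h6] := iter_c0 n.+1.
move=> /andP[]; rewrite le_eqVlt => /orP[/eqP<- _|h7 h8].
  by rewrite [iter n.+2 _ _]iterS (inverts_eq (bp_f0inc bp) T_f0)//; lra.
have [h9 h10] : iter n.+1 f0 c0 < T x /\ T x < iter n f0 c0.
  by apply: T_f0 => //; lra.
by lra.
Qed.

Lemma step_c1 n x : iter n.+1 f1 c1 < x <= iter n.+2 f1 c1 ->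
  iter n f1 c1 < T x <= iter n.+1 f1 c1.
Proof.
move: c0_gam c1_del => /andP[c00 c0g] /andP[c1d c11].
move: (bp_gam bp) (bp_gamc bp) (bp_cdel bp) => g0 gc cd.
have [h1 h2 h3] := iter_c1 n; have [h4 h5 h6] := iter_c1 n.+1.
move=> /andP[h7]; rewrite le_eqVlt => /orP[/eqP->|h8].
  by rewrite [iter n.+2 _ _]iterS (inverts_eq (bp_f1inc bp) T_f1)//; lra.
have [h9 h10] : iter n f1 c1 < T x /\ T x < iter n.+1 f1 c1.
  by apply: T_f1 => //; lra.
by lra.
Qed.

Lemma hit_time_left n x : iter n.+1 f0 c0 <= x < iter n f0 c0 ->
  hit_time T Y x = (n.+1%:R)%:E.
Proof.
move: c0_gam c1_del => /andP[c00 c0g] /andP[c1d c11].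
move: (bp_gamc bp) (bp_cdel bp) (bp_del bp) => gc cd d1.
move=> hx.
have orb k : (k <= n)%N -> iter (n - k).+1 f0 c0 <= iter k T x < iter (n - k) f0 c0.
  elim: k => [|k IH] kn; first by rewrite subn0.
  have := IH (ltnW kn); have -> : (n - k = (n - k.+1).+1)%N by rewrite -subSn// subSS.
  by rewrite iterS; exact: step_c0.
apply: hit_time_first => //.
- have := orb n (leqnn n); rewrite subnn iterS /= => /andP[h1 h2].
  rewrite /Y /= in_itv /=.
  have [h3|h3] := eqVneq (iter n T x) (f0 c0).
    by rewrite h3 (inverts_eq (bp_f0inc bp) T_f0); lra.
  have h4 : f0 c0 < iter n T x by rewrite lt_neqAle eq_sym h3.
  have [h5 h6] : c0 < T (iter n T x) /\ T (iter n T x) < del.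
    by apply: T_f0; rewrite ?(bp_f0del bp); lra.
  by lra.
- move=> k k1; rewrite ltnS => kn; rewrite /Y /= in_itv /= => /andP[h1 _].
  by have := orb k kn; have [_ _ h] := iter_c0 (n - k); lra.
Qed.

Lemma hit_time_right n x : iter n f1 c1 < x <= iter n.+1 f1 c1 ->
  hit_time T Y x = (n.+1%:R)%:E.
Proof.
move: c0_gam c1_del => /andP[c00 c0g] /andP[c1d c11].
move: (bp_gam bp) (bp_gamc bp) (bp_cdel bp) => g0 gc cd.
move=> hx.
have orb k : (k <= n)%N -> iter (n - k) f1 c1 < iter k T x <= iter (n - k).+1 f1 c1.
  elim: k => [|k IH] kn; first by rewrite subn0.
  have := IH (ltnW kn); have -> : (n - k = (n - k.+1).+1)%N by rewrite -subSn// subSS.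
  by rewrite iterS; exact: step_c1.
apply: hit_time_first => //.
- have := orb n (leqnn n); rewrite subnn iterS /= => /andP[h1 h2].
  rewrite /Y /= in_itv /=.
  have [h3|h3] := eqVneq (iter n T x) (f1 c1).
    by rewrite h3 (inverts_eq (bp_f1inc bp) T_f1); lra.
  have h4 : iter n T x < f1 c1 by rewrite lt_neqAle h3.
  have [h5 h6] : gam < T (iter n T x) /\ T (iter n T x) < c1.
    by apply: T_f1; rewrite ?(bp_f1gam bp); lra.
  by lra.
- move=> k k1; rewrite ltnS => kn; rewrite /Y /= in_itv /= => /andP[_ h1].
  by have := orb k kn; have [_ _ h] := iter_c1 (n - k); lra.
Qed.

Lemma hit_time_0 n : hit_time T Y 0 <> (n%:R)%:E.
Proof.
move: c0_gam c1_del => /andP[c00 c0g] /andP[c1d c11].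
move=> /hit_time_inv[m [_ + _]].
have -> : iter m T 0 = 0 by elim: m => //= m ->.
by rewrite /Y /= in_itv /=; lra.
Qed.

Lemma hit_time_1 n : hit_time T Y 1 <> (n%:R)%:E.
Proof.
move: c0_gam c1_del => /andP[c00 c0g] /andP[c1d c11].
move=> /hit_time_inv[m [_ + _]].
have -> : iter m T 1 = 1 by elim: m => //= m ->.
by rewrite /Y /= in_itv /=; lra.
Qed.

Lemma level_left x : 0 < x < c0 -> exists n, iter n.+1 f0 c0 <= x < iter n f0 c0.
Proof.
move: c0_gam c1_del => /andP[c00 c0g] /andP[c1d c11].
move: (bp_gamc bp) (bp_cdel bp) (bp_del bp) => gc cd d1 /andP[x0 xc].
have [j hj] := iter_f0_small bp x0.
have exP : exists n, iter n f0 c0 <= x.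
  exists j; apply: le_trans hj.
  by have [] := @contracts_iter _ f0 j c0 gam (bp_f0I bp) (bp_f0inc bp) (bp_f0con bp) ltac:(lra) ltac:(lra) ltac:(lra).
case: (ex_minnP exP) => -[|n] hn Hn; first by rewrite /= in hn; lra.
exists n; rewrite hn /= ltNge; apply/negP => /Hn; by rewrite ltnn.
Qed.

Lemma level_right x : c1 < x < 1 -> exists n, iter n f1 c1 < x <= iter n.+1 f1 c1.
Proof.
move: c0_gam c1_del => /andP[c00 c0g] /andP[c1d c11].
move: (bp_gam bp) (bp_gamc bp) (bp_cdel bp) => g0 gc cd /andP[xc x1].
have [j hj] := iter_f1_close bp x1.
have exP : exists n, x <= iter n f1 c1.
  exists j; apply: (le_trans hj).
  by have [] := @contracts_iter _ f1 j del c1 (bp_f1I bp) (bp_f1inc bp) (bp_f1con bp) ltac:(lra) ltac:(lra) ltac:(lra).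
case: (ex_minnP exP) => -[|n] hn Hn; first by rewrite /= in hn; lra.
exists n; rewrite hn andbT ltNge; apply/negP => /Hn; by rewrite ltnn.
Qed.

(** Each step of T moves [f0^(n+2) c0, f0^(n+1) c0[ onto the previous such interval, and
    from [f0 c0, c0[ it leads into Y: f0 c0 <= x < c0 <= gam = f0 del gives
    c0 <= T x < del <= c1. *)
Lemma Yset_left n : Yset T Y n.+1 `&` `[0, c0[ = `[iter n.+1 f0 c0, iter n f0 c0[%classic.
Proof.
move: c0_gam c1_del => /andP[c00 c0g] /andP[c1d c11].
move: (bp_gam bp) (bp_gamc bp) (bp_cdel bp) (bp_del bp) => g0 gc cd d1.
apply/seteqP; split=> x /=; rewrite !in_itv /=.
  move=> [[_ hx] /andP[]]; rewrite le_eqVlt => /orP[/eqP x0|x0] xc.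
    by exfalso; move: hx; rewrite -x0; exact: hit_time_0.
  have [m hm] := level_left (x := x) ltac:(lra).
  move: hx; rewrite (hit_time_left hm) => -[] /eqP.
  by rewrite eqr_nat eqSS => /eqP <-.
move=> hx; have [h1 _ h2] := iter_c0 n; have [h3 _ _] := iter_c0 n.+1.
split; last by move: hx h1 h2 h3 => /=; lra.
split; last exact: hit_time_left.
rewrite /Y /= !in_itv /=; split; first by move: hx h1 h2 h3 => /=; lra.
by move: hx h1 h2 h3 => /=; lra.
Qed.

Lemma Yset_right n : Yset T Y n.+1 `&` `]c1, 1] = `]iter n f1 c1, iter n.+1 f1 c1]%classic.
Proof.
move: c0_gam c1_del => /andP[c00 c0g] /andP[c1d c11].
move: (bp_gam bp) (bp_gamc bp) (bp_cdel bp) (bp_del bp) => g0 gc cd d1.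
apply/seteqP; split=> x /=; rewrite !in_itv /=.
  move=> [[_ hx] /andP[xc]]; rewrite le_eqVlt => /orP[/eqP x1|x1].
    by exfalso; move: hx; rewrite x1; exact: hit_time_1.
  have [m hm] := level_right (x := x) ltac:(lra).
  move: hx; rewrite (hit_time_right hm) => -[] /eqP.
  by rewrite eqr_nat eqSS => /eqP <-.
move=> hx; have [h1 _ h2] := iter_c1 n; have [h3 _ _] := iter_c1 n.+1.
split; last by move: hx h1 h2 h3 => /=; lra.
split; last exact: hit_time_right.
rewrite /Y /= !in_itv /=; split; first by move: hx h1 h2 h3 => /=; lra.
by move: hx h1 h2 h3 => /=; lra.
Qed.

Variables (h0 : R -> R) (mu : {measure set (measurableTypeR R) -> \bar R}).
Variables (m1 m2 : R).
Hypothesis m1_gt0 : 0 < m1.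
Hypothesis h0_bounds : forall x, 0 <= x <= 1 -> m1 <= h0 x <= m2.
Hypothesis h0_cont : {within `[0, 1], continuous h0}.
Let h := thaler_density f0 f1 h0.
Let leb := @lebesgue_measure R.
Hypothesis muE : forall A : set (measurableTypeR R), measurable A ->
  mu A = (\int[leb]_(x in A `&` `]0%R, 1%R[) (h x)%:E)%E.

Lemma contracts_continuous (f : R -> R) x : increasing_on 0 1 f -> contracts 0 1 1 f ->
  0 < x < 1 -> {for x, continuous f}.
Proof.
move=> If Cf /andP[x0 x1]; apply/cvgrPdist_lt => e e0.
apply/nbhs_ballP; exists (Num.min e (Num.min x (1 - x))) => /=.
  by rewrite !lt_min e0 x0 subr_gt0.
move=> y; rewrite /ball /= !lt_min => /andP[xye /andP[xyx xy1]].
have [y0 y1] : 0 < y /\ y < 1.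
  by move: xyx xy1; rewrite !ltr_norml; lra.
apply: le_lt_trans xye.
have [xy|yx] := leP x y.
- have := increasing_onW If (ltW x0) xy (ltW y1) => h1.
  have := Cf _ _ (ltW x0) xy (ltW y1); rewrite mul1r => h2.
  by rewrite distrC ger0_norm ?subr_ge0// distrC ger0_norm ?subr_ge0.
- have := increasing_onW If (ltW y0) (ltW yx) (ltW x1) => h1.
  have := Cf _ _ (ltW y0) (ltW yx) (ltW x1); rewrite mul1r => h2.
  by rewrite ger0_norm ?subr_ge0// ger0_norm ?subr_ge0// ltW.
Qed.

Lemma gaps_gt0 x : 0 < x < 1 -> 0 < x - f0 x /\ 0 < f1 x - x.
Proof.
move=> x01; have := bp_f0lt bp (x := x) ltac:(lra); have := bp_f1gt bp (x := x) ltac:(lra).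
by lra.
Qed.

Lemma measurable_density : measurable_fun (`]0, 1[%classic : set R) h.
Proof.
apply: open_continuous_measurable_fun; first exact: interval_open.
move=> x; rewrite inE /= in_itv /= => x01.
have [g1 g2] := gaps_gt0 x01.
have cx : {for x, continuous (fun y : R => y)} by exact: cvg_id.
have cf0 := contracts_continuous (bp_f0inc bp) (bp_f0con bp) x01.
have cf1 := contracts_continuous (bp_f1inc bp) (bp_f1con bp) x01.
have ch0 : {for x, continuous h0}.
  have [H _ _] := (continuous_within_itvP h0 (ltr01 : (0 < 1 :> R))).1 h0_cont.
  by apply: H; rewrite in_itv.
rewrite /h /thaler_density; apply: cvgM; first exact: ch0.
apply: cvgM.
  by apply: cvgM; [exact: cvg_id|apply: cvgB; [exact: cvg_cst|exact: cvg_id]].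
apply: cvgV; first by rewrite mulf_neq0// lt0r_neq0.
by apply: cvgM; apply: cvgB => //; exact: cvg_id.
Qed.

Let ratio x := x * (1 - x) / ((x - f0 x) * (f1 x - x)).

Lemma ratio_ge A B x : 0 < x < 1 -> 0 <= A -> 0 <= B ->
  A * (x - f0 x) <= x -> B * (f1 x - x) <= 1 - x -> A * B <= ratio x.
Proof.
move=> x01 A0 B0 hA hB; have [g1 g2] := gaps_gt0 x01.
rewrite /ratio ler_pdivlMr ?mulr_gt0//.
have -> : A * B * ((x - f0 x) * (f1 x - x)) = (A * (x - f0 x)) * (B * (f1 x - x)) by ring.
by apply: ler_pM => //; apply: mulr_ge0 => //; apply: ltW.
Qed.

Lemma ratio_le A B x : 0 < x < 1 ->
  x <= A * (x - f0 x) -> 1 - x <= B * (f1 x - x) -> ratio x <= A * B.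
Proof.
move=> x01 hA hB; have [g1 g2] := gaps_gt0 x01.
rewrite /ratio ler_pdivrMr ?mulr_gt0//.
have -> : A * B * ((x - f0 x) * (f1 x - x)) = (A * (x - f0 x)) * (B * (f1 x - x)) by ring.
by apply: ler_pM => //; lra.
Qed.

Lemma density_ge_of A x : 0 < x < 1 -> 0 <= A -> A <= ratio x -> m1 * A <= h x.
Proof.
move=> x01 A0 Ar; rewrite /h /thaler_density; apply: ler_pM => //.
- exact: ltW.
- by have /andP[] := h0_bounds (x := x) ltac:(lra).
Qed.

Lemma density_le_of A x : 0 < x < 1 -> 0 <= ratio x -> ratio x <= A -> h x <= m2 * A.
Proof.
move=> x01 r0 Ar; rewrite /h /thaler_density; apply: ler_pM => //.
- by have /andP[h1 _] := h0_bounds (x := x) ltac:(lra); apply: le_trans h1; apply: ltW.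
- by have /andP[] := h0_bounds (x := x) ltac:(lra).
Qed.

Lemma density_ge_m1 x : 0 < x < 1 -> m1 <= h x.
Proof.
move=> x01; rewrite -[m1]mulr1; apply: density_ge_of => //.
have /andP[k1 _] := bp_f0I bp (x := x) ltac:(lra).
have /andP[_ k2] := bp_f1I bp (x := x) ltac:(lra).
by rewrite -[1]mulr1; apply: ratio_ge => //; rewrite mul1r; lra.
Qed.

Lemma ratio_ge0 x : 0 < x < 1 -> 0 <= ratio x.
Proof.
by move=> x01; rewrite -(mulr0 0); apply: ratio_ge => //; rewrite mul0r; lra.
Qed.

Lemma mu_ge_leb (E : set R) : measurable E -> E `<=` `]0, 1[ -> (m1%:E * leb E <= mu E)%E.
Proof.
move=> mE E01; apply: (density_ge muE) => //.
- exact: measurable_density.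
- exact: ltW.
- by move=> x /E01 /=; rewrite in_itv; exact: density_ge_m1.
Qed.

Lemma gap0_mono x y : 0 <= x -> x <= y -> y <= 1 -> x - f0 x <= y - f0 y.
Proof. by move=> x0 xy y1; have := bp_f0con bp x0 xy y1; rewrite mul1r; lra. Qed.

Lemma gap1_mono x y : 0 <= x -> x <= y -> y <= 1 -> f1 y - y <= f1 x - x.
Proof. by move=> x0 xy y1; have := bp_f1con bp x0 xy y1; rewrite mul1r; lra. Qed.

Lemma mu_le (E : set R) B : measurable E -> E `<=` `]0, 1[ -> 0 <= B ->
  (forall x, E x -> h x <= B) -> (mu E <= B%:E * leb E)%E.
Proof.
move=> mE E01 B0 HB; apply: (density_le muE) => //; first exact: measurable_density.
by move=> x x01; apply: le_trans (density_ge_m1 x01); exact: ltW.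
Qed.

Lemma mu_ge (E : set R) B : measurable E -> E `<=` `]0, 1[ -> 0 <= B ->
  (forall x, E x -> B <= h x) -> (B%:E * leb E <= mu E)%E.
Proof.
by move=> mE E01 B0 HB; apply: (density_ge muE) => //; exact: measurable_density.
Qed.

Let Cu := m2 * L ^+ 2 / (del - gam).

Lemma Cu_gt0 : 0 < Cu.
Proof.
move: (bp_gamc bp) (bp_cdel bp) => gc cd.
have /andP[k1 k2] := h0_bounds (x := 0) ltac:(lra).
have L0 : 0 < L by apply: lt_le_trans L1.
have m20 : 0 < m2 by apply: lt_le_trans m1_gt0 (le_trans k1 k2).
by rewrite /Cu divr_gt0 ?mulr_gt0 ?exprn_gt0//; lra.
Qed.

Lemma m2_gt0 : 0 < m2.
Proof.
have /andP[k1 k2] := h0_bounds (x := 0) ltac:(lra).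
by apply: lt_le_trans m1_gt0 (le_trans k1 k2).
Qed.

(** On [f0 b, b[ both x and x - f0 x vary by bounded factors only, so the density is
    comparable to b / (b - f0 b).  The length b - f0 b of the interval cancels the
    denominator. *)
Lemma mu_level_left n : ((m1 * iter n.+1 f0 c0)%:E <= mu (Yset T Y n.+1 `&` `[0%R, c0[))%E /\
  (mu (Yset T Y n.+1 `&` `[0%R, c0[) <= (Cu * iter n.+1 f0 c0)%:E)%E.
Proof.
move: c0_gam c1_del => /andP[c00 c0g] /andP[c1d c11].
move: (bp_gamc bp) (bp_cdel bp) (bp_del bp) => gc cd d1.
have L0 : 0 < L by apply: lt_le_trans L1.
have m20 := m2_gt0.
rewrite Yset_left; set b := iter n f0 c0; rewrite [iter n.+1 _ _]iterS -/b.
have [b1 b2 b3] := iter_c0 n; rewrite iterS -/b in b1 b2 b3.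
have [b4 b5 _] := iter_c0 n.+1; rewrite 2!iterS -/b in b4 b5.
have E01 : `[f0 b, b[ `<=` `]0, 1[%classic.
  by move=> x /=; rewrite !in_itv /= => xb; lra.
have lebE : leb `[f0 b, b[ = (b - f0 b)%:E.
  by rewrite /leb lebesgue_measure_itv /= lte_fin b2.
have bb : 0 < b - f0 b by rewrite subr_gt0.
split.
- have -> : ((m1 * f0 b)%:E = (m1 * (f0 b / (b - f0 b) * 1))%:E * leb `[f0 b, b[)%E.
    rewrite lebE -EFinM mulr1; congr EFin; rewrite -mulrA divfK//; exact: lt0r_neq0.
  apply: mu_ge => //.
    by rewrite mulr1 mulr_ge0 ?divr_ge0// ltW.
  move=> x xE; have x01 : 0 < x < 1 by have := E01 x xE; rewrite /= in_itv.
  move: xE; rewrite /= in_itv /= => /andP[xb1 xb2].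
  have A0 : 0 <= f0 b / (b - f0 b) by rewrite divr_ge0// ltW.
  apply: density_ge_of; rewrite ?mulr1//; rewrite -[f0 b / _]mulr1; apply: ratio_ge => //.
    apply: le_trans xb1; rewrite mulrAC ler_pdivrMr//; apply: ler_wpM2l; first exact: ltW.
    by apply: gap0_mono; lra.
  by rewrite mul1r; have := bp_f1I bp (x := x) ltac:(lra); lra.
- have bL : b <= L * f0 b.
    by have := low0 (u := 0) (v := b); rewrite (bp_f00 bp) !subr0; apply; lra.
  apply: (@le_trans _ _ ((m2 * (b * L / (b - f0 b) * (del - gam)^-1))%:E * leb `[f0 b, b[)%E); last first.
    rewrite lebE -EFinM lee_fin.
    have -> : m2 * (b * L / (b - f0 b) * (del - gam)^-1) * (b - f0 b) = (m2 * L / (del - gam)) * b.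
      by field; lra.
    have -> : Cu * f0 b = (m2 * L / (del - gam)) * (L * f0 b) by rewrite /Cu; field; lra.
    by apply: ler_wpM2l => //; rewrite divr_ge0 ?mulr_ge0//; lra.
  apply: mu_le => //.
    by rewrite !mulr_ge0// ?invr_ge0; lra.
  move=> x xE; have x01 : 0 < x < 1 by have := E01 x xE; rewrite /= in_itv.
  move: xE; rewrite /= in_itv /= => /andP[xb1 xb2].
  apply: density_le_of => //; first exact: ratio_ge0.
  apply: ratio_le => //.
    apply: (le_trans (ltW xb2)); rewrite -!mulrA ler_peMr//; first lra.
    rewrite mulrCA ler_pdivlMl// mulr1.
    apply: (le_trans (low0 (u := f0 b) (v := b) _ _ _)); try lra.
    by apply: ler_wpM2l; [lra|apply: gap0_mono; lra].
  have := gap1_mono (x := x) (y := gam); rewrite (bp_f1gam bp) => k.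
  apply: (@le_trans _ _ 1); first lra.
  by rewrite ler_pdivlMl; [rewrite mulr1; apply: k; lra|lra].
Qed.

Lemma mu_level_right n : ((m1 * (1 - iter n.+1 f1 c1))%:E <= mu (Yset T Y n.+1 `&` `]c1, 1%R]))%E /\
  (mu (Yset T Y n.+1 `&` `]c1, 1%R]) <= (Cu * (1 - iter n.+1 f1 c1))%:E)%E.
Proof.
move: c0_gam c1_del => /andP[c00 c0g] /andP[c1d c11].
move: (bp_gam bp) (bp_gamc bp) (bp_cdel bp) => g0 gc cd.
have L0 : 0 < L by apply: lt_le_trans L1.
have m20 := m2_gt0.
rewrite Yset_right; set b := iter n f1 c1; rewrite [iter n.+1 _ _]iterS -/b.
have [b1 b2 b3] := iter_c1 n; rewrite iterS -/b in b1 b2 b3.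
have [b4 b5 _] := iter_c1 n.+1; rewrite 2!iterS -/b in b4 b5.
have E01 : `]b, f1 b] `<=` `]0, 1[%classic.
  by move=> x /=; rewrite !in_itv /= => xb; lra.
have lebE : leb `]b, f1 b] = (f1 b - b)%:E.
  by rewrite /leb lebesgue_measure_itv /= lte_fin b2.
have bb : 0 < f1 b - b by rewrite subr_gt0.
split.
- have -> : ((m1 * (1 - f1 b))%:E = (m1 * (1 * ((1 - f1 b) / (f1 b - b))))%:E * leb `]b, f1 b])%E.
    rewrite lebE -EFinM mul1r; congr EFin; rewrite -mulrA divfK//; exact: lt0r_neq0.
  have A0 : 0 <= (1 - f1 b) / (f1 b - b) by rewrite divr_ge0//; lra.
  apply: mu_ge => //.
    by rewrite mul1r mulr_ge0 // ltW.
  move=> x xE; have x01 : 0 < x < 1 by have := E01 x xE; rewrite /= in_itv.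
  move: xE; rewrite /= in_itv /= => /andP[xb1 xb2].
  apply: density_ge_of; rewrite ?mul1r//; rewrite -[_ / _]mul1r; apply: ratio_ge => //.
    by rewrite mul1r; have := bp_f0I bp (x := x) ltac:(lra); lra.
  apply: (@le_trans _ _ (1 - f1 b)); last lra.
  rewrite mulrAC ler_pdivrMr//; apply: ler_wpM2l; first lra.
  by apply: gap1_mono; lra.
- have bL : 1 - b <= L * (1 - f1 b).
    by have := low1 (u := b) (v := 1); rewrite (bp_f11 bp); apply; lra.
  apply: (@le_trans _ _ ((m2 * ((del - gam)^-1 * ((1 - b) * L / (f1 b - b))))%:E * leb `]b, f1 b])%E); last first.
    rewrite lebE -EFinM lee_fin.
    have -> : m2 * ((del - gam)^-1 * ((1 - b) * L / (f1 b - b))) * (f1 b - b) = (m2 * L / (del - gam)) * (1 - b).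
      by field; lra.
    have -> : Cu * (1 - f1 b) = (m2 * L / (del - gam)) * (L * (1 - f1 b)) by rewrite /Cu; field; lra.
    by apply: ler_wpM2l => //; rewrite divr_ge0 ?mulr_ge0//; lra.
  apply: mu_le => //.
    by rewrite !mulr_ge0// ?invr_ge0; lra.
  move=> x xE; have x01 : 0 < x < 1 by have := E01 x xE; rewrite /= in_itv.
  move: xE; rewrite /= in_itv /= => /andP[xb1 xb2].
  apply: density_le_of => //; first exact: ratio_ge0.
  apply: ratio_le => //.
    have := gap0_mono (x := del) (y := x); rewrite (bp_f0del bp) => k.
    apply: (@le_trans _ _ 1); first lra.
    by rewrite ler_pdivlMl; [rewrite mulr1; apply: k; lra|lra].
  apply: (@le_trans _ _ (1 - b)); first lra.
  rewrite -!mulrA ler_peMr//; first lra.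
  rewrite mulrCA ler_pdivlMl// mulr1.
  apply: (le_trans (low1 (u := b) (v := f1 b) _ _ _)); try lra.
  by apply: ler_wpM2l; [lra|apply: gap1_mono; lra].
Qed.

Lemma mu_Y_finite : exists2 B, 0 <= B & (mu Y <= B%:E)%E.
Proof.
move: c0_gam c1_del => /andP[c00 c0g] /andP[c1d c11].
move: (bp_gamc bp) (bp_cdel bp) => gc cd.
have m20 := m2_gt0.
have [g1 _] := gaps_gt0 (x := c0) ltac:(lra).
have [_ g2] := gaps_gt0 (x := c1) ltac:(lra).
pose A := (c0 - f0 c0)^-1 * (f1 c1 - c1)^-1.
have A0 : 0 <= A by rewrite mulr_ge0// invr_ge0 ltW.
exists (m2 * A * (c1 - c0)).
  by apply: mulr_ge0; [apply: mulr_ge0 => //; exact: ltW|lra].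
have Y01 : Y `<=` `]0, 1[%classic by move=> x; rewrite /Y /= !in_itv /=; lra.
have lebE : leb Y = (c1 - c0)%:E.
  rewrite /leb /Y lebesgue_measure_itv /= lte_fin.
  by rewrite ifT//; lra.
have mA : 0 <= m2 * A by apply: mulr_ge0 => //; exact: ltW.
rewrite EFinM -lebE; apply: (mu_le _ Y01 mA) => [|x Yx]; first exact: measurable_itv.
have x01 : 0 < x < 1 by have := Y01 x Yx; rewrite /= in_itv.
move: Yx; rewrite /Y /= in_itv /= => /andP[xc0 xc1].
apply: density_le_of => //; first exact: ratio_ge0.
apply: ratio_le => //.
- apply: (@le_trans _ _ 1); first lra.
  by rewrite ler_pdivlMl// mulr1; apply: gap0_mono; lra.
- apply: (@le_trans _ _ 1); first lra.
  by rewrite ler_pdivlMl// mulr1; apply: gap1_mono; lra.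
Qed.

Let z k := iter k f0 c0 + (1 - iter k f1 c1).

Lemma mu_Yset_le n : (mu (Yset T Y n.+1) <= (Cu * z n.+1)%:E)%E.
Proof.
move: c0_gam c1_del => /andP[c00 c0g] /andP[c1d c11].
move: (bp_gamc bp) (bp_cdel bp) => gc cd.
have -> : Yset T Y n.+1 = (Yset T Y n.+1 `&` `[0%R, c0[) `|` (Yset T Y n.+1 `&` `]c1, 1%R]).
  rewrite -setIUr; apply/esym/setIidl => x [[/= + +] _].
  rewrite /Y /= !in_itv /= => x01 /negP; rewrite negb_and -!ltNge.
  by move=> /orP[hx|hx]; [left|right]; lra.
rewrite /z mulrDr EFinD.
apply: (le_trans (measureU2 _ _ _)).
- by rewrite Yset_left.
- by rewrite Yset_right.
by apply: leeD; [exact: (mu_level_left n).2|exact: (mu_level_right n).2].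
Qed.

Lemma wander_in_left n :
  ((m1 * \sum_(1 <= k < n.+1) iter k f0 c0)%:E <= wander_in mu T Y `[0%R, c0[ n.+1)%E /\
  (wander_in mu T Y `[0%R, c0[ n.+1 <= (Cu * \sum_(1 <= k < n.+1) iter k f0 c0)%:E)%E.
Proof.
rewrite /wander_in; elim: n => [|n [IH1 IH2]].
  rewrite big_nat1 big_geq// !mulr0 (_ : _ `&` _ = set0) ?measure0//.
  by apply/seteqP; split=> // x [] /=; rewrite /Y /= !in_itv /=; lra.
rewrite [X in (_ <= X)%E /\ (X <= _)%E]big_nat_recr//=.
rewrite [\sum_(1 <= k < n.+2) _]big_nat_recr//= !mulrDr !EFinD.
by split; apply: leeD => //; have [] := mu_level_left n.
Qed.

Lemma wander_in_right n :
  ((m1 * \sum_(1 <= k < n.+1) (1 - iter k f1 c1))%:E <= wander_in mu T Y `]c1, 1%R] n.+1)%E /\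
  (wander_in mu T Y `]c1, 1%R] n.+1 <= (Cu * \sum_(1 <= k < n.+1) (1 - iter k f1 c1))%:E)%E.
Proof.
rewrite /wander_in; elim: n => [|n [IH1 IH2]].
  rewrite big_nat1 big_geq// !mulr0 (_ : _ `&` _ = set0) ?measure0//.
  by apply/seteqP; split=> // x [] /=; rewrite /Y /= !in_itv /=; lra.
rewrite [X in (_ <= X)%E /\ (X <= _)%E]big_nat_recr//=.
rewrite [\sum_(1 <= k < n.+2) _]big_nat_recr//= (mulrDr m1 (\sum_(1 <= k < n.+1) _)) (mulrDr Cu (\sum_(1 <= k < n.+1) _)) !(EFinD (_ * \sum_(1 <= k < n.+1) _)).
by split; apply: leeD => //; have [] := mu_level_right n.
Qed.

Lemma z_props k : 0 <= z k /\ z k.+1 <= z k.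
Proof.
have [h1 h2 h3] := iter_c0 k; have [h4 h5 h6] := iter_c1 k.
by rewrite /z; lra.
Qed.

Lemma Yset_fin n : mu (Yset T Y n) \is a fin_num.
Proof.
rewrite ge0_fin_numE ?measure_ge0//; case: n => [|n].
  by have [B _ /le_lt_trans] := mu_Y_finite; apply; rewrite ltry.
by apply: (le_lt_trans (mu_Yset_le n)); rewrite ltry.
Qed.

Lemma wander_fin n : wander mu T Y n \is a fin_num.
Proof. by rewrite /wander; apply/sum_fin_numP => k _ _; exact: Yset_fin. Qed.

(** The increments of the wandering rate are the measures of the levels, which
    are dominated by the nonincreasing sequence z. *)
Lemma Qfun_le : exists2 C, 0 < C & forall n, (2 <= n)%N ->
  (0 <= Qfun mu T Y (n%:R^-1))%E /\
  (Qfun mu T Y (n%:R^-1) <= (C * (1 + \sum_(1 <= k < n) z k))%:E)%E.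
Proof.
have [B B0 HB] := mu_Y_finite; have Cu0 := Cu_gt0.
exists (B + 4 * Cu); first lra.
move=> n n2; rewrite /Qfun.
have -> : (\sum_(0 <= k <oo) (expR (- (k%:R * n%:R^-1)))%:E * (wander mu T Y k.+1 - wander mu T Y k))%E =
   (\sum_(0 <= k <oo) (expR (- (k%:R * n%:R^-1)))%:E * mu (Yset T Y k))%E.
  apply: eq_eseriesr => k _; congr (_ * _)%E.
  have -> : (wander mu T Y k.+1 = mu (Yset T Y k) + wander mu T Y k)%E.
    by rewrite /wander big_nat_recr//= addeC.
  by rewrite addeK // wander_fin.
have t0 k : (0 <= (expR (- (k%:R * n%:R^-1)))%:E * mu (Yset T Y k))%E.
  by rewrite mule_ge0// lee_fin expR_ge0.
split; first exact: nneseries_ge0.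
apply: lime_le; first exact: is_cvg_nneseries.
near=> K; have K1 : (0 < K)%N by near: K; exists 1%N.
rewrite big_ltn//= mul0r oppr0 expR0 mul1e.
have S0 : 0 <= \sum_(1 <= k < n) z k by apply: sumr_ge0 => k _; have [] := z_props k.
have B' : B * 1 <= B * (1 + \sum_(1 <= k < n) z k) by apply: ler_wpM2l => //; lra.
apply: (@le_trans _ _ (B%:E + (\sum_(1 <= k < K) (expR (- (k%:R * n%:R^-1)) * (Cu * z k))%:E))%E).
  apply: leeD => //; rewrite big_nat [leRHS]big_nat; apply: lee_sum => -[|k]// _.
  rewrite EFinM; apply: lee_wpmul2l; first by rewrite lee_fin expR_ge0.
  exact: mu_Yset_le.
rewrite sumEFin -EFinD lee_fin.
have -> : \sum_(1 <= k < K) expR (- (k%:R * n%:R^-1)) * (Cu * z k) =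
   Cu * \sum_(1 <= k < K) expR (- (k%:R * n%:R^-1)) * z k.
  by rewrite mulr_sumr; apply: eq_bigr => k _; ring.
have := @laplace_sum _ z n K (fun k => (z_props k).1) (fun k => (z_props k).2) n2.
rewrite -(ler_pM2l Cu0); lra.
Unshelve. all: by end_near. Qed.

End Wandering.

(** * Slow variation and wandering rates *)

Section SlowVariation.
Variable R : realType.
Let leb := @lebesgue_measure R.

(** By uniqueness of Lebesgue measure, as both sides agree on intervals. *)
Lemma lebesgue_measure_scale (a : R) (A : set (measurableTypeR R)) : 0 < a -> measurable A ->
  (a%:E * leb [set x | A (a * x)%R] = leb A)%E.
Proof.
move=> a0 mA.
have mf : measurable_fun [set: measurableTypeR R] ( *%R a : measurableTypeR R -> measurableTypeR R).
  exact: mulrl_measurable.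
apply/esym; apply: (@lebesgue_measure_unique R
  (mscale (NngNum (ltW a0)) (pushforward leb ( *%R a : measurableTypeR R -> measurableTypeR R)))) => //.
move=> _ [[u v] _ <-]; rewrite /mscale /= /pushforward /=.
transitivity (a%:E * leb `](u / a)%R, (v / a)%R]%classic)%E; last first.
  congr (_ * leb _)%E.
  by apply/seteqP; split=> x /=; rewrite !in_itv /= ltr_pdivrMr// ler_pdivlMr// (mulrC x).
rewrite /leb !lebesgue_measure_itv /= !lte_fin ltr_pM2r ?invr_gt0//.
case: ifP => _; last by rewrite mule0.
by rewrite -EFinD -EFinM; congr EFin; rewrite mulrBr !(mulrC a) !divfK ?lt0r_neq0.
Qed.

(** Egorov's theorem on [1, 4], applied to the functions x |-> l (x * u n) / l (u n), which
    converge pointwise to 1. *)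
Lemma slowly_varying_near (l : R -> R) (u : nat -> R) (e : R) :
  slowly_varying +oo l -> (forall n, 0 < u n) -> u n @[n --> \oo] --> +oo -> 0 < e ->
  exists B, [/\ measurable B, (leb B < e%:E)%E &
    \forall n \near \oo, forall x, 1 <= x <= 4 -> ~ B x ->
      l (u n) / 2 <= l (x * u n) <= l (u n) * 2].
Proof.
move=> [ml lpos lsv] u0 uoo e0.
pose A : set (measurableTypeR R) := `[1, 4]%classic.
pose f n : measurableTypeR R -> R := fun x => l (x * u n) / l (u n).
have mf n : measurable_fun A (f n).
  apply: measurable_funM; last exact: measurable_cst.
  apply: (@measurable_comp _ _ _ _ _ _ (`]0, +oo[%classic : set R)) => //.
  - by move=> _ [x xA <-]; move: xA; rewrite /A /= !in_itv /= andbT => /andP[x1 _]; rewrite mulr_gt0//; lra.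
  - by apply: measurable_funM => //; exact: measurable_cst.
have Afin : (leb A < +oo)%E by rewrite /leb /A lebesgue_measure_itv /= lte_fin; case: ifP => _; rewrite ?ltry// -EFinB ltry.
have cf x : A x -> f ^~ x @ \oo --> (1 : R).
  rewrite /A /= in_itv /= => /andP[x1 _].
  have := lsv x ltac:(lra); rewrite /asymp_eq => h.
  exact: (cvg_comp _ _ uoo h).
have [B [mB Be Bu]] := @pointwise_almost_uniform _ _ _ leb f (fun=> 1) A e mf (measurable_itv _) Afin cf e0.
exists B; split=> //.
have near1 : \forall n \near \oo, forall y, (A `\` B) y -> `|1 - f n y| < 2^-1.
  apply: (Bu [set g | forall y, (A `\` B) y -> `|1 - g y| < 2^-1]).
  apply/uniform_nbhs; exists [set xy : R * R | ball xy.1 2^-1 xy.2]; split.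
    exact: (@entourage_ball _ R (2^-1)%:pos).
  by move=> g /= h y yA; exact: h.
near=> n => x x14 nBx.
have H : forall y, (A `\` B) y -> `|1 - f n y| < 2^-1 by near: n.
have := H x; rewrite /A /= in_itv /= => /(_ (conj x14 nBx)).
have lu := lpos _ (u0 n).
rewrite /f ltr_norml => /andP[h1 h2].
have e1 : l (x * u n) = l (x * u n) / l (u n) * l (u n) by rewrite divfK// lt0r_neq0.
rewrite e1; set r := _ / _ in h1 h2 *.
have h3 : 2^-1 * l (u n) <= r * l (u n) by rewrite ler_pM2r//; lra.
have h4 : r * l (u n) <= 2 * l (u n) by rewrite ler_pM2r//; lra.
by apply/andP; split; lra.
Unshelve. all: by end_near. Qed.

(** A form of the uniform convergence theorem.  Put th = t n / s n in [1, 2].  If x in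
    [1, 2] is such that neither x is exceptional for the scale t n nor th * x for the
    scale s n, then l (t n) and l (s n) are both within a factor 2 of
    l (x * t n) = l (th * x * s n).  Such x exist because the exceptional sets have
    measure less than 1 / 4 each. *)
Lemma slowly_varying_comparable (l : R -> R) (s t : nat -> R) :
  slowly_varying +oo l -> s n @[n --> \oo] --> +oo -> t n @[n --> \oo] --> +oo ->
  (\forall n \near \oo, s n <= t n <= 2 * s n) ->
  \forall n \near \oo, l (s n) <= 4 * l (t n).
Proof.
move=> sv soo too st.
pose s' n := Num.max 1 (s n); pose t' n := Num.max 1 (t n).
have s'0 n : 0 < s' n by rewrite /s' lt_max ltr01.
have t'0 n : 0 < t' n by rewrite /t' lt_max ltr01.
have s1 : \forall n \near \oo, 1 <= s n by move/cvgryPge : soo; exact.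
have t1 : \forall n \near \oo, 1 <= t n by move/cvgryPge : too; exact.
have es : \forall n \near \oo, s n = s' n.
  by apply: filterS s1 => n h; rewrite /s' max_r.
have et : \forall n \near \oo, t n = t' n.
  by apply: filterS t1 => n h; rewrite /t' max_r.
have s'oo : s' n @[n --> \oo] --> +oo by apply: cvg_trans soo; exact: near_eq_cvg.
have t'oo : t' n @[n --> \oo] --> +oo by apply: cvg_trans too; exact: near_eq_cvg.
have q0 : 0 < 4^-1 :> R by [].
have [B [mB Be HB]] := slowly_varying_near sv s'0 s'oo q0.
have [C [mC Ce HC]] := slowly_varying_near sv t'0 t'oo q0.
near=> n.
have /andP[stn tsn] : s n <= t n <= 2 * s n by near: n.
have ->: s n = s' n by near: n.
have e2 : t n = t' n by near: n.
have e1 : s n = s' n by near: n.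
rewrite e2; rewrite e1 e2 in stn tsn.
have HB' : forall x, 1 <= x <= 4 -> ~ B x ->
      l (s' n) / 2 <= l (x * s' n) <= l (s' n) * 2 by near: n.
have HC' : forall x, 1 <= x <= 4 -> ~ C x ->
      l (t' n) / 2 <= l (x * t' n) <= l (t' n) * 2 by near: n.
pose th := t' n / s' n.
have th1 : 1 <= th by rewrite /th ler_pdivlMr// mul1r.
have th2 : th <= 2 by rewrite /th ler_pdivrMr.
have th0 : 0 < th by lra.
have mthB : measurable [set x | B (th * x)].
  have := @mulrl_measurable R setT th; move=> /(_ measurableT B mB).
  by rewrite setTI.
have [x [x12 nC nB]] : exists x, [/\ 1 <= x <= 2, ~ C x & ~ B (th * x)].
  apply: contrapT => /forallNP H.
  have sub : `[1, 2]%classic `<=` C `|` [set x | B (th * x)].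
    move=> x /=; rewrite in_itv /= => x12.
    have [Cx|nCx] := pselect (C x); first by left.
    have [Bx|nBx] := pselect (B (th * x)); first by right.
    by exfalso; apply: (H x).
  have : (leb `[1%R, 2%R]%classic <= leb C + leb [set x | B (th * x)%R])%E.
    apply: (@le_trans _ _ (leb (C `|` [set x | B (th * x)]))).
      by apply: le_measure => //; rewrite inE //; exact: measurableU.
    exact: measureU2.
  have leB : (leb [set x | B (th * x)%R] <= leb B)%E.
    rewrite -(lebesgue_measure_scale th0 mB) -[leLHS]mul1e.
    by apply: lee_wpmul2r => //; rewrite lee_fin.
  have : (leb C + leb [set x | B (th * x)%R] < (4^-1 + 4^-1)%:E)%E.
    rewrite EFinD; apply: lteD => //; exact: le_lt_trans Be.
  move=> h1 h2; have := le_lt_trans h2 h1.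
  by rewrite /leb lebesgue_measure_itv /= lte_fin ltr1n -EFinB lte_fin; lra.
have /andP[h1 h2] := HC' x ltac:(lra) nC.
have thx : 1 <= th * x <= 4.
  have : 1 * x <= th * x by rewrite ler_pM2r; lra.
  have : th * x <= 2 * x by rewrite ler_pM2r; lra.
  by lra.
have /andP[h3 h4] := HB' _ thx nB.
have e3 : th * x * s' n = x * t' n.
  by rewrite /th mulrAC divfK ?lt0r_neq0// mulrC.
by rewrite e3 in h3; lra.
Unshelve. all: by end_near. Qed.

Lemma powR_unbounded (e y : R) : 0 < e -> exists2 K, (2 <= K)%N & y <= K%:R `^ e.
Proof.
move=> e0; pose y' := Num.max 1 y; pose r := y' `^ e^-1.
exists (Num.truncn r).+2; first by [].
apply: (@le_trans _ _ y'); first by rewrite /y' le_max lexx orbT.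
have y'0 : 0 <= y' by rewrite /y' le_max ler01.
have -> : y' = r `^ e by rewrite /r -powRrM mulVf ?lt0r_neq0// powRr1.
apply: ge0_ler_powR; rewrite ?nnegrE//; first exact: ltW.
  exact: powR_ge0.
by apply: (le_trans (ltW (truncnS_gt r))); rewrite ler_nat.
Qed.

Lemma cvg_to1_near (u : nat -> R) : u n @[n --> \oo] --> (1 : R) ->
  \forall n \near \oo, 2^-1 <= u n <= 2.
Proof.
move=> /cvgrPdist_lt/(_ 2^-1 ltac:(by [])); apply: filterS => n.
by rewrite ltr_norml; lra.
Qed.

Definition regular_scale (alpha : R) (l : R -> R) (n : nat) : R := n%:R `^ (1 - alpha) * l n%:R.

Lemma near_ge (N : nat) : \forall n \near \oo, (N <= n)%N.
Proof. by exists N. Qed.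

Lemma near_mul (P : nat -> Prop) K : (0 < K)%N -> (\forall n \near \oo, P n) ->
  \forall n \near \oo, P (K * n)%N.
Proof.
move=> K0 [N _ HN]; exists N => // n /= Nn; apply: HN => /=.
by rewrite (leq_trans Nn)// leq_pmull.
Qed.

Lemma cvg_natr_infty : n%:R @[n --> \oo] --> (+oo : set_system R).
Proof. exact: cvgr_idn. Qed.

(** The sums X n of x k are comparable to the scale b n by hypothesis.  Monotonicity
    gives n x n <= 2 X n.  Conversely X (K n) - X n <= K n x n, and for large K the left
    side is at least of order b n, since b (K n) is about K^(1-alpha) b n and
    1 - alpha > 0. *)
Lemma wandering_asymptotics (alpha beta m C : R) (l : R -> R) (x : nat -> R) (w : nat -> \bar R) :
  0 < alpha < 1 -> slowly_varying +oo l -> 0 < m -> 0 < C ->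
  (forall k, 0 < x k) -> (forall k, x k.+1 <= x k) ->
  (forall n, ((m * \sum_(1 <= k < n.+1) x k)%:E <= w n.+1)%E /\
             (w n.+1 <= (C * \sum_(1 <= k < n.+1) x k)%:E)%E) ->
  fine (w n) / (beta * n%:R `^ (1 - alpha) * l n%:R) @[n --> \oo] --> (1 : R) ->
  exists2 c, 0 < c & exists2 d, 0 < d & \forall n \near \oo,
    [/\ \sum_(1 <= k < n) x k <= d * regular_scale alpha l n,
       c * regular_scale alpha l n <= n%:R * x n &
       n%:R * x n <= d * regular_scale alpha l n].
Proof.
move=> /andP[a0 a1] sv m0 C0 x0 xd hw hlim.
have [_ lpos lsv] := sv.
pose X n := \sum_(1 <= k < n) x k.
pose b := regular_scale alpha l.
have bpos n : (0 < n)%N -> 0 < b n.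
  by move=> n0; rewrite /b /regular_scale mulr_gt0 ?lpos ?powR_gt0 ?ltr0n.
have xW i j : (i <= j)%N -> x j <= x i.
  move=> /subnKC <-; elim: (j - i)%N => [|k IH]; first by rewrite addn0.
  by rewrite addnS (le_trans (xd _)).
have Xpos n : (2 <= n)%N -> 0 < X n.
  move=> n2; rewrite /X big_ltn//.
  by rewrite (lt_le_trans (x0 1%N))// lerDl sumr_ge0// => k _; exact: ltW.
have fw n : (1 <= n)%N -> m * X n <= fine (w n) <= C * X n.
  case: n => // n _; have [h1 h2] := hw n.
  have wfin : w n.+1 \is a fin_num.
    by rewrite fin_numElt (lt_le_trans (ltNyr _) h1) (le_lt_trans h2 (ltry _)).
  by rewrite -!lee_fin fineK// h1.
have hl := cvg_to1_near hlim.
have beta0 : 0 < beta.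
  have [n [n2 /andP[h1 _]]] : exists n, (2 <= n)%N /\
      (2^-1 <= fine (w n) / (beta * n%:R `^ (1 - alpha) * l n%:R) <= 2).
    have [n [h1 h2]] := @filter_ex _ _ _ _ (filterI (near_ge 2) hl).
    by exists n.
  have /andP[h3 _] := fw n (ltnW n2).
  have h4 : 0 < fine (w n) by apply: lt_le_trans h3; rewrite mulr_gt0// Xpos.
  have bn := bpos n (ltnW n2).
  rewrite -mulrA -/(regular_scale alpha l n) -/b in h1.
  have : 0 < fine (w n) / (beta * b n) by apply: lt_le_trans h1.
  by rewrite pmulr_rgt0// invr_gt0 pmulr_lgt0.
pose c1 := beta / (2 * C); pose d1 := 2 * beta / m.
have c10 : 0 < c1 by rewrite /c1 divr_gt0// mulr_gt0.
have d10 : 0 < d1 by rewrite /d1 divr_gt0// mulr_gt0.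
have XB : \forall n \near \oo, c1 * b n <= X n <= d1 * b n.
  apply: filterS2 (near_ge 2) hl => n n2 /andP[h1 h2].
  have bn := bpos n (ltnW n2); have bb : 0 < beta * b n by rewrite mulr_gt0.
  have /andP[h3 h4] := fw n (ltnW n2).
  rewrite -mulrA -/(regular_scale alpha l n) -/b in h1 h2.
  move: h1 h2; rewrite ler_pdivlMr// ler_pdivrMr// => h1 h2.
  rewrite /c1 /d1; apply/andP; split.
    by rewrite mulrAC ler_pdivrMr ?mulr_gt0//; lra.
  by rewrite mulrAC ler_pdivlMr//; lra.
(* K^(1-alpha) / 2 * c1 >= 2 * d1 leaves at least d1 * b n for X (K n) - X n. *)
have [K K2 HK] := powR_unbounded (4 * d1 / c1) (e := 1 - alpha) ltac:(lra).
have K0 : (0 < K)%N by apply: leq_trans K2.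
have K0' : 0 < K%:R :> R by rewrite ltr0n.
have lK : \forall n \near \oo, l n%:R / 2 <= l (K * n)%N%:R.
  have h := cvg_comp _ _ cvg_natr_infty (lsv K%:R K0').
  apply: filterS2 (near_ge 1) (cvg_to1_near h) => n n1 /=.
  by rewrite ler_pdivlMr ?lpos ?ltr0n// natrM; lra.
exists (d1 / K%:R); first by rewrite divr_gt0.
exists (2 * d1); first by rewrite mulr_gt0.
near=> n.
have n2 : (2 <= n)%N by near: n; exact: near_ge.
have n0 : 0 < n%:R :> R by rewrite ltr0n; apply: leq_trans n2.
have /andP[h1 h2] : c1 * b n <= X n <= d1 * b n by near: n.
have /andP[h3 h4] : c1 * b (K * n)%N <= X (K * n)%N <= d1 * b (K * n)%N.
  by near: n; apply: (near_mul (P := fun n => c1 * b n <= X n <= d1 * b n)).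
have h5 : l n%:R / 2 <= l (K * n)%N%:R by near: n.
have bn := bpos n (ltnW n2).
have h6 : (n.-1)%:R * x n <= X n.
  have -> : (n.-1)%:R * x n = \sum_(1 <= k < n) x n.
    by rewrite big_const_nat iter_addr addr0 subn1 mulr_natl.
  by rewrite /X big_nat [leRHS]big_nat; apply: ler_sum => k /andP[_ kn]; exact/xW/ltnW.
have h7 : n%:R <= 2 * (n.-1)%:R :> R.
  by rewrite -natrM ler_nat -{1}(ltn_predK n2) mul2n -addnn -addn1 leq_add2l -ltnS (ltn_predK n2).
have h8 : n%:R * x n <= 2 * (n.-1)%:R * x n by rewrite ler_pM2r.
have h9 : X (K * n)%N <= X n + K%:R * (n%:R * x n).
  rewrite /X (@big_cat_nat _ _ _ n)//=; [|exact: ltnW|exact: leq_pmull].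
  rewrite lerD2l; apply: (@le_trans _ _ (\sum_(n <= k < K * n) x n)).
    by rewrite big_nat [leRHS]big_nat; apply: ler_sum => k /andP[kn _]; exact: xW.
  rewrite big_const_nat iter_addr addr0 -[leLHS]mulr_natl mulrA -natrM ler_pM2r//.
  by rewrite ler_nat leq_subr.
have h10 : K%:R `^ (1 - alpha) / 2 * b n <= b (K * n)%N.
  rewrite /b /regular_scale natrM powRM ?ler0n// -natrM.
  have -> : K%:R `^ (1 - alpha) / 2 * (n%:R `^ (1 - alpha) * l n%:R) =
    K%:R `^ (1 - alpha) * n%:R `^ (1 - alpha) * (l n%:R / 2) by ring.
  by apply: ler_wpM2l => //; rewrite mulr_ge0// powR_ge0.
have h11 : 4 * d1 <= K%:R `^ (1 - alpha) * c1 by rewrite -ler_pdivrMr.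
have h12 : 4 * d1 * b n <= K%:R `^ (1 - alpha) * c1 * b n by rewrite ler_pM2r.
have h13 : c1 * (K%:R `^ (1 - alpha) / 2 * b n) <= c1 * b (K * n)%N by rewrite ler_pM2l.
have h14 : d1 / K%:R * b n <= n%:R * x n.
  have -> : d1 / K%:R * b n = d1 * b n / K%:R by rewrite mulrAC.
  by rewrite ler_pdivrMr//; lra.
have h15 : X n <= 2 * d1 * b n by have := mulr_gt0 d10 bn; lra.
have h16 : n%:R * x n <= 2 * d1 * b n by lra.
by split.
Unshelve. all: by end_near. Qed.

End SlowVariation.

(** * Lower bounds for the measure with density G *)

Section Density.
Variable R : realType.
Variable mu : {measure set (measurableTypeR R) -> \bar R}.
Variable G : R -> R.

Import HBNNSimple.

(** A supremum over simple functions below grows with the set.  The sets are arbitrary, so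
    that this applies directly to the events of the theorem. *)
Lemma ge0_integral_subset (A B : set R) (f : measurableTypeR R -> \bar R) :
  (forall x, 0 <= f x)%E -> A `<=` B ->
  (\int[mu]_(x in A) f x <= \int[mu]_(x in B) f x)%E.
Proof.
move=> f0 AB; rewrite !ge0_integralE//.
apply: ereal_sup_le => _ [h hf <-]; exists h => // x; apply: (le_trans (hf x)).
rewrite /patch; case: ifPn => [/set_mem/AB/mem_set-> //|_].
by case: ifPn.
Qed.

Lemma mu_density_ge (U E : set R) (d : R) : L1_nonneg mu G -> measurable U ->
  U `<=` `[0, 1] `&` E -> 0 <= d -> {ae mu, forall x, U x -> d <= G x} ->
  (d%:E * mu U <= mu_density mu G E)%E.
Proof.
move=> [iG G0] mU UE d0 dG; rewrite /mu_density.
have m01 : measurable (`[0, 1]%classic : set (measurableTypeR R)) by exact: measurable_itv.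
have mG : measurable_fun (`[0, 1]%classic : set (measurableTypeR R)) (EFin \o G).
  exact: measurable_int iG.
have U01 : U `<=` `[0, 1] by move=> x /UE[].
have mGU : measurable_fun U (EFin \o G) by apply: measurable_funS mG.
rewrite integralE; set D := `[0%R, 1%R] `&` E.
have -> : (\int[mu]_(x in D) (EFin \o G)^\- x = 0)%E.
  apply/eqP; rewrite eq_le; apply/andP; split; last exact: integral_ge0.
  have <- : (\int[mu]_(x in `[0%R, 1%R]) (EFin \o G)^\- x = 0)%E.
    rewrite (@ae_eq_integral _ _ _ mu `[0%R, 1%R]%classic (cst 0))//; first exact: integral0.
      exact: measurable_funeneg.
    have [N [mN N0 sub]] := G0; exists N; split=> // x /= nx; apply: sub => /= Gx.
    apply: nx => x01; rewrite funenegE /=.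
    by apply/max_idPr; rewrite lee_fin oppr_le0 Gx//; move: x01; rewrite in_itv.
  by apply: ge0_integral_subset => // x [].
rewrite sube0.
apply: (@le_trans _ _ (\int[mu]_(x in U) (EFin \o G)^\+ x)%E); last first.
  exact: ge0_integral_subset.
have -> : (d%:E * mu U = \int[mu]_(x in U) (cst d%:E) x)%E by rewrite integral_cst.
apply: ae_ge0_le_integral => //; first exact: measurable_funepos.
have [N [mN N0 sub]] := dG; exists N; split=> // x /= nx; apply: sub => /= Gx.
by apply: nx => Ux; rewrite funeposE le_max lee_fin Gx.
Qed.

End Density.

Section Riemann.
Variable R : realType.

(** Otherwise every interval of a fine partition would contain a tag with value below
    I / 4, and the resulting Riemann sum would be too far from I.  The interval is then
    shrunk to lie inside ]0, 1[. *)
Lemma riemann_lower_interval (g : R -> R) (I : R) : is_riemann_integral 0 1 g I -> 0 < I ->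
  exists u v d, [/\ 0 < u, u < v, v < 1, 0 < d & forall x, u <= x <= v -> d <= g x].
Proof.
move=> gI I0; have I20 : 0 < I / 2 by rewrite divr_gt0.
have [d d0 H] := gI (I / 2) I20.
pose N := (Num.truncn d^-1).+1.
have N0 : 0 < N%:R :> R by [].
have Nd : N%:R^-1 < d.
  by rewrite -[d]invrK ltf_pV2 ?posrE ?invr_gt0// truncnS_gt.
pose pt i : R := i%:R / N%:R.
have [i [iN Hi]] : exists i, (i < N)%N /\ forall x, pt i <= x <= pt i.+1 -> I / 4 <= g x.
  apply: contrapT => /forallNP nH.
  have tag i : exists x, (i < N)%N -> pt i <= x <= pt i.+1 /\ g x < I / 4.
    have [iN|] := boolP (i < N)%N; last by exists 0.
    have /not_andP[//|/existsNP[x /not_implyP[x1 x2]]] := nH i.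
    by exists x => _; split=> //; rewrite ltNge; apply/negP.
  pose xi i := projT1 (cid (tag i)).
  have xiP i : (i < N)%N -> pt i <= xi i <= pt i.+1 /\ g (xi i) < I / 4.
    exact: (projT2 (cid (tag i))).
  pose s := [seq pt i | i <- iota 1 N].
  have ss : size s = N by rewrite size_map size_iota.
  have nths i : (i <= N)%N -> nth 1 (0 :: s) i = pt i.
    case: i => [|i] iN /=; first by rewrite /pt mul0r.
    by rewrite (nth_map 0%N) ?size_iota// nth_iota.
  have ps : itv_partition 0 1 s.
    split; last first.
      rewrite (last_nth 1) ss nths// /pt divff// lt0r_neq0//.
    apply/(pathP 1) => i; rewrite ss => iN.
    rewrite -[nth 1 s i]/(nth 1 (0 :: s) i.+1) !nths//; last exact: ltnW.
    by rewrite /pt ltr_pM2r ?invr_gt0// ltr_nat.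
  have := H s xi ps; rewrite ss; apply/not_implyP; split.
    move=> i iN; rewrite !nths//; last exact: ltnW.
    split; last exact: (xiP i iN).1.
    by rewrite /pt -mulrBl -natrB// subSnn mul1r.
  apply/negP; rewrite -leNgt distrC; apply: le_trans (ler_norm _).
  have : \sum_(0 <= i < N) g (xi i) * (nth 1 (0 :: s) i.+1 - nth 1 (0 :: s) i) <=
     \sum_(0 <= i < N) I / 4 * N%:R^-1.
    rewrite big_nat [leRHS]big_nat; apply: ler_sum => i /andP[_ iN].
    rewrite !nths//; last exact: ltnW.
    rewrite /pt -mulrBl -natrB// subSnn mul1r ler_pM2r ?invr_gt0//.
    exact/ltW/(xiP i iN).2.
  rewrite big_const_nat subn0 iter_addr addr0 -[X in _ <= X -> _]mulr_natr.
  by rewrite divfK ?lt0r_neq0//; lra.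
have [p0 p1] : 0 <= pt i /\ pt i.+1 <= 1.
  split; first by rewrite /pt divr_ge0.
  by rewrite /pt ler_pdivrMr// mul1r ler_nat.
have pp : pt i < pt i.+1 by rewrite /pt ltr_pM2r ?invr_gt0// ltr_nat.
exists ((3 * pt i + pt i.+1) / 4), ((pt i + 3 * pt i.+1) / 4), (I / 4); split; try lra.
by move=> x hx; apply: Hi; lra.
Qed.

End Riemann.

(** * Mass and dynamics of unions of cylinders *)

Section Cylinders.
Variable R : realType.
Variables f0 f1 : R -> R.
Variables M theta cc gam del : R.
Hypothesis bp : branch_pair f0 f1 M theta cc gam del.
Variables (c0 c1 L : R).
Hypothesis c0_gam : 0 < c0 <= gam.
Hypothesis c1_del : del <= c1 < 1.
Hypothesis L1 : 1 <= L.
Hypothesis low0 : forall u v, 0 <= u -> u <= v -> v <= 1 -> v - u <= L * (f0 v - f0 u).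
Hypothesis low1 : forall u v, 0 <= u -> u <= v -> v <= 1 -> v - u <= L * (f1 v - f1 u).

Let x n := iter n f0 c0.
Let y n := 1 - iter n f1 c1.

Definition words_upto (n s : nat) : seq (seq letter) :=
  flatten [seq words n r | r <- iota 0 s.+1].

(** All the words of time at most m: the number of letters and their indices are then
    at most m. *)
Definition early_words (m : nat) : seq (seq letter) :=
  [seq w <- words_upto m m | (word_time w <= m)%N].

Lemma words_uptoS n s : words_upto n s.+1 = words_upto n s ++ words n s.+1.
Proof. by rewrite /words_upto -addn1 iotaD map_cat flatten_cat /= cats0. Qed.

Lemma mem_words_upto n s w : w \in words_upto n s ->
  (size w <= s)%N /\ all (fun l : letter => (l.2 < n)%N) w.
Proof.
move=> /flatten_mapP[r]; rewrite mem_iota add0n => /andP[_ rs] /mem_words[sw aw].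
by rewrite sw -ltnS.
Qed.

Lemma words_upto_uniq n s : uniq (words_upto n s).
Proof.
elim: s => [|s IH]; first by [].
rewrite words_uptoS cat_uniq IH words_uniq andbT; apply/hasPn => w /mem_words[sw _].
by apply/negP => /mem_words_upto[]; rewrite sw ltnn.
Qed.

Lemma sum_words_upto n s (P : pred (seq letter)) (F : seq letter -> R) :
  \sum_(w <- words_upto n s | P w) F w =
  \sum_(0 <= r < s.+1) \sum_(w <- words n r | P w) F w.
Proof. by rewrite /words_upto big_flatten big_map /index_iota subn0. Qed.

(** Since f0^j gam <= c0 for some j, the two sequences interlace up to a shift by j, and a
    shift costs a factor at most L^j as the slopes are bounded below. *)
Lemma iter_f0_comparable : exists2 C, 0 < C & forall n, iter n f0 gam <= C * x n.
Proof.
move: c0_gam (bp_gamc bp) (bp_cdel bp) (bp_del bp) => /andP[c00 c0g] gc cd d1.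
have [j hj] := iter_f0_small bp c00.
have L0 : 0 < L by apply: lt_le_trans L1.
exists (L ^+ j); first exact: exprn_gt0.
have shift n : iter (n + j) f0 gam <= x n.
  rewrite iterD /x; have h0 : 0 < iter j f0 gam.
    by have [h1 /andP[h2 _]] := iter_f0_anti bp j; lra.
  by have [] := @contracts_iter _ f0 n (iter j f0 gam) c0 (bp_f0I bp) (bp_f0inc bp) (bp_f0con bp) (ltW h0) hj ltac:(lra).
move=> n; apply: (@le_trans _ _ (L ^+ j * iter (n + j) f0 gam)); last first.
  by apply: ler_wpM2l; [exact/ltW/exprn_gt0|exact: shift].
elim: j {hj shift} => [|j IH]; first by rewrite addn0 expr0 mul1r.
apply: (le_trans IH); rewrite exprSr -mulrA; apply: ler_wpM2l; first exact/ltW/exprn_gt0.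
rewrite addnS /=; have [h1 /andP[h2 h3]] := iter_f0_anti bp (n + j).
by have := low0 (u := 0) (v := iter (n + j) f0 gam); rewrite (bp_f00 bp) !subr0; apply; lra.
Qed.

Lemma iter_f1_comparable : exists2 C, 0 < C & forall n, 1 - iter n f1 del <= C * y n.
Proof.
move: c1_del (bp_gam bp) (bp_gamc bp) (bp_cdel bp) => /andP[c1d c11] g0 gc cd.
have [j hj] := iter_f1_close bp c11.
have L0 : 0 < L by apply: lt_le_trans L1.
exists (L ^+ j); first exact: exprn_gt0.
have shift n : 1 - iter (n + j) f1 del <= y n.
  rewrite iterD /y lerD2l lerN2; have h0 : iter j f1 del < 1.
    by have [h1 /andP[_ h2]] := iter_f1_mono bp j; lra.
  by have [] := @contracts_iter _ f1 n c1 (iter j f1 del) (bp_f1I bp) (bp_f1inc bp) (bp_f1con bp) ltac:(lra) hj (ltW h0).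
move=> n; apply: (@le_trans _ _ (L ^+ j * (1 - iter (n + j) f1 del))); last first.
  by apply: ler_wpM2l; [exact/ltW/exprn_gt0|exact: shift].
elim: j {hj shift} => [|j IH]; first by rewrite addn0 expr0 mul1r.
apply: (le_trans IH); rewrite exprSr -mulrA; apply: ler_wpM2l; first exact/ltW/exprn_gt0.
rewrite addnS /=; have [h1 /andP[h2 h3]] := iter_f1_mono bp (n + j).
by have := low1 (u := iter (n + j) f1 del) (v := 1); rewrite (bp_f11 bp); apply; lra.
Qed.

Lemma core_length : exists2 C, 0 < C & forall n,
  core_right f0 f1 gam n - core_left f0 f1 del n <= C * (x n + y n).
Proof.
move: (bp_gam bp) (bp_gamc bp) (bp_cdel bp) (bp_del bp) => g0 gc cd d1.
have [C0 C00 H0] := iter_f0_comparable; have [C1 C10 H1] := iter_f1_comparable.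
exists (C0 + C1); first exact: addr_gt0.
move=> n; have [h1 /andP[h2 h3]] := iter_f0_anti bp n.
have [h4 /andP[h5 h6]] := iter_f1_mono bp n.
have k1 : core_right f0 f1 gam n - cc <= iter n f0 gam.
  have := bp_f1con bp (a := 0) (b := iter n f0 gam) (lexx 0) ltac:(lra) ltac:(lra).
  by rewrite (bp_f10 bp) mul1r subr0.
have k2 : cc - core_left f0 f1 del n <= 1 - iter n f1 del.
  have := bp_f0con bp (a := iter n f1 del) (b := 1) ltac:(lra) ltac:(lra) (lexx 1).
  by rewrite (bp_f01 bp) mul1r.
have x0 : 0 <= x n by rewrite /x; have [h _ _] := iter_c0 bp c0_gam c1_del n; exact: ltW.
have y0 : 0 <= y n by rewrite /y; have [h _ _] := iter_c1 bp c0_gam c1_del n; lra.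
have := H0 n; have := H1 n.
have := mulr_ge0 (ltW C00) y0; have := mulr_ge0 (ltW C10) x0; lra.
Qed.

Lemma entrance_right n : [/\ core_left f0 f1 del n <= cc, cc <= f1 (x n),
  f1 (x n) <= core_right f0 f1 gam n & x n <= L * (f1 (x n) - cc)].
Proof.
move: c0_gam (bp_gam bp) (bp_gamc bp) (bp_cdel bp) (bp_del bp) => /andP[c00 c0g] g0 gc cd d1.
have [h1 _ h2] := iter_c0 bp c0_gam c1_del n.
have [k1 k2 k3 k4] := @contracts_iter _ f0 n c0 gam (bp_f0I bp) (bp_f0inc bp) (bp_f0con bp) (ltW c00) c0g ltac:(lra).
have := core_leftW bp n => /andP[_ cl].
split; first exact: ltW.
- by rewrite -(bp_f10 bp); apply: (increasing_onW (bp_f1inc bp)); rewrite /x; lra.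
- by rewrite /core_right; apply: (increasing_onW (bp_f1inc bp)); rewrite /x; lra.
- by have := low1 (u := 0) (v := x n); rewrite (bp_f10 bp) !subr0; apply; rewrite /x; lra.
Qed.

Lemma entrance_left n : [/\ core_left f0 f1 del n <= f0 (iter n f1 c1), f0 (iter n f1 c1) <= cc,
  cc <= core_right f0 f1 gam n & y n <= L * (cc - f0 (iter n f1 c1))].
Proof.
move: c1_del (bp_gam bp) (bp_gamc bp) (bp_cdel bp) (bp_del bp) => /andP[c1d c11] g0 gc cd d1.
have [h1 _ h2] := iter_c1 bp c0_gam c1_del n.
have [k1 k2 k3 k4] := @contracts_iter _ f1 n del c1 (bp_f1I bp) (bp_f1inc bp) (bp_f1con bp) ltac:(lra) c1d (ltW c11).
have := core_rightW bp n => /andP[cr _].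
split; last 2 first.
- exact: ltW.
- by have := low0 (u := iter n f1 c1) (v := 1); rewrite (bp_f01 bp); apply; lra.
- by rewrite /core_left; apply: (increasing_onW (bp_f0inc bp)); lra.
- by rewrite -(bp_f01 bp); apply: (increasing_onW (bp_f0inc bp)); lra.
Qed.

Variables (K : R) (G : R -> R).
Hypothesis K_large : M * expR M / (del - gam) + M <= (1 - theta) * K.
Hypothesis K_ge0 : 0 <= K.
Hypothesis nG : nice gam del K G.

Variable b : nat -> R.
Variables c d : R.
Hypothesis c_gt0 : 0 < c.
Hypothesis d_gt0 : 0 < d.
Hypothesis b_gt0 : forall n, (0 < n)%N -> 0 < b n.
Hypothesis x_asymp : \forall n \near \oo,
  [/\ \sum_(1 <= k < n) x k <= d * b n, c * b n <= n%:R * x n & n%:R * x n <= d * b n].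
Hypothesis y_asymp : \forall n \near \oo,
  [/\ \sum_(1 <= k < n) y k <= d * b n, c * b n <= n%:R * y n & n%:R * y n <= d * b n].

Lemma gapG_gt0 : 0 < gap G gam del.
Proof.
move: (bp_gamc bp) (bp_cdel bp) => gc cd.
by case: nG => IG _; rewrite subr_gt0; apply: IG; lra.
Qed.

(** The terms of index 0 and the additive constant are absorbed in the factor B, the
    sum of the z k being at least z 1. *)
Lemma sum_core_length : exists2 C, 0 < C & \forall m \near \oo,
  \sum_(0 <= j < m.+1) (core_right f0 f1 gam j.-1 - core_left f0 f1 del j.-1) <= C * b m.
Proof.
have [C C0 HC] := core_length.
have xpos k : 0 < x k by have [h _ _] := iter_c0 bp c0_gam c1_del k.
have ypos k : 0 < y k by rewrite /y; have [h _ _] := iter_c1 bp c0_gam c1_del k; lra.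
(* The index 0 occurs twice because of the truncated predecessor. *)
pose z k := x k + y k.
have zpos k : 0 < z k by rewrite addr_gt0.
pose B := 2 * z 0%N / z 1%N + 1.
have B0 : 0 < B by rewrite /B addr_gt0// divr_gt0// mulr_gt0.
exists (C * (B * (2 * d))); first by rewrite !mulr_gt0.
near=> m.
have m2 : (2 <= m)%N by near: m; exact: near_ge.
have [X1 _ _] : [/\ \sum_(1 <= k < m) x k <= d * b m, c * b m <= m%:R * x m & m%:R * x m <= d * b m] by near: m.
have [Y1 _ _] : [/\ \sum_(1 <= k < m) y k <= d * b m, c * b m <= m%:R * y m & m%:R * y m <= d * b m] by near: m.
apply: (@le_trans _ _ (C * \sum_(0 <= j < m.+1) z j.-1)).
  by rewrite mulr_sumr; apply: ler_sum => j _; exact: HC.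
rewrite -mulrA; apply: ler_wpM2l; first exact: ltW.
have -> : \sum_(0 <= j < m.+1) z j.-1 = 2 * z 0%N + \sum_(1 <= k < m) z k.
  rewrite big_nat_recl//= (big_ltn (ltnW m2)) addrA; congr +%R; ring.
have Z1 : z 1%N <= \sum_(1 <= k < m) z k.
  by rewrite big_ltn// lerDl sumr_ge0// => k _; exact: ltW.
have Z2 : \sum_(1 <= k < m) z k <= 2 * d * b m by rewrite big_split /=; lra.
have h1 : 2 * z 0%N <= 2 * z 0%N / z 1%N * \sum_(1 <= k < m) z k.
  by rewrite mulrAC ler_pdivlMr// ler_pM2l// mulr_gt0.
have h2 : B * \sum_(1 <= k < m) z k <= B * (2 * d * b m) by apply: ler_wpM2l => //; exact: ltW.
by rewrite -mulrA; move: h2; rewrite /B mulrDl mul1r -[2 * d * b m]mulrA; lra.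
Unshelve. all: by end_near. Qed.

(** [renewal_bound] divided by the sum of the core lengths, which is at most of order
    b m. *)
Lemma early_mass : exists2 C, 0 < C & \forall m \near \oo,
  C * (m%:R / b m) <= \sum_(w <- early_words m) gap (word_map f0 f1 G w) gam del.
Proof.
move: (bp_gamc bp) (bp_cdel bp) => gc cd.
have [C C0 HC] := sum_core_length; have q0 := gapG_gt0.
have e0 := expR_gt0 K.
have dg : 0 < del - gam by lra.
exists ((del - gam) * gap G gam del / (expR K * C)); first by rewrite divr_gt0 ?mulr_gt0.
near=> m.
have m1 : (1 <= m)%N by near: m; exact: near_ge.
have hC : \sum_(0 <= j < m.+1) (core_right f0 f1 gam j.-1 - core_left f0 f1 del j.-1) <= C * b m.
  by near: m.
have bm := b_gt0 m1.
have := renewal_bound bp m K_large K_ge0 nG.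
rewrite /early_words big_filter sum_words_upto.
set S := \sum_(0 <= r < m.+1) _.
set t := \sum_(0 <= j < m.+1) _ in hC * => h.
have S0 : 0 <= S.
  apply: sumr_ge0 => r _; apply: sumr_ge0 => w _.
  by apply: (gap_ge0 (nice_word bp w K_large K_ge0 nG)); lra.
have h1 : expR K * S * t <= expR K * S * (C * b m) by apply: ler_wpM2l => //; rewrite mulr_ge0// ltW.
have h2 : m%:R * (del - gam) * gap G gam del <= m.+1%:R * (del - gam) * gap G gam del.
  by rewrite -!mulrA ler_pM2r ?mulr_gt0// ler_nat.
have -> : (del - gam) * gap G gam del / (expR K * C) * (m%:R / b m) =
  (m%:R * (del - gam) * gap G gam del) / (expR K * C * b m).
  by field; rewrite !lt0r_neq0.
rewrite ler_pdivrMr ?mulr_gt0//.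
have -> : S * (expR K * C * b m) = expR K * S * (C * b m) by ring.
by lra.
Unshelve. all: by end_near. Qed.

Let leb := @lebesgue_measure R.

Lemma early_letters m n w : (m <= n)%N -> w \in early_words m ->
  all (fun l : letter => (l.2 < n)%N) w.
Proof.
move=> mn; rewrite mem_filter => /andP[_ /mem_words_upto[_]]; apply: sub_all => l lm.
exact: leq_trans mn.
Qed.

(** In every cylinder of an early word, the entrance into an excursion of length n takes
    up a proportion of order x n, respectively y n, hence of order b n / n. *)
Lemma early_measure : exists2 C, 0 < C & \forall m \near \oo, forall n, (m <= n)%N ->
  ((C * (m%:R / b m * (b n / n%:R)))%:E <= leb (word_union f0 f1 G (early_words m) cc (f1 (x n))))%E /\
  ((C * (m%:R / b m * (b n / n%:R)))%:E <= leb (word_union f0 f1 G (early_words m) (f0 (iter n f1 c1)) cc))%E.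
Proof.
move: (bp_gamc bp) (bp_cdel bp) => gc cd.
have [C1 C10 HC1] := early_mass.
have [N1 _ HN1] := x_asymp; have [N2 _ HN2] := y_asymp.
have e0 := expR_gt0 K.
have dg : 0 < del - gam by lra.
have L0 : 0 < L by apply: lt_le_trans L1.
pose D := expR K * (del - gam).
have D0 : 0 < D by rewrite mulr_gt0.
exists (C1 * c / (L * D)); first by rewrite divr_gt0 ?mulr_gt0.
near=> m; move=> n mn.
have m1 : (1 <= m)%N by near: m; exact: near_ge.
have mass : C1 * (m%:R / b m) <= \sum_(w <- early_words m) gap (word_map f0 f1 G w) gam del.
  by near: m.
have N1m : (N1 <= m)%N by near: m; exact: near_ge.
have N2m : (N2 <= m)%N by near: m; exact: near_ge.
have [_ xn _] := HN1 n (leq_trans N1m mn).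
have [_ yn _] := HN2 n (leq_trans N2m mn).
have n1 : (0 < n)%N := leq_trans m1 mn.
have n0 : 0 < n%:R :> R by rewrite ltr0n.
have bm := b_gt0 m1; have bn := b_gt0 n1.
have uniq_early : uniq (early_words m) by rewrite filter_uniq// words_upto_uniq.
have lower (S len z : R) : C1 * (m%:R / b m) <= S -> c * b n <= n%:R * z -> z <= L * len ->
    C1 * c / (L * D) * (m%:R / b m * (b n / n%:R)) <= S * (len / D).
  move=> hS hz hlen.
  have -> : C1 * c / (L * D) * (m%:R / b m * (b n / n%:R)) =
      (C1 * (m%:R / b m)) * (c * (b n / n%:R) / L / D).
    by field; rewrite !lt0r_neq0.
  apply: ler_pM => //; first by rewrite mulr_ge0 ?divr_ge0// ltW.
    by rewrite !mulr_ge0 ?invr_ge0// ltW.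
  apply: ler_wpM2r; first by rewrite invr_ge0 ltW.
  rewrite ler_pdivrMr// mulrA ler_pdivrMr// (le_trans hz)//.
  by rewrite mulrC ler_pM2r// mulrC.
split.
- have [k1 k2 k3 k4] := entrance_right n.
  apply: le_trans (measure_words_ge bp K_large K_ge0 nG uniq_early (fun w => early_letters mn) k1 k2 k3).
  by rewrite lee_fin; apply: (lower _ _ (x n)).
- have [k1 k2 k3 k4] := entrance_left n.
  apply: le_trans (measure_words_ge bp K_large K_ge0 nG uniq_early (fun w => early_letters mn) k1 k2 k3).
  by rewrite lee_fin; apply: (lower _ _ (y n)).
Unshelve. all: by end_near. Qed.

(** As long as s * (b n / n) <= eta, words of at most s letters with return times at most
    n.+1 keep half of the mass for each number of letters; the entrance into a long
    excursion is a proportion of order b n / n of it. *)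
Lemma few_returns_measure : exists2 C, 0 < C & exists2 eta, 0 < eta &
  \forall n \near \oo, forall s, s%:R * (b n / n%:R) <= eta ->
  ((C * (s.+1%:R * (b n / n%:R)))%:E <= leb (word_union f0 f1 G (words_upto n s) cc (f1 (x n))))%E.
Proof.
move: (bp_gamc bp) (bp_cdel bp) => gc cd.
have [C C0 HC] := core_length; have q0 := gapG_gt0.
have e0 := expR_gt0 K.
have dg : 0 < del - gam by lra.
have L0 : 0 < L by apply: lt_le_trans L1.
pose D := expR K * (del - gam).
have D0 : 0 < D by rewrite mulr_gt0.
pose eta := (del - gam) / (2 * (expR K * (C * (2 * d)))).
have eta0 : 0 < eta by rewrite /eta divr_gt0// !mulr_gt0.
exists (gap G gam del / 2 * c / (L * D)); first by rewrite !divr_gt0 ?mulr_gt0 ?divr_gt0.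
exists eta => //.
near=> n; move=> s hs.
have n1 : (1 <= n)%N by near: n; exact: near_ge.
have [_ xn xn'] : [/\ \sum_(1 <= k < n) x k <= d * b n, c * b n <= n%:R * x n & n%:R * x n <= d * b n] by near: n.
have [_ yn yn'] : [/\ \sum_(1 <= k < n) y k <= d * b n, c * b n <= n%:R * y n & n%:R * y n <= d * b n] by near: n.
have n0 : 0 < n%:R :> R by rewrite ltr0n.
have bn := b_gt0 n1.
have [k1 k2 k3 k4] := entrance_right n.
apply: le_trans (measure_words_ge bp K_large K_ge0 nG (words_upto_uniq n s)
  (fun w hw => (mem_words_upto hw).2) k1 k2 k3).
rewrite lee_fin.
have zn : x n + y n <= 2 * d * (b n / n%:R).
  by rewrite mulrA ler_pdivlMr//; lra.
have mass : gap G gam del / 2 * s.+1%:R <= \sum_(w <- words_upto n s) gap (word_map f0 f1 G w) gam del.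
  rewrite sum_words_upto; apply: (@le_trans _ _ (\sum_(0 <= r < s.+1) gap G gam del / 2)).
    by rewrite big_const_nat iter_addr addr0 subn0 mulr_natr.
  rewrite big_nat [leRHS]big_nat; apply: ler_sum => r /andP[_ rs].
  have /andP[+ _] := killed_mass bp n r K_large K_ge0 nG; apply: le_trans.
  apply: ler_wpM2l; first exact: ltW.
  suff : r%:R * (expR K * (core_right f0 f1 gam n - core_left f0 f1 del n) / (del - gam)) <= 2^-1 by lra.
  have cz : core_right f0 f1 gam n - core_left f0 f1 del n <= C * (2 * d * (b n / n%:R)).
    by apply: (le_trans (HC n)); rewrite ler_pM2l.
  rewrite mulrA ler_pdivrMr//.
  have h1 : expR K * (core_right f0 f1 gam n - core_left f0 f1 del n) <= expR K * (C * (2 * d * (b n / n%:R))).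
    by rewrite ler_pM2l.
  have h2 : r%:R * (expR K * (core_right f0 f1 gam n - core_left f0 f1 del n)) <= r%:R * (expR K * (C * (2 * d * (b n / n%:R)))).
    by apply: ler_wpM2l.
  apply: (le_trans h2).
  have h3 : r%:R * (b n / n%:R) <= eta.
    by apply: le_trans hs; rewrite ler_pM2r ?divr_gt0// ler_nat -ltnS.
  have -> : r%:R * (expR K * (C * (2 * d * (b n / n%:R)))) = (r%:R * (b n / n%:R)) * (expR K * (C * (2 * d))).
    by ring.
  apply: (le_trans (ler_wpM2r _ h3)); first by rewrite !mulr_ge0// ltW.
  rewrite /eta le_eqVlt; apply/orP; left; apply/eqP; field.
  by rewrite !lt0r_neq0.
have -> : gap G gam del / 2 * c / (L * D) * (s.+1%:R * (b n / n%:R)) =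
      (gap G gam del / 2 * s.+1%:R) * (c * (b n / n%:R) / L / D).
  by field; rewrite !lt0r_neq0.
apply: ler_pM => //; first by rewrite mulr_ge0 ?divr_ge0// ltW.
  by rewrite !mulr_ge0 ?invr_ge0// ltW.
apply: ler_wpM2r; first by rewrite invr_ge0 ltW.
rewrite ler_pdivrMr// mulrA ler_pdivrMr// (le_trans xn)//.
by rewrite mulrC ler_pM2r// mulrC.
Unshelve. all: by end_near. Qed.

Variable T : R -> R.
Hypothesis T_f0 : inverts T f0.
Hypothesis T_f1 : inverts T f1.
Variable N : nat.
Hypothesis rG : realizes gam del T c0 c1 G N N.

Lemma word_union_in ws s t u v : u <= G gam -> G del <= v -> gam <= s -> s <= t -> t <= del ->
  word_union f0 f1 G ws s t `<=` `[u, v].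
Proof.
move=> uG Gv gs st td z [w _ /=]; rewrite !in_itv /= => /andP[h1 h2].
have [h3 h4] := word_map_range bp w K_large K_ge0 nG gs st td.
by lra.
Qed.

Lemma measurable_word_union ws s t : measurable (word_union f0 f1 G ws s t).
Proof. by apply: fin_bigcup_measurable => // w _; exact: measurable_itv. Qed.

Lemma early_right_events m n z :
  word_union f0 f1 G (early_words m) cc (f1 (x n)) z ->
  (Zlast T `[c0, c1] n z <= N + m)%N /\ occupation T `]c1, 1] n z <= (N + m)%:R.
Proof.
move: c0_gam c1_del (bp_gamc bp) (bp_cdel bp) => /andP[c00 c0g] /andP[c1d c11] gc cd.
have [j0 hj0] := iter_f0_small bp c00; have [j1 hj1] := iter_f1_close bp c11.
move=> [w /= + ]; rewrite mem_filter in_itv /= => /andP[wm _] /andP[h1 h2].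
have hj0' : iter (maxn j0 j1) f0 gam <= c0.
  by apply: le_trans hj0; apply: (iter_f0_le bp); exact: leq_maxl.
have hj1' : c1 <= iter (maxn j0 j1) f1 del.
  by apply: (le_trans hj1); apply: (iter_f1_le bp); exact: leq_maxr.
have [orb _] := cylinder_orbit_right bp T_f0 T_f1 c0_gam c1_del hj0' hj1' rG h1 h2.
have orb' k : (N + word_time w < k)%N -> (k <= n)%N -> 0 < iter k T z < c0.
  by move=> k1 k2; apply: orb => //; rewrite (leq_trans k2)// addnS ltnW// ltnS leq_addl.
have tm : (N + word_time w <= N + m)%N by rewrite leq_add2l.
split.
- apply: leq_trans tm; apply: Zlast_le => k k1 k2; have := orb' k k1 k2.
  by rewrite /= in_itv /=; lra.
- apply: (@le_trans _ _ (N + word_time w)%:R); last by rewrite ler_nat.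
  apply: occupation_le => k k1 k2; have := orb' k k1 k2.
  by rewrite /= in_itv /=; lra.
Qed.

Lemma early_left_events m n z :
  word_union f0 f1 G (early_words m) (f0 (iter n f1 c1)) cc z ->
  occupation T `[0, c0[ n z <= (N + m)%:R.
Proof.
move: c0_gam c1_del (bp_gamc bp) (bp_cdel bp) => /andP[c00 c0g] /andP[c1d c11] gc cd.
have [j0 hj0] := iter_f0_small bp c00; have [j1 hj1] := iter_f1_close bp c11.
move=> [w /= + ]; rewrite mem_filter in_itv /= => /andP[wm _] /andP[h1 h2].
have hj0' : iter (maxn j0 j1) f0 gam <= c0.
  by apply: le_trans hj0; apply: (iter_f0_le bp); exact: leq_maxl.
have hj1' : c1 <= iter (maxn j0 j1) f1 del.
  by apply: (le_trans hj1); apply: (iter_f1_le bp); exact: leq_maxr.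
have [orb _] := cylinder_orbit_left bp T_f0 T_f1 c0_gam c1_del hj0' hj1' rG h1 h2.
have orb' k : (N + word_time w < k)%N -> (k <= n)%N -> c1 < iter k T z < 1.
  by move=> k1 k2; apply: orb => //; rewrite (leq_trans k2)// addnS ltnW// ltnS leq_addl.
apply: (@le_trans _ _ (N + word_time w)%:R); last by rewrite ler_nat leq_add2l.
apply: occupation_le => k k1 k2; have := orb' k k1 k2.
by rewrite /= in_itv /=; lra.
Qed.

Lemma few_returns_event : exists j, forall n s z,
  word_union f0 f1 G (words_upto n s) cc (f1 (x n)) z ->
  occupation T `[c0, c1] n z <= (N + s * j.+1).+1%:R.
Proof.
move: c0_gam c1_del (bp_gamc bp) (bp_cdel bp) => /andP[c00 c0g] /andP[c1d c11] gc cd.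
have [j0 hj0] := iter_f0_small bp c00; have [j1 hj1] := iter_f1_close bp c11.
have hj0' : iter (maxn j0 j1) f0 gam <= c0.
  by apply: le_trans hj0; apply: (iter_f0_le bp); exact: leq_maxl.
have hj1' : c1 <= iter (maxn j0 j1) f1 del.
  by apply: (le_trans hj1); apply: (iter_f1_le bp); exact: leq_maxr.
exists (maxn j0 j1) => n s z [w /= /mem_words_upto[ws _]]; rewrite in_itv /= => /andP[h1 h2].
have [orb vis] := cylinder_orbit_right bp T_f0 T_f1 c0_gam c1_del hj0' hj1' rG h1 h2.
have orb' k : (N + word_time w < k)%N -> (k <= n)%N -> 0 < iter k T z < c0.
  by move=> k1 k2; apply: orb => //; rewrite (leq_trans k2)// addnS ltnW// ltnS leq_addl.
apply: (@le_trans _ _ (visits T c0 c1 (N + word_time w) z).+1%:R).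
  apply: occupation_visits => k k1 k2; have := orb' k k1 k2.
  by rewrite /= in_itv /=; lra.
by rewrite ler_nat ltnS (leq_trans vis)// leq_add2l leq_mul2r ws orbT.
Qed.

End Cylinders.

(** * Passage to the lower limits *)

Section Limits.
Variable R : realType.

Lemma limn_einf_ge (u : nat -> \bar R) (C : \bar R) :
  (\forall n \near \oo, (C <= u n)%E) -> (C <= limn_einf u)%E.
Proof.
move=> [N _ HN]; rewrite limn_einf_lim; apply: lime_ge; first exact: is_cvg_einfs.
exists N => // n /= Nn; apply: le_ereal_inf_tmp => _ [k /= nk <-].
by apply: HN => /=; exact: leq_trans nk.
Qed.

Variables (alpha : R) (l : R -> R) (cs : nat -> R) (N : nat).
Hypothesis alpha01 : 0 < alpha < 1.
Hypothesis sv : slowly_varying +oo l.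
Hypothesis cs_gt0 : forall n, 0 < cs n.
Hypothesis cs_0 : cs n @[n --> \oo] --> (0 : R).
Hypothesis cs_oo : cs n * n%:R @[n --> \oo] --> +oo.

Let t n := cs n * n%:R.
(** The time which is left to a word, when N steps out of cs n * n are spent in the onto
    branch. *)
Definition early_time n := (Num.truncn (cs n * n%:R) - N)%N.
Let b := regular_scale alpha l.

Lemma early_time_le n : (N <= Num.truncn (t n))%N -> ((N + early_time n)%:R <= t n) /\
  t n < (N + early_time n).+1%:R.
Proof.
move=> Nt; rewrite /early_time subnKC//.
have t0 : 0 <= t n by rewrite mulr_ge0// ltW.
by have /andP[] := truncn_itv t0.
Qed.

Lemma truncn_t_large k : \forall n \near \oo, (k <= Num.truncn (t n))%N.
Proof.
have /cvgryPge/(_ k%:R) := cs_oo; apply: filterS => n kt.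
by rewrite truncn_ge_nat// mulr_ge0// ltW.
Qed.

Lemma early_time_large k : \forall n \near \oo, (k <= early_time n)%N.
Proof.
apply: filterS (truncn_t_large (k + N)) => n h.
by rewrite /early_time leq_subRL ?(leq_trans _ h) ?leq_addl// addnC.
Qed.

Lemma early_time_le_n : \forall n \near \oo, (early_time n <= n)%N.
Proof.
have c1 : \forall n \near \oo, cs n < 1.
  have /cvgrPdist_lt/(_ 1 ltr01) := cs_0; apply: filterS => n.
  by rewrite sub0r normrN gtr0_norm.
apply: filterS2 c1 (truncn_t_large N) => n c1 Nt.
have [h _] := early_time_le Nt.
rewrite -(@ler_nat R); apply: (@le_trans _ _ (N + early_time n)%:R); first by rewrite ler_nat leq_addl.
by apply: (le_trans h); rewrite /t ler_piMl// ltW.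
Qed.

Lemma scale_quotient k : (0 < k)%N -> k%:R / b k = k%:R `^ alpha / l k%:R /\ b k / k%:R = l k%:R / k%:R `^ alpha.
Proof.
move=> k0; have [_ lpos _] := sv.
have kk : 0 < k%:R :> R by rewrite ltr0n.
have lk := lpos _ kk.
have p1 : k%:R `^ alpha * k%:R `^ (1 - alpha) = k%:R :> R.
  rewrite -powRD; first by rewrite subrKC powRr1// ltW.
  by rewrite (gt_eqF kk) implybT.
have pa : 0 < k%:R `^ alpha :> R by exact: powR_gt0.
have pb : 0 < k%:R `^ (1 - alpha) :> R by exact: powR_gt0.
rewrite /b /regular_scale; set A := k%:R `^ alpha in p1 pa *.
set B := k%:R `^ (1 - alpha) in p1 pb *; set lk' := l k%:R in lk *.
by rewrite -p1; split; field; rewrite !lt0r_neq0.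
Qed.

(** By [scale_quotient] the hypothesis is a lower bound of P by
    A * (m / n)^alpha * l n / l m, with m the early time.  As m <= cs n * n <= 2 m, replacing m by
    cs n * n costs 4 for l and 2 for the power: hence 8. *)
Lemma early_limit (A : R) (P : nat -> \bar R) : 0 < A ->
  (\forall n \near \oo,
    ((A * ((early_time n)%:R / b (early_time n) * (b n / n%:R)))%:E <= P n)%E) ->
  ((A / 8)%:E <= limn_einf (fun n => (l (cs n * n%:R) / (cs n `^ alpha * l n%:R))%:E * P n))%E.
Proof.
move=> A0 HP; apply: limn_einf_ge.
have [_ lpos _] := sv.
have moo : (early_time n)%:R @[n --> \oo] --> (+oo : set_system R).
  apply/cvgryPge => B; apply: filterS (early_time_large (Num.truncn B).+1) => n h.
  by apply: (le_trans (ltW (truncnS_gt B))); rewrite ler_nat.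
have mt : \forall n \near \oo, (early_time n)%:R <= t n <= 2 * (early_time n)%:R.
  apply: filterS2 (truncn_t_large N) (early_time_large N.+1) => n Nt Nm.
  have [h1 h2] := early_time_le Nt; apply/andP; split.
    by apply: le_trans h1; rewrite ler_nat leq_addl.
  by apply: (le_trans (ltW h2)); rewrite -natrM ler_nat mul2n -addnn -addSn leq_add2r.
have lm := slowly_varying_comparable sv moo cs_oo mt.
have /andP[al0 al1] := alpha01.
near=> n.
have n1 : (1 <= n)%N by near: n; exact: near_ge.
have m1 : (1 <= early_time n)%N by near: n; exact: early_time_large.
have /andP[mt1 mt2] : (early_time n)%:R <= t n <= 2 * (early_time n)%:R by near: n.
have lmn : l (early_time n)%:R <= 4 * l (t n) by near: n.
have Pn : ((A * ((early_time n)%:R / b (early_time n) * (b n / n%:R)))%:E <= P n)%E by near: n.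
have n0 : 0 < n%:R :> R by rewrite ltr0n.
have m0 : 0 < (early_time n)%:R :> R by rewrite ltr0n.
have t0 : 0 < t n by rewrite mulr_gt0.
have lt0 := lpos _ t0; have ln0 := lpos _ n0; have lm0 := lpos _ m0.
have ca : 0 < cs n `^ alpha by exact: powR_gt0.
have na : 0 < n%:R `^ alpha :> R by exact: powR_gt0.
have ma : 0 < (early_time n)%:R `^ alpha :> R by exact: powR_gt0.
have ta : cs n `^ alpha * n%:R `^ alpha <= 2 * (early_time n)%:R `^ alpha.
  rewrite -powRM ?(ltW (cs_gt0 n))//; apply: (@le_trans _ _ ((2 * (early_time n)%:R) `^ alpha)).
    by apply: ge0_ler_powR; rewrite ?nnegrE ?mulr_ge0//; [lra|exact: ltW].
  rewrite powRM//; apply: ler_wpM2r; first exact: ltW.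
  by rewrite -[leRHS]powRr1//; apply: ler_powR; lra.
apply: (@le_trans _ _ ((l (t n) / (cs n `^ alpha * l n%:R))%:E *
   (A * ((early_time n)%:R / b (early_time n) * (b n / n%:R)))%:E)%E); last first.
  apply: lee_wpmul2l => //; rewrite lee_fin divr_ge0//; first exact: ltW.
  by rewrite mulr_ge0// ltW.
rewrite -EFinM lee_fin; have [-> _] := scale_quotient m1; have [_ ->] := scale_quotient n1.
set lt := l (t n) in lt0 lmn *; set lnn := l n%:R in ln0 *; set lmm := l (early_time n)%:R in lm0 lmn *.
set cA := cs n `^ alpha in ca ta *; set nA := n%:R `^ alpha in na ta *; set mA := (early_time n)%:R `^ alpha in ma ta *.
have -> : lt / (cA * lnn) * (A * (mA / lmm * (lnn / nA))) = A * (lt * mA / (lmm * (cA * nA))).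
  by field; rewrite !lt0r_neq0.
apply: ler_wpM2l; first exact: ltW.
rewrite ler_pdivlMr ?mulr_gt0//.
have h1 : lmm * (cA * nA) <= 4 * lt * (2 * mA).
  by apply: ler_pM => //; [exact: ltW|rewrite mulr_ge0// ltW].
lra.
Unshelve. all: by end_near. Qed.

End Limits.

Section FewReturnsLimit.
Variable R : realType.

(** Take for s the integer part of kap * ct n * (n / b n).  The choice of kap makes the
    visits along s letters, j.+1 for each, use at most half of ct n * n / (gm * q n); the
    other half, which tends to infinity, takes care of the constant N.+1.
    The divergence of ct n * (n / (gm * q n)) also shows that gm > 0. *)
Lemma few_returns_limit (b ct q : nat -> R) (gm A eta Cq : R) (N j : nat) (P : nat -> \bar R) :
  (forall n, (0 < n)%N -> 0 < b n) -> 0 < A -> 0 < eta -> 0 < Cq ->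
  (forall n, 0 < ct n) -> ct n @[n --> \oo] --> (0 : R) ->
  (\forall n \near \oo, 0 <= q n <= Cq * b n) ->
  ct n * (n%:R / (gm * q n)) @[n --> \oo] --> +oo ->
  (\forall n \near \oo, forall s, s%:R * (b n / n%:R) <= eta ->
     (N + s * j.+1).+1%:R <= ct n * (n%:R / (gm * q n)) ->
     ((A * (s.+1%:R * (b n / n%:R)))%:E <= P n)%E) ->
  ((A * (2 * j.+1%:R * (`|gm| + 1) * Cq)^-1)%:E <= limn_einf (fun n => (1 / ct n)%:E * P n))%E.
Proof.
move=> b0 A0 eta0 Cq0 ct0 ctlim hq oo HP; apply: limn_einf_ge.
pose g := `|gm| + 1; have g0 : 0 < g by rewrite /g ltr_wpDl.
pose kap := (2 * j.+1%:R * g * Cq)^-1.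
have den0 : 0 < 2 * j.+1%:R * g * Cq by rewrite !mulr_gt0.
have kap0 : 0 < kap by rewrite /kap invr_gt0.
have ct_small : \forall n \near \oo, ct n < eta / kap.
  have ek : 0 < eta / kap by rewrite divr_gt0.
  have /cvgrPdist_lt/(_ _ ek) := ctlim; apply: filterS => n.
  by rewrite sub0r normrN gtr0_norm.
have big : \forall n \near \oo, (2 * N.+1%:R : R) <= ct n * (n%:R / (gm * q n)).
  by move/cvgryPge : oo; exact.
near=> n.
have n1 : (1 <= n)%N by near: n; exact: near_ge.
have n0 : 0 < n%:R :> R by rewrite ltr0n.
have bn := b0 n n1.
have /andP[q0 qC] : 0 <= q n <= Cq * b n by near: n.
have large : (2 * N.+1%:R : R) <= ct n * (n%:R / (gm * q n)) by near: n.
have small : ct n < eta / kap by near: n.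
have ctn := ct0 n.
have an0 : 0 < n%:R / (gm * q n).
  have : 0 < ct n * (n%:R / (gm * q n)) by apply: lt_le_trans large.
  by rewrite pmulr_rgt0.
have gq0 : 0 < gm * q n by move: an0; rewrite pmulr_rgt0// invr_gt0.
have q_gt0 : 0 < q n.
  by rewrite lt_neqAle q0 andbT; apply/eqP => q00; move: gq0; rewrite -q00 mulr0 ltxx.
have gm0 : 0 < gm by rewrite -(pmulr_lgt0 _ q_gt0).
have an_ge : n%:R / (g * (Cq * b n)) <= n%:R / (gm * q n).
  apply: ler_wpM2l; first exact: ltW.
  rewrite lef_pV2 ?posrE ?mulr_gt0//.
  apply: ler_pM => //; [exact: ltW|].
  by rewrite /g (le_trans (ler_norm gm))// lerDl.
pose r := kap * ct n * (n%:R / b n).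
have r0 : 0 <= r.
  by rewrite /r; apply: mulr_ge0; [apply: mulr_ge0|apply: divr_ge0]; exact: ltW.
pose s := Num.truncn r.
have /andP[s1 s2] := truncn_itv r0; rewrite -/s in s1 s2.
have bq : 0 < b n / n%:R by rewrite divr_gt0.
have rb : r * (b n / n%:R) = kap * ct n by rewrite /r; field; rewrite !lt0r_neq0.
have Pn : ((A * (s.+1%:R * (b n / n%:R)))%:E <= P n)%E.
  have HPn : forall s, s%:R * (b n / n%:R) <= eta ->
     (N + s * j.+1).+1%:R <= ct n * (n%:R / (gm * q n)) ->
     ((A * (s.+1%:R * (b n / n%:R)))%:E <= P n)%E by near: n.
  apply: HPn.
    apply: (@le_trans _ _ (r * (b n / n%:R))); first by rewrite ler_pM2r.
    by rewrite rb mulrC -ler_pdivlMr// ltW.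
  have h1 : s%:R * j.+1%:R <= r * j.+1%:R by apply: ler_wpM2r.
  have h2 : r * j.+1%:R = ct n * (n%:R / (g * (Cq * b n))) / 2.
    by rewrite /r /kap; field; rewrite !lt0r_neq0.
  have h3 : ct n * (n%:R / (g * (Cq * b n))) <= ct n * (n%:R / (gm * q n)) by rewrite ler_pM2l.
  have -> : (N + s * j.+1).+1%:R = N.+1%:R + s%:R * j.+1%:R :> R.
    by rewrite -addSn natrD natrM.
  by lra.
apply: (@le_trans _ _ ((1 / ct n)%:E * (A * (s.+1%:R * (b n / n%:R)))%:E)%E); last first.
  by apply: lee_wpmul2l => //; rewrite lee_fin divr_ge0// ltW.
rewrite -EFinM lee_fin -/g -/kap.
have h4 : kap * ct n <= s.+1%:R * (b n / n%:R) by rewrite -rb ler_pM2r// ltW.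
have h5 : A * (kap * ct n) <= A * (s.+1%:R * (b n / n%:R)) by rewrite ler_pM2l.
by rewrite mul1r [leRHS]mulrC ler_pdivlMr// -mulrA.
Unshelve. all: by end_near. Qed.

Lemma nice_le (gam del K K' : R) (G : R -> R) : K <= K' -> nice gam del K G -> nice gam del K' G.
Proof.
move=> KK [IG LG]; split=> // s t gs st td.
apply: (@slopes_within_le _ _ _ (K * (t - s))); last exact: LG.
  by move=> u v *; apply: IG; lra.
by apply: ler_wpM2r; lra.
Qed.

End FewReturnsLimit.

(** * The lower estimates *)

Theorem theorem8p3 (R : realType)
    (T T0 T1 : R -> R) (c p a : R)
    (hT : thaler_map T T0 T1 c p a)
    (f0 f1 : R -> R)
    (hf0 : inverse_branch `[0, c] T0 f0) (hf1 : inverse_branch `[c, 1] T1 f1)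
    (h0 : R -> R) (mu : {measure set (measurableTypeR R) -> \bar R})
    (hmu : thaler_measure T f0 f1 h0 mu)
    (gamma : R) (hgamma : 0 < gamma < c) (hTgamma : c < T gamma < 1)
    (hper : T (T gamma) = gamma)
    (c0 c1 : R) (hc0 : 0 < c0 <= gamma) (hc1 : T gamma <= c1 < 1)
    (A0 Y A1 : set R)
    (hA0 : A0 = `[0, c0[%classic) (hY : Y = `[c0, c1]%classic)
    (hA1 : A1 = `]c1, 1]%classic)
    (alpha : R) (halpha : alpha = p^-1)
    (l : R -> R) (hl : slowly_varying +oo l)
    (hw0 : fine (wander_in mu T Y A0 n) /
             (beta0 T c a * n%:R `^ (1 - alpha) * l n%:R) @[n --> \oo] --> (1 : R))
    (hw1 : fine (wander_in mu T Y A1 n) /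
             (beta1 T c a * n%:R `^ (1 - alpha) * l n%:R) @[n --> \oo] --> (1 : R))
    (G : R -> R) (hG : L1_nonneg mu G) (hGR : riemann_version mu G) :
  exists2 C1 : R, 0 < C1 &
    forall cs ct : nat -> R,
      (forall n, 0 < cs n) -> (forall n, 0 < ct n) ->
      cs n @[n --> \oo] --> (0 : R) ->
      cs n * n%:R @[n --> \oo] --> +oo ->
      ct n @[n --> \oo] --> (0 : R) ->
      ct n * return_scale mu T alpha Y n%:R @[n --> \oo] --> +oo ->
      [/\ (C1%:E <= limn_einf (fun n : nat =>
             (l (cs n * n%:R) / (cs n `^ alpha * l n%:R))%:E *
             mu_density mu G
               [set x | (Zlast T Y n x)%:R / n%:R <= cs n]%R))%E,
          (C1%:E <= limn_einf (fun n : nat =>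
             (1 / ct n)%:E *
             mu_density mu G
               [set x | occupation T Y n x / return_scale mu T alpha Y n%:R
                          <= ct n]%R))%E,
          (C1%:E <= limn_einf (fun n : nat =>
             (l (cs n * n%:R) / (cs n `^ alpha * l n%:R))%:E *
             mu_density mu G
               [set x | occupation T A0 n x / n%:R <= cs n]%R))%E &
          (C1%:E <= limn_einf (fun n : nat =>
             (l (cs n * n%:R) / (cs n `^ alpha * l n%:R))%:E *
             mu_density mu G
               [set x | occupation T A1 n x / n%:R <= cs n]%R))%E].
Proof.
have p1 := thaler_p hT.
have alpha01 : 0 < alpha < 1.
  by rewrite halpha invr_gt0 invf_lt1; lra.
have [M [theta [L [[bp Tf0 Tf1 L1] low]]]] := thaler_branch_pair hT hf0 hf1 hgamma hTgamma hper.
have low0 u v : 0 <= u -> u <= v -> v <= 1 -> v - u <= L * (f0 v - f0 u).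
  by move=> u0 uv v1; have [] := low u v u0 uv v1.
have low1 u v : 0 <= u -> u <= v -> v <= 1 -> v - u <= L * (f1 v - f1 u).
  by move=> u0 uv v1; have [] := low u v u0 uv v1.
have /andP[c_0 c_1] := thaler_c hT.
have T00 : T 0 = 0.
  have [_ e] := hf0.1 0 ltac:(rewrite lexx ler01 //).
  rewrite -(thaler_ext0 hT); last by rewrite in_itv /= lexx.
  by rewrite -{1}(bp_f00 bp).
have T11 : T 1 = 1.
  have [_ e] := hf1.1 1 ltac:(rewrite lexx ler01 //).
  rewrite -(thaler_ext1 hT); last by rewrite in_itv /= lexx andbT.
  by rewrite -{1}(bp_f11 bp).
have h0c := thaler_h0_continuous hmu.
have [w1 w1i h0max] := EVT_max ler01 h0c.
have [w2 w2i h0min] := EVT_min ler01 h0c.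
have m1_gt0 : 0 < h0 w2 by apply: (thaler_h0_gt0 hmu); move: w2i; rewrite in_itv.
have h0b x : 0 <= x <= 1 -> h0 w2 <= h0 x <= h0 w1.
  by move=> x01; rewrite h0min ?in_itv// h0max ?in_itv.
have muE := thaler_muE hmu.
subst A0 A1 Y.
have WL := wander_in_left bp Tf0 hc0 hc1 T00 L1 low0 m1_gt0 h0b h0c muE.
have WR := wander_in_right bp Tf1 hc0 hc1 T11 L1 low1 m1_gt0 h0b h0c muE.
have [Cq Cq0 HQ] := Qfun_le bp Tf0 Tf1 hc0 hc1 T00 T11 L1 low0 low1 m1_gt0 h0b h0c muE.
have Cu0 := Cu_gt0 bp L1 m1_gt0 h0b.
have x0 k : 0 < iter k f0 c0 by have [] := iter_c0 bp hc0 hc1 k.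
have xd k : iter k.+1 f0 c0 <= iter k f0 c0 by have [_ /ltW] := iter_c0 bp hc0 hc1 k.
have y0 k : 0 < 1 - iter k f1 c1 by have [] := iter_c1 bp hc0 hc1 k; rewrite subr_gt0.
have yd k : 1 - iter k.+1 f1 c1 <= 1 - iter k f1 c1.
  by have [_ /ltW] := iter_c1 bp hc0 hc1 k; rewrite lerD2l lerN2.
have [cx cx0 [dx dx0 Hx]] := wandering_asymptotics alpha01 hl m1_gt0 Cu0 x0 xd WL hw0.
have [cy cy0 [dy dy0 Hy]] := wandering_asymptotics alpha01 hl m1_gt0 Cu0 y0 yd WR hw1.
pose b := regular_scale alpha l.
have bpos n : (0 < n)%N -> 0 < b n.
  have [_ lpos _] := hl.
  by move=> n0; rewrite /b /regular_scale mulr_gt0 ?lpos ?powR_gt0 ?ltr0n.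
pose cm := Num.min cx cy; pose dm := Num.max dx dy.
have cm0 : 0 < cm by rewrite /cm lt_min cx0.
have dm0 : 0 < dm by rewrite /dm lt_max dx0.
have cmx : cm <= cx by rewrite /cm ge_min lexx.
have cmy : cm <= cy by rewrite /cm ge_min lexx orbT.
have dmx : dx <= dm by rewrite /dm le_max lexx.
have dmy : dy <= dm by rewrite /dm le_max lexx orbT.
have Hx' : \forall n \near \oo, [/\ \sum_(1 <= k < n) iter k f0 c0 <= dm * b n,
    cm * b n <= n%:R * iter n f0 c0 & n%:R * iter n f0 c0 <= dm * b n].
  apply: filterS2 (near_ge 1) Hx => n n1 [k1 k2 k3]; have bn := bpos n n1.
  split; [apply: (le_trans k1)|apply: le_trans k2|apply: (le_trans k3)];
    by rewrite ler_pM2r.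
have Hy' : \forall n \near \oo, [/\ \sum_(1 <= k < n) (1 - iter k f1 c1) <= dm * b n,
    cm * b n <= n%:R * (1 - iter n f1 c1) & n%:R * (1 - iter n f1 c1) <= dm * b n].
  apply: filterS2 (near_ge 1) Hy => n n1 [k1 k2 k3]; have bn := bpos n n1.
  split; [apply: (le_trans k1)|apply: le_trans k2|apply: (le_trans k3)];
    by rewrite ler_pM2r.
have [g [I [gG gI I0]]] := hGR.
have [u [v [dl [u0 uv v1 dl0 gdl]]]] := riemann_lower_interval gI I0.
have [G0 [N [K0 [[K00 nG0 _] [uG Gv rG]]]]] := onto_branch_exists bp c0 c1 Tf0 Tf1 (ltW u0) uv (ltW v1).
have /andP[th0 th1] := bp_theta bp.
have gd : gamma < T gamma by apply: lt_trans (bp_gamc bp) (bp_cdel bp).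
pose D := M * expR M / (T gamma - gamma) + M.
have D0 : 0 <= D.
  rewrite /D addr_ge0 ?(bp_M bp)// divr_ge0 ?mulr_ge0 ?expR_ge0 ?(bp_M bp)//.
  by rewrite subr_ge0 ltW.
(* K dominates the distortion of the onto branch and absorbs that of the letters. *)
pose K := K0 + D / (1 - theta).
have th1' : 0 < 1 - theta by rewrite subr_gt0.
have K_ge0 : 0 <= K by rewrite /K addr_ge0// divr_ge0// ltW.
have K_large : D <= (1 - theta) * K.
  rewrite /K mulrDr mulrCA divff ?lt0r_neq0// mulr1 lerDr.
  by rewrite mulr_ge0// ltW.
have nG : nice gamma (T gamma) K G0.
  by apply: nice_le nG0; rewrite /K lerDl divr_ge0// ltW.
have [Ce Ce0 HCe] := early_measure bp hc0 hc1 L1 low0 low1 K_large K_ge0 nG cm0 dm0 bpos Hx' Hy'.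
have [Cf Cf0 [eta eta0 HCf]] := few_returns_measure bp hc0 hc1 L1 low0 low1 K_large K_ge0 nG cm0 dm0 bpos Hx' Hy'.
have [j Hj] := few_returns_event bp hc0 hc1 Tf0 Tf1 rG.
(* The cylinder unions lie in [u, v], where G is at least dl, and the invariant
   density is at least the minimum h0 w2 of h0, as the two quotients in it are at
   least 1. *)
have dens ws s t E : gamma <= s -> s <= t -> t <= T gamma ->
    word_union f0 f1 G0 ws s t `<=` E -> forall r : R, 0 <= r ->
    (r%:E <= lebesgue_measure (word_union f0 f1 G0 ws s t))%E ->
    ((dl * h0 w2 * r)%:E <= mu_density mu G E)%E.
  move=> gs st tT UE r r0 rU.
  have mU := measurable_word_union f0 f1 G0 ws s t.
  have Uuv := word_union_in bp K_large K_ge0 nG (ws := ws) uG Gv gs st tT.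
  have U01 : word_union f0 f1 G0 ws s t `<=` `]0, 1[%classic.
    move=> z /Uuv /=; rewrite !in_itv /= => /andP[uz zv].
    by rewrite (lt_le_trans u0 uz) (le_lt_trans zv v1).
  apply: (@le_trans _ _ (dl%:E * mu (word_union f0 f1 G0 ws s t))%E).
    rewrite -mulrA EFinM; apply: lee_wpmul2l; first by rewrite lee_fin ltW.
    apply: le_trans (mu_ge_leb bp m1_gt0 h0b h0c muE mU U01).
    by rewrite EFinM; apply: lee_wpmul2l => //; rewrite lee_fin ltW.
  apply: mu_density_ge => //.
  - move=> z Uz; split; last exact: UE.
    by have := U01 z Uz; rewrite /= !in_itv /= => /andP[/ltW-> /ltW->].
  - exact: ltW.
  - have [Z [mZ Z0 sub]] := gG; exists Z; split=> // z /= nz; apply: sub => /= gz.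
    apply: nz => Uz; have := Uuv z Uz; rewrite /= in_itv /= => zuv.
    rewrite -gz; first exact: gdl.
    by move: zuv => /andP[uz zv]; rewrite (le_trans (ltW u0) uz) (le_trans zv (ltW v1)).
pose Cq' := Cq * ((1 + (iter 1 f0 c0 + (1 - iter 1 f1 c1))^-1) * (2 * dm)).
have z10 : 0 < iter 1 f0 c0 + (1 - iter 1 f1 c1) by rewrite addr_gt0.
have Cq'0 : 0 < Cq' by rewrite /Cq' !mulr_gt0// addr_gt0// invr_gt0.
have Q_bound : \forall n \near \oo, 0 <= fine (Qfun mu T `[c0, c1] n%:R^-1) <= Cq' * b n.
  near=> n.
  have n2 : (2 <= n)%N by near: n; exact: near_ge.
  have [X1 _ _] : [/\ \sum_(1 <= k < n) iter k f0 c0 <= dm * b n,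
    cm * b n <= n%:R * iter n f0 c0 & n%:R * iter n f0 c0 <= dm * b n] by near: n.
  have [Y1 _ _] : [/\ \sum_(1 <= k < n) (1 - iter k f1 c1) <= dm * b n,
    cm * b n <= n%:R * (1 - iter n f1 c1) & n%:R * (1 - iter n f1 c1) <= dm * b n] by near: n.
  have [q0 q1] := HQ n n2.
  have qfin : Qfun mu T `[c0, c1] n%:R^-1 \is a fin_num.
    by rewrite ge0_fin_numE// (le_lt_trans q1)// ltry.
  rewrite -lee_fin fineK// q0 /= -lee_fin fineK//; apply: (le_trans q1); rewrite lee_fin.
  rewrite /Cq' -mulrA; apply: ler_wpM2l; first exact: ltW.
  set z1 := iter 1 f0 c0 + (1 - iter 1 f1 c1) in z10 *.
  set Z := \sum_(1 <= k < n) _.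
  have Z1 : z1 <= Z.
    by rewrite /Z (big_ltn n2) lerDl sumr_ge0// => k _; apply: addr_ge0; exact: ltW.
  have Z2 : Z <= 2 * dm * b n.
    by rewrite /Z big_split /= -mulrA mulr_natl mulr2n; exact: lerD.
  have h1 : 1 <= z1^-1 * Z by rewrite ler_pdivlMl// mulr1.
  have h2 : (1 + z1^-1) * Z <= (1 + z1^-1) * (2 * dm * b n).
    by apply: ler_wpM2l => //; rewrite addr_ge0// invr_ge0 ltW.
  rewrite -[_ * _ * b n]mulrA; apply: le_trans h2.
  by rewrite mulrDl mul1r addrC lerD2l.
pose kap := (2 * j.+1%:R * (`|Gamma (1 + alpha)| + 1) * Cq')^-1.
have kap0 : 0 < kap.
  rewrite /kap invr_gt0; apply: mulr_gt0 => //; do ?apply: mulr_gt0 => //.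
pose B := dl * h0 w2.
have B0 : 0 < B by rewrite /B mulr_gt0.
exists (Num.min (B * Ce / 8) (B * Cf * kap)).
  by rewrite lt_min divr_gt0 ?mulr_gt0.
move=> cs ct cs0 ct0 cs_lim cs_oo ct_lim ct_oo.
have minE (a1 a2 : R) (X : \bar R) : ((a1%:E <= X) -> ((Num.min a1 a2)%:E <= X))%E.
  by apply: le_trans; rewrite lee_fin ge_min lexx.
have minE' (a1 a2 : R) (X : \bar R) : ((a2%:E <= X) -> ((Num.min a1 a2)%:E <= X))%E.
  by apply: le_trans; rewrite lee_fin ge_min lexx orbT.
have BCe0 : 0 < B * Ce by rewrite mulr_gt0.
pose m := early_time cs N.
have early : \forall n \near \oo,
   [/\ (1 <= n)%N, (N + m n)%:R <= cs n * n%:R, 0 <= Ce * ((m n)%:R / b (m n) * (b n / n%:R)),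
     ((Ce * ((m n)%:R / b (m n) * (b n / n%:R)))%:E <= lebesgue_measure (word_union f0 f1 G0 (early_words (m n)) c (f1 (iter n f0 c0))))%E &
     ((Ce * ((m n)%:R / b (m n) * (b n / n%:R)))%:E <= lebesgue_measure (word_union f0 f1 G0 (early_words (m n)) (f0 (iter n f1 c1)) c))%E].
  have [N3 _ HN3] := HCe.
  near=> n.
  have n1 : (1 <= n)%N by near: n; exact: near_ge.
  have Nt : (N <= Num.truncn (cs n * n%:R))%N by near: n; exact: truncn_t_large.
  have m3 : (N3 <= m n)%N by near: n; exact: early_time_large.
  have m1 : (1 <= m n)%N by near: n; exact: early_time_large.
  have mn : (m n <= n)%N by near: n; exact: early_time_le_n.
  have [k1 k2] := HN3 (m n) m3 n mn.
  split=> //; first by have [] := early_time_le cs0 Nt.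
  have bm := bpos _ m1; have bn := bpos _ n1.
  apply: mulr_ge0; first exact: ltW.
  by apply: mulr_ge0; apply: divr_ge0 => //; exact: ltW.
have zoneR n : [/\ gamma <= c, c <= f1 (iter n f0 c0) & f1 (iter n f0 c0) <= T gamma].
  have [_ k2 k3 _] := entrance_right bp hc0 hc1 low1 n.
  have /andP[_ k4] := core_rightW bp n; split=> //; first exact/ltW/(bp_gamc bp).
  exact: le_trans k4.
have zoneL n : [/\ gamma <= f0 (iter n f1 c1), f0 (iter n f1 c1) <= c & c <= T gamma].
  have [k1 k2 _ _] := entrance_left bp hc0 hc1 low0 n.
  have /andP[k4 _] := core_leftW bp n; split=> //; last exact/ltW/(bp_cdel bp).
  exact: le_trans k1.
split.
- apply: minE; apply: (early_limit alpha01 hl cs0 cs_oo BCe0 (N := N)).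
  apply: filterS early => n [n1 tn pos rU _].
  have [z1 z2 z3] := zoneR n; rewrite -(mulrA B Ce); apply: (dens _ _ _ _ z1 z2 z3 _ _ pos rU).
  move=> z /(early_right_events bp hc0 hc1 Tf0 Tf1 rG)[h1 _] /=.
  rewrite ler_pdivrMr ?ltr0n//; apply: le_trans tn; by rewrite ler_nat.
- apply: minE'; apply: (few_returns_limit bpos _ eta0 Cq'0 ct0 ct_lim Q_bound (N := N)).
  + by rewrite mulr_gt0.
  + exact: ct_oo.
  + apply: filterS2 (near_ge 1) HCf => n n1 H s sn st.
    have [z1 z2 z3] := zoneR n; rewrite -(mulrA B Cf); apply: (dens _ _ _ _ z1 z2 z3 _ _ _ (H s sn)).
      move=> z /Hj h1 /=.
      have an0 : 0 < return_scale mu T alpha `[c0, c1] n%:R.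
        rewrite -(pmulr_rgt0 _ (ct0 n)); apply: lt_le_trans st; by rewrite ltr0n.
      by rewrite ler_pdivrMr//; apply: (le_trans h1).
    have bn := bpos _ n1; apply: mulr_ge0; first exact: ltW.
    by apply: mulr_ge0 => //; apply: divr_ge0 => //; exact: ltW.
- apply: minE; apply: (early_limit alpha01 hl cs0 cs_oo BCe0 (N := N)).
  apply: filterS early => n [n1 tn pos _ rU].
  have [z1 z2 z3] := zoneL n; rewrite -(mulrA B Ce); apply: (dens _ _ _ _ z1 z2 z3 _ _ pos rU).
  move=> z /(early_left_events bp hc0 hc1 Tf0 Tf1 rG) h1 /=.
  by rewrite ler_pdivrMr ?ltr0n//; apply: le_trans tn.
- apply: minE; apply: (early_limit alpha01 hl cs0 cs_oo BCe0 (N := N)).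
  apply: filterS early => n [n1 tn pos rU _].
  have [z1 z2 z3] := zoneR n; rewrite -(mulrA B Ce); apply: (dens _ _ _ _ z1 z2 z3 _ _ pos rU).
  move=> z /(early_right_events bp hc0 hc1 Tf0 Tf1 rG)[_ h1] /=.
  by rewrite ler_pdivrMr ?ltr0n//; apply: le_trans tn.
Unshelve. all: by end_near. Qed.
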